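(* 1. Every algebraic expansion of $Bal$ is $\tau_\mathcal{G}$-equipollent to exactly one of the following: the inconsistent logic, or $Bal^S$ for some set $S$ of prime numbers. 2. The algebraic expansions of $Bal$, modulo $\tau_\mathcal{G}$-equipollence and ordered by existence of $\tau_\mathcal{G}$-morphisms, form a lattice isomorphic with $\mathbf{2}^\omega\oplus\mathbf{1}$. 3. Given sets $S\subseteq S'$ of prime numbers, the expansion $Bal^{S'}$ is conservative over $Bal^S$.
   Context: $Bal$ (the Logic of Equilibrium) is the logic in connectives $\to$ (binary) and ${}^+$ (unary) with axioms $(\varphi\to\psi)\to((\theta\to\varphi)\to(\theta\to\psi))$, $(\varphi\to(\psi\to\theta))\to(\psi\to(\varphi\to\theta))$, $((\varphi\to\psi)\to\psi)\to\varphi$, $((\psi\to\varphi)^+\to(\varphi\to\psi)^+)\to(\varphi\to\psi)$, $\varphi^{++}\to\varphi^+$, and rules $\varphi,\varphi\to\psi\vdash\psi$; $\varphi,\psi\vdash\varphi\to\psi$; $\varphi\vdash\varphi^+$; $(\varphi\to\psi)^+\vdash(\varphi^+\to\psi^+)^+$. With derived connectives $0:=x\to x$, $-x:=x\to0$, $x+y:=-x\to y$, $x\vee y:=(x\to y)^++x$, $x\wedge y:=-(-x\vee-y)$ (a complete set, since $x\to y\dashv\vdash -x+y$ and $x^+\dashv\vdash x\vee 0$), $Bal$ is regarded as a logic in $\tau_\mathcal{G}:=\{+,-,0,\vee,\wedge\}$; it is algebraizable with equivalence formulas $\{x\to y\}$ and defining equation $x=0$, its equivalent algebraic semantics being the variety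 of Abelian $\ell$-groups. For a prime $p$ and a new unary connective $\mathsf d_p$, let $A_p$ be the axiom $x\to p\,\mathsf d_p(x)$ (where $p\,y$ is $y+\dots+y$, $p$ times); $Bal^S$ is the expansion of $Bal$ by the axioms $\{A_p:p\in S\}$. Algebraic expansions of an algebraizable logic $L$ with equivalence formulas $\Delta(x,y)$: for a finite set $\Phi(\bar x,\bar z)$ of formulas ($\bar x=x_1..x_n$, $\bar z=z_1..z_m$), $L^\Phi$ is the least logic containing $L$ with new $n$-ary connectives $f_1,\dots,f_m$ such that $\vdash\Phi(\bar x,f_1(\bar x),\dots,f_m(\bar x))$ and $\Phi(\bar x,\bar y),\Phi(\bar x,\bar z)\vdash\bigcup_j\Delta(y_j,z_j)$; for a set $\Sigma$ of such $\Phi$'s, $L^\Sigma$ is the least logic containing every $L^\Phi$ (distinct new connectives). A $\tau$-translation from an expansion $\tau_1$ of $\tau$ into an expansion $\tau_2$ maps each $n$-ary symbol of $\tau_1$ to a $\tau_2$-term in $x_1,\dots,x_n$, fixing symbols of $\tau$, extended homomorphically to formulas; it is a $\tau$-morphism from $L_1$ to $L_2$ if $\Gamma\vdash_{L_1}\varphi$ implies $T(\Gamma)\vdash_{L_2}T(\varphi)$; $L_1,L_2$ are $\tau$-equipollent if there are $\tau$-morphisms $T:L_1\to L_2$, $S:L_2\to L_1$ with $\varphi\dashv\vdash_{L_1}S(T(\varphi))$ and $\psi\dashv\vdash_{L_2}T(S(\psi))$ for all formulas. An expansion $L'$ of $L$ is conservative if $\Gamma\vdash_{L'}\varphi$ implies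 $\Gamma\vdash_L\varphi$ for all $L$-formulas $\Gamma\cup\{\varphi\}$. $\mathbf 2^\omega$ is the lattice of subsets of a countably infinite set, $\mathbf1$ the one-element lattice, $\oplus$ ordinal sum. *)

(* Defs.v *)
From mathcomp Require Import all_boot.
From mathcomp Require Import boolp classical_sets cardinality.

Set Implicit Arguments.
Unset Strict Implicit.
Unset Printing Implicit Defensive.

Local Open Scope classical_set_scope.

Record signature := Signature { sym :> Type; ar : sym -> nat }.

Inductive form (t : signature) (X : Type) : Type :=
| Var of X
| App (f : t) of ('I_(ar f) -> form t X).
Arguments Var {t X}.
Arguments App {t X} f.

Fixpoint subst (t : signature) (X Y : Type) (s : X -> form t Y)
    (phi : form t X) : form t Y :=
  match phi with
  | Var x => s x
  | App f a => App f (fun i => subst s (a i))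
  end.

Record logic (t : signature) := Logic {
  entails :> set (form t nat) -> form t nat -> Prop;
  entails_refl : forall (G : set (form t nat)) phi, G phi -> entails G phi;
  entails_cut : forall G D phi, (forall psi, D psi -> entails G psi) ->
    entails D phi -> entails G phi;
  entails_subst : forall (s : nat -> form t nat) G phi,
    entails G phi -> entails (subst s @` G) (subst s phi) }.

Definition interderivable (t : signature) (L : logic t) (phi psi : form t nat) :=
  L [set phi] psi /\ L [set psi] phi.

Section Generated.
Variables (t : signature) (R : set (form t nat) -> form t nat -> Prop).

Inductive derives (G : set (form t nat)) : form t nat -> Prop :=
| derives_hyp phi : G phi -> derives G phi
| derives_rule (s : nat -> form t nat) D phi : R D phi ->
    (forall psi, D psi -> derives G (subst s psi)) -> derives G (subst s phi).

Lemma subst_comp X Y Z (s : X -> form t Y) (s' : Y -> form t Z) (phi : form t X) :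
  subst s' (subst s phi) = subst (fun x => subst s' (s x)) phi.
Proof. by elim: phi => //= f a IH; congr App; apply/funext => i; apply: IH. Qed.

Lemma subst_var X (phi : form t X) : subst Var phi = phi.
Proof. by elim: phi => //= f a IH; congr App; apply/funext => i; apply: IH. Qed.

Lemma derives_cut G D phi : (forall psi, D psi -> derives G psi) ->
  derives D phi -> derives G phi.
Proof.
move=> GD; elim=> [psi /GD//|s E psi RE _ IH].
exact: derives_rule RE IH.
Qed.

Lemma derives_subst (s : nat -> form t nat) G phi :
  derives G phi -> derives (subst s @` G) (subst s phi).
Proof.
elim=> [psi Gp|s' E psi RE _ IH]; first by apply: derives_hyp; exists psi.
rewrite subst_comp; apply: derives_rule RE _ => chi Ec.
by rewrite -subst_comp; apply: IH.
Qed.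

Definition least_logic : logic t :=
  Logic derives_hyp derives_cut derives_subst.

Lemma least_logic_contains G phi : R G phi -> least_logic G phi.
Proof.
move=> RG; rewrite -[phi]subst_var; apply: derives_rule RG _ => psi Gp.
by rewrite subst_var; apply: derives_hyp.
Qed.

Lemma least_logic_min (L : logic t) : (forall G phi, R G phi -> L G phi) ->
  forall G phi, least_logic G phi -> L G phi.
Proof.
move=> RL G phi; elim=> [psi|s D psi /RL LD _ IH]; first exact: entails_refl.
apply: entails_cut (entails_subst s LD) => _ [chi Dc <-].
exact: IH.
Qed.

End Generated.

Definition two (T : Type) (a b : T) (i : 'I_2) : T :=
  if val i is 0 then a else b.

Definition expand (t r : signature) : signature :=
  Signature (fun f : t + r => match f with inl g => ar g | inr h => ar h end).

Definition empty_sig : signature := @Signature False (fun=> 0).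

Record sig_map (t1 t2 : signature) := SigMap {
  sig_fun :> t1 -> t2;
  sig_ar : forall f, ar (sig_fun f) = ar f }.

Fixpoint rename (t1 t2 : signature) (e : sig_map t1 t2) (X : Type)
    (phi : form t1 X) : form t2 X :=
  match phi with
  | Var x => Var x
  | App f a => App (e f) (fun i => rename e (a (cast_ord (sig_ar e f) i)))
  end.

Arguments rename {t1 t2} e {X}.

Definition base_map (t r : signature) : sig_map t (expand t r) :=
  @SigMap t (expand t r) inl (fun=> erefl).

Definition expand_map_fun (t r1 r2 : signature) (e : sig_map r1 r2)
    (f : expand t r1) : expand t r2 :=
  match f with inl g => inl g | inr h => inr (e h) end.

Lemma expand_map_ar t r1 r2 (e : sig_map r1 r2) (f : expand t r1) :
  ar (expand_map_fun e f) = ar f.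
Proof. by case: f => //= h; apply: sig_ar. Qed.

Definition expand_map (t r1 r2 : signature) (e : sig_map r1 r2) :
    sig_map (expand t r1) (expand t r2) :=
  SigMap (@expand_map_ar t r1 r2 e).

Definition is_expansion (t1 t2 : signature) (e : sig_map t1 t2)
    (L1 : logic t1) (L2 : logic t2) : Prop :=
  forall G phi, L1 G phi -> L2 (rename e @` G) (rename e phi).

Definition conservative (t1 t2 : signature) (e : sig_map t1 t2)
    (L1 : logic t1) (L2 : logic t2) : Prop :=
  forall G phi, L2 (rename e @` G) (rename e phi) -> L1 G phi.

Record expansion (t : signature) := Expansion {
  new_sig : signature;
  exp_logic :> logic (expand t new_sig) }.

(* Only the values on the new symbols are recorded, since a translation fixes
   the symbols of [t]; [form _ 'I_n] is the type of terms in [n] variables. *)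
Definition translation (t r1 r2 : signature) :=
  forall f : r1, form (expand t r2) 'I_(ar f).

Fixpoint translate (t r1 r2 : signature) (T : translation t r1 r2) (X : Type)
    (phi : form (expand t r1) X) : form (expand t r2) X :=
  match phi with
  | Var x => Var x
  | App f a =>
      match f return ('I_(@ar (expand t r1) f) -> form (expand t r2) X) ->
                     form (expand t r2) X with
      | inl g => fun b => @App (expand t r2) X (inl g) b
      | inr h => fun b => subst b (T h)
      end (fun i => translate T (a i))
  end.

Arguments translate {t r1 r2} T {X}.

Definition is_morphism (t : signature) (L1 L2 : expansion t)
    (T : translation t (new_sig L1) (new_sig L2)) : Prop :=
  forall G phi, L1 G phi -> L2 (translate T @` G) (translate T phi).

Definition has_morphism (t : signature) (L1 L2 : expansion t) : Prop :=
  exists T, @is_morphism t L1 L2 T.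

Definition equipollent (t : signature) (L1 L2 : expansion t) : Prop :=
  exists (T : translation t (new_sig L1) (new_sig L2))
         (S : translation t (new_sig L2) (new_sig L1)),
    [/\ is_morphism T, is_morphism S,
        forall phi, interderivable L1 phi (translate S (translate T phi)) &
        forall psi, interderivable L2 psi (translate T (translate S psi))].

(* A finite set Phi(x_1..x_n, z_1..z_m) of formulas: the variables x_i are
   the left injections and the z_j the right ones. *)
Record system (t : signature) := System {
  n_in : nat;
  n_out : nat;
  sys_forms :> set (form t ('I_n_in + 'I_n_out));
  sys_finite : finite_set sys_forms }.

Arguments sys_forms {t} s _.

Definition system_inst (t r : signature) (P : system t)
    (a : 'I_(n_in P) -> form (expand t r) nat)
    (b : 'I_(n_out P) -> form (expand t r) nat) : set (form (expand t r) nat) :=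
  [set subst (fun v => match v with inl i => a i | inr j => b j end)
             (rename (base_map t r) phi) | phi in sys_forms P].
Arguments system_inst {t r} P a b _.

Section AlgebraicExpansion.
Variables (t : signature) (L : logic t) (Delta : set (form t 'I_2)).

Definition system_sig (P : system t) : signature :=
  @Signature 'I_(n_out P) (fun=> n_in P).

Inductive system_rule (P : system t) :
    set (form (expand t (system_sig P)) nat) ->
    form (expand t (system_sig P)) nat -> Prop :=
| system_base G phi : L G phi ->
    system_rule (rename (base_map t (system_sig P)) @` G)
                (rename (base_map t (system_sig P)) phi)
| system_exists a phi :
    system_inst P a (fun j => @App (expand t (system_sig P)) nat (inr j) a) phi ->
    system_rule set0 phi
| system_unique a b c j delta : Delta delta ->
    system_rule (system_inst P a b `|` system_inst P a c)
      (subst (two (b j) (c j)) (rename (base_map t (system_sig P)) delta)).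

Definition system_expansion (P : system t) : logic (expand t (system_sig P)) :=
  least_logic (@system_rule P).

Variable Sigma : set (system t).

Definition family_sig : signature :=
  @Signature {P : {P | Sigma P} & 'I_(n_out (sval P))}
             (fun f => n_in (sval (projT1 f))).

Definition member_map (P : {P | Sigma P}) :
    sig_map (system_sig (sval P)) family_sig :=
  @SigMap (system_sig (sval P)) family_sig
    (fun j : 'I_(n_out (sval P)) => existT _ P j) (fun=> erefl).

Inductive family_rule :
    set (form (expand t family_sig) nat) -> form (expand t family_sig) nat ->
    Prop :=
| family_base G phi : L G phi ->
    family_rule (rename (base_map t family_sig) @` G)
                (rename (base_map t family_sig) phi)
| family_member P G phi : system_expansion (sval P) G phi ->
    family_rule (rename (expand_map t (member_map P)) @` G)
                (rename (expand_map t (member_map P)) phi).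

Definition algebraic_expansion : expansion t :=
  Expansion (least_logic family_rule).

End AlgebraicExpansion.

Inductive bal_sym := BImp | BPos.
Definition bal_sig : signature :=
  Signature (fun f => match f with BImp => 2 | BPos => 1 end).

Definition bform := form bal_sig nat.
Definition imp (a b : bform) : bform := @App bal_sig nat BImp (two a b).
Definition pos (a : bform) : bform := @App bal_sig nat BPos (fun=> a).

Inductive bal_rule : set bform -> bform -> Prop :=
| bal_B a b c : bal_rule set0 (imp (imp a b) (imp (imp c a) (imp c b)))
| bal_C a b c : bal_rule set0 (imp (imp a (imp b c)) (imp b (imp a c)))
| bal_N a b : bal_rule set0 (imp (imp (imp a b) b) a)
| bal_L a b :
    bal_rule set0 (imp (imp (pos (imp b a)) (pos (imp a b))) (imp a b))
| bal_P a : bal_rule set0 (imp (pos (pos a)) (pos a))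
| bal_mp a b : bal_rule [set a; imp a b] b
| bal_G a b : bal_rule [set a; b] (imp a b)
| bal_pos a : bal_rule [set a] (pos a)
| bal_mono a b : bal_rule [set pos (imp a b)] (pos (imp (pos a) (pos b))).

Definition Bal0 : logic bal_sig := least_logic bal_rule.

(* The constant 0 := x -> x needs a choice of x; all the formulas a -> a are
   interchangeable in the logic (see [Bal0_zero]). *)
Definition bzero : bform := imp (Var 0) (Var 0).
Definition bneg (a : bform) : bform := imp a bzero.
Definition badd (a b : bform) : bform := imp (bneg a) b.
Definition bjoin (a b : bform) : bform := badd (pos (imp a b)) a.
Definition bmeet (a b : bform) : bform := bneg (bjoin (bneg a) (bneg b)).

Inductive grp_sym := GAdd | GNeg | GZero | GJoin | GMeet.
Definition grp_sig : signature :=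
  Signature (fun f => match f with
                      | GAdd | GJoin | GMeet => 2
                      | GNeg => 1
                      | GZero => 0
                      end).

Fixpoint to_bal (phi : form grp_sig nat) : bform :=
  match phi with
  | Var x => Var x
  | App f a =>
      match f return ('I_(@ar grp_sig f) -> bform) -> bform with
      | GAdd => fun b : 'I_2 -> bform => badd (b ord0) (b ord_max)
      | GNeg => fun b : 'I_1 -> bform => bneg (b ord0)
      | GZero => fun=> bzero
      | GJoin => fun b : 'I_2 -> bform => bjoin (b ord0) (b ord_max)
      | GMeet => fun b : 'I_2 -> bform => bmeet (b ord0) (b ord_max)
      end (fun i => to_bal (a i))
  end.

Section Congruence.
Variable G : set bform.
Notation "|- a" := (Bal0 G a) (at level 70).

Lemma Bal0_ax a : bal_rule set0 a -> |- a.
Proof.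
move=> Ra; apply: entails_cut (least_logic_contains Ra) => psi [].
Qed.

Lemma Bal0_mp a b : |- a -> |- imp a b -> |- b.
Proof.
move=> Ha Hab; apply: entails_cut (least_logic_contains (bal_mp a b)).
by move=> psi [->|->].
Qed.

Lemma Bal0_G a b : |- a -> |- b -> |- imp a b.
Proof.
move=> Ha Hb; apply: entails_cut (least_logic_contains (bal_G a b)).
by move=> psi [->|->].
Qed.

Lemma Bal0_trans a b c : |- imp a b -> |- imp b c -> |- imp a c.
Proof.
move=> ab bc; apply: Bal0_mp ab _; apply: Bal0_mp bc _.
exact: Bal0_ax (bal_B _ _ _).
Qed.

Lemma Bal0_swap a b c : |- imp a (imp b c) -> |- imp b (imp a c).
Proof. by move=> h; apply: Bal0_mp h _; apply: Bal0_ax (bal_C _ _ _). Qed.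

Lemma Bal0_id a : |- imp a a.
Proof.
have h3 x y z : |- imp (imp x (imp y z)) (imp x (imp y z)).
  exact: Bal0_trans (Bal0_ax (bal_C _ _ _)) (Bal0_ax (bal_C _ _ _)).
exact: Bal0_trans (Bal0_swap (h3 a a a)) (Bal0_ax (bal_N _ _)).
Qed.

Definition beq a b := |- imp a b /\ |- imp b a.

Lemma beq_refl a : beq a a.
Proof. by split; apply: Bal0_id. Qed.

Lemma beq_imp a a' b b' : beq a a' -> beq b b' -> beq (imp a b) (imp a' b').
Proof.
suff h x x' y y' : |- imp x' x -> |- imp y y' -> |- imp (imp x y) (imp x' y').
  by move=> [? ?] [? ?]; split; apply: h.
move=> hx hy; apply: (@Bal0_trans _ (imp x' y)).
  by apply: Bal0_mp hx _; apply: Bal0_swap; apply: Bal0_ax (bal_B _ _ _).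
by apply: Bal0_mp hy _; apply: Bal0_ax (bal_B _ _ _).
Qed.

Lemma beq_pos a a' : beq a a' -> beq (pos a) (pos a').
Proof.
have h x y : |- imp x y -> |- pos (imp (pos x) (pos y)).
  move=> hxy; have hp : |- pos (imp x y).
    by apply: entails_cut (least_logic_contains (bal_pos (imp x y))) => psi ->.
  by apply: entails_cut (least_logic_contains (bal_mono x y)) => psi ->.
move=> [/h h1 /h h2]; split.
  by apply: Bal0_mp (Bal0_G h2 h1) _; apply: Bal0_ax (bal_L _ _).
by apply: Bal0_mp (Bal0_G h1 h2) _; apply: Bal0_ax (bal_L _ _).
Qed.

Lemma Bal0_zero a b : beq (imp a a) (imp b b).
Proof. by split; apply: Bal0_G; apply: Bal0_id. Qed.

Lemma subst_imp s a b : subst s (imp a b) = imp (subst s a) (subst s b).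
Proof. by congr App; apply/funext => -[[|[|]]]. Qed.

Lemma subst_pos s a : subst s (pos a) = pos (subst s a).
Proof. by []. Qed.

Lemma subst_to_bal (s : nat -> form grp_sig nat) phi :
  beq (subst (to_bal \o s) (to_bal phi)) (to_bal (subst s phi)).
Proof.
elim: phi => [x|f a IH] /=; first exact: beq_refl.
case: f a IH => a IH;
  rewrite /bmeet /bjoin /badd /bneg /bzero ?(subst_imp, subst_pos) /=;
  by repeat first [exact: IH | exact: Bal0_zero | apply: beq_imp | apply: beq_pos].
Qed.

End Congruence.

Definition Bal_entails (G : set (form grp_sig nat)) (phi : form grp_sig nat) :=
  Bal0 (to_bal @` G) (to_bal phi).

Lemma Bal_refl (G : set (form grp_sig nat)) phi : G phi -> Bal_entails G phi.
Proof. by move=> Gp; apply: entails_refl; exists phi. Qed.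

Lemma Bal_cut G D phi : (forall psi, D psi -> Bal_entails G psi) ->
  Bal_entails D phi -> Bal_entails G phi.
Proof. by move=> GD; apply: entails_cut => _ [psi Dp <-]; apply: GD. Qed.

Lemma Bal_subst (s : nat -> form grp_sig nat) G phi :
  Bal_entails G phi -> Bal_entails (subst s @` G) (subst s phi).
Proof.
move=> /(entails_subst (to_bal \o s)) h.
set H := to_bal @` (subst s @` G).
have [hphi _] := subst_to_bal H s phi.
apply: Bal0_mp hphi; apply: entails_cut h => _ [_ [psi Gp <-] <-].
have [_ hpsi] := subst_to_bal H s psi.
apply: Bal0_mp hpsi; apply: entails_refl.
by exists (subst s psi) => //; exists psi.
Qed.

Definition Bal : logic grp_sig := Logic Bal_refl Bal_cut Bal_subst.

(* The equivalence formula x -> y, which in the group signature is -x + y. *)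
Definition gimp : form grp_sig 'I_2 :=
  @App grp_sig _ GAdd
    (two (@App grp_sig _ GNeg (fun=> Var ord0)) (Var ord_max)).

Definition Bal_ae (Sigma : set (system grp_sig)) : expansion grp_sig :=
  algebraic_expansion Bal [set gimp] Sigma.

Definition inconsistent_exp : expansion grp_sig :=
  @Expansion _ empty_sig
    (@Logic (expand grp_sig empty_sig) (fun _ _ => True)
       (fun _ _ _ => I) (fun _ _ _ _ _ => I) (fun _ _ _ _ => I)).

Section Divisibility.
Variable S : set nat.

Definition div_sig : signature := @Signature {p : nat | S p} (fun=> 1).

Definition divf := form (expand grp_sig div_sig) nat.

Definition div_app (p : {p | S p}) (x : divf) : divf :=
  @App (expand grp_sig div_sig) nat (inr p) (fun=> x).

Definition div_add (x y : divf) : divf :=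
  @App (expand grp_sig div_sig) nat (inl GAdd) (two x y).

(* [iter p.-1] because the iteration starts from one copy of [y]; this is the
   p-fold sum for [p > 0]. *)
Definition div_mul (p : nat) (y : divf) : divf := iter p.-1 (div_add y) y.

Definition div_axiom (p : {p | S p}) (x : divf) : divf :=
  subst (two x (div_mul (sval p) (div_app p x)))
        (rename (base_map grp_sig div_sig) gimp).

Inductive div_rule : set divf -> divf -> Prop :=
| div_base G phi : Bal G phi ->
    div_rule (rename (base_map grp_sig div_sig) @` G)
             (rename (base_map grp_sig div_sig) phi)
| div_ax p x : div_rule set0 (div_axiom p x).

Definition BalS : expansion grp_sig := Expansion (least_logic div_rule).

End Divisibility.

Definition div_map (S S' : set nat) (sub : S `<=` S') :
    sig_map (div_sig S) (div_sig S') :=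
  @SigMap (div_sig S) (div_sig S')
    (fun p : {p | S p} => exist S' (sval p) (sub _ (svalP p))) (fun=> erefl).

Definition primes_set : set nat := [set p | prime p].

Definition Bal_ae_class : Type :=
  {C : set (set (system grp_sig)) | exists Sigma,
     C = [set Sigma' | equipollent (Bal_ae Sigma) (Bal_ae Sigma')]}.

Definition Bal_ae_le (C D : Bal_ae_class) : Prop :=
  exists Sigma Sigma', [/\ sval C Sigma, sval D Sigma' &
    has_morphism (Bal_ae Sigma) (Bal_ae Sigma')].

Definition is_partial_order (T : Type) (le : T -> T -> Prop) : Prop :=
  [/\ forall x, le x x,
      forall x y, le x y -> le y x -> x = y &
      forall x y z, le x y -> le y z -> le x z].

Definition is_lattice (T : Type) (le : T -> T -> Prop) : Prop :=
  [/\ is_partial_order le,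
      forall x y, exists j, [/\ le x j, le y j &
        forall z, le x z -> le y z -> le j z] &
      forall x y, exists m, [/\ le m x, le m y &
        forall z, le z x -> le z y -> le z m]].

Definition ordinal_sum (A B : Type) (leA : A -> A -> Prop)
    (leB : B -> B -> Prop) (x y : A + B) : Prop :=
  match x, y with
  | inl a, inl a' => leA a a'
  | inl _, inr _ => True
  | inr _, inl _ => False
  | inr b, inr b' => leB b b'
  end.

Definition order_isomorphic (A B : Type) (leA : A -> A -> Prop)
    (leB : B -> B -> Prop) : Prop :=
  exists f : A -> B, bijective f /\ forall x y, leA x y <-> leB (f x) (f y).

Definition pow_omega_top_le : set nat + unit -> set nat + unit -> Prop :=
  ordinal_sum (fun A B => A `<=` B) (fun _ _ => True).

(* Main.v *)
(** Everything is decided over the ordered group of rationals.  Consequence in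
    Bal from finitely many premises is consequence in Q: a theory maximal among
    those not proving a formula has a totally ordered Lindenbaum l-group, and
    Fourier-Motzkin elimination moves a finite sign pattern from such a group
    to Q.  Replacing terms [d_p a] by variables extends this to Bal^S, whence
    conservativity.

    If an algebraic expansion is consistent, homogeneity of l-group terms
    transfers "for all x there is a unique z with Phi(x, z)" to Q.  The
    solution map F is piecewise linear.  Let S be the set of primes dividing
    denominators of values of F at integer points.  Each p in S makes division
    by p definable from F and the integers by Bezout.  Conversely, linear
    pieces of F which are not redundant have coefficients in Z[1/S], because
    differences of values of F at integer points recover them, and F is the
    minimum over the pieces L of [L x + K err_L x], where [err_L x] measures
    the failure of Phi(x, L x); so F is a term of Bal^S.  The set S is an
    invariant since terms of Bal^S preserve Z[1/S].  Morphisms in both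
    directions already give equipollence, since the new connectives are
    implicitly defined and every morphism of such a logic to itself is the
    identity up to provable equality. *)

From HB Require Import structures.
From mathcomp Require Import all_boot all_order all_algebra.
From mathcomp Require Import boolp classical_sets functions cardinality.
From mathcomp Require Import lra ring.
Require Import Defs.

Set Implicit Arguments.
Unset Strict Implicit.
Unset Printing Implicit Defensive.

Import Order.TTheory GRing.Theory Num.Theory.

(** The obstacle is that the new connectives have no prescribed meaning: an algebraic expansion only
    proves that [f(x)] solves Phi and that solutions coincide. No model of it is built. Each
    consequence needed in it is obtained by treating the terms [f(a)] as fresh variables subject to
    Phi and checking a quasi-identity over Q ([Bal_instance]).

    L-group terms are homogeneous for nonnegative factors only. To reach a rational point from
    inside the logic, it is multiplied by a common denominator times [g = v^+] for a variable [v];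
    its coordinates become integer multiples of [g], which are terms. A point with no solution, or
    with two, then yields a proof of [v^+], and substituting [-v] yields [v] itself, that is,
    inconsistency. For the same reason division by p is defined separately on positive and negative
    parts.

    The constant K exists because a consequence of Bal does more than preserve zeros: the ideal
    argument behind soundness bounds the conclusion by a fixed multiple of the sum of the absolute
    values of the premises. *)

HB.instance Definition _ (t : signature) (X : Type) := gen_eqMixin (form t X).
HB.instance Definition _ (t : signature) (X : Type) :=
  gen_choiceMixin (form t X).

(** * Evaluation of formulas in algebras *)

Section Evaluation.
Variables (t : signature) (D : Type).
Variable M : forall f : t, ('I_(ar f) -> D) -> D.

Fixpoint eval (X : Type) (e : X -> D) (phi : form t X) : D :=
  match phi with
  | Var x => e x
  | App f a => M (fun i => eval e (a i))
  end.

Lemma eval_subst (X Y : Type) (s : X -> form t Y) (e : Y -> D) phi :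
  eval e (subst s phi) = eval (eval e \o s) phi.
Proof.
elim: phi => //= f a IH; congr (M _); apply/funext => i; exact: IH.
Qed.

End Evaluation.

Lemma eval_rename (t1 t2 : signature) (m : sig_map t1 t2) (D : Type)
    (M1 : forall f : t1, ('I_(ar f) -> D) -> D)
    (M2 : forall f : t2, ('I_(ar f) -> D) -> D) :
  (forall f b, M2 (m f) (b \o cast_ord (sig_ar m f)) = M1 f b) ->
  forall (X : Type) (e : X -> D) (phi : form t1 X),
    eval M2 e (rename m phi) = eval M1 e phi.
Proof.
move=> M12 X e; elim=> //= f a IH; rewrite -M12; congr (M2 _ _).
by apply/funext => i; rewrite IH.
Qed.

(** The generated induction principle presents arguments as functions on ordinals; extensionality
    brings them back to [imp] and [pos]. *)
Lemma bform_ind (P : bform -> Prop) :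
  (forall x, P (Var x)) -> (forall a b, P a -> P b -> P (imp a b)) ->
  (forall a, P a -> P (pos a)) -> forall a, P a.
Proof.
move=> PV PI PP; elim=> [//|[] a IH].
  suff -> : @App bal_sig nat BImp a = imp (a ord0) (a ord_max) by exact: PI.
  congr App; apply/funext => -[[|[|]]] //= ?; rewrite /two /=;
    by congr a; apply: val_inj.
suff -> : @App bal_sig nat BPos a = pos (a ord0) by exact: PP.
by congr App; apply/funext => i; rewrite (ord1 i).
Qed.

(** * Abelian l-groups as algebras of Bal *)

Section BalAlgebra.
Local Open Scope ring_scope.
Variables (A : zmodType) (ps : A -> A).

Definition bal_interp (f : bal_sig) : ('I_(ar f) -> A) -> A :=
  match f return ('I_(@ar bal_sig f) -> A) -> A with
  | BImp => fun a => a ord_max - a ord0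
  | BPos => fun a => ps (a ord0)
  end.

Definition beval (X : Type) := @eval bal_sig A bal_interp X.

(** An Abelian l-group presented by its positive-part map alone. The conditions are what the axioms
    and rules on [pos] say when [x -> y] is read as [y - x] and theorems as 0; the order is
    recovered in [ple]. *)
Record bal_algebra : Prop := BalAlgebra {
  ps0 : ps 0 = 0;
  psK : forall a, ps (ps a) = ps a;
  psB : forall a, ps a - ps (- a) = a;
  ps_mono : forall a b, ps (b - a) = 0 -> ps (ps b - ps a) = 0 }.

(** The closure conditions mirror the rules of Bal, so the designated set may be larger than 0.
    Principal convex ideals then turn provability into quantitative bounds. *)
Record bal_ideal (I : A -> Prop) : Prop := BalIdeal {
  ideal0 : I 0;
  idealB : forall a b, I a -> I b -> I (b - a);
  ideal_ps : forall a, I a -> I (ps a);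
  ideal_mono : forall a b, I (ps (b - a)) -> I (ps (ps b - ps a)) }.

Lemma beval_imp e a b : beval e (imp a b) = beval e b - beval e a :> A.
Proof. by []. Qed.

Lemma beval_pos e a : beval e (pos a) = ps (beval e a).
Proof. by []. Qed.

Lemma bal_ideal_sound (I : A -> Prop) (e : nat -> A) G phi :
  bal_algebra -> bal_ideal I -> (forall g, G g -> I (beval e g)) ->
  Bal0 G phi -> I (beval e phi).
Proof.
move=> AA II GI; elim=> [g /GI//|s D psi RD _].
rewrite /beval eval_subst -!/(@beval _) => IH.
have {}IH chi : D chi -> I (beval (beval e \o s) chi).
  by move=> /IH; rewrite /beval eval_subst.
move: (beval e \o s) IH; clear GI e => e IH; have I0 := ideal0 II.
have Ieq x : x = 0 -> I x by move=> ->.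
case: RD IH => [a b c|a b c|a b|a b|a|a b|a b|a|a b] IH;
  rewrite ?(beval_imp, beval_pos).
- apply: Ieq. by rewrite (opprB (beval e a)) addrA subrK subrr.
- by apply: Ieq; rewrite [X in X - _]addrAC subrr.
- by apply: Ieq; rewrite opprB addrA [X in X - _]addrC subrK subrr.
- by apply: Ieq; rewrite -(opprB (beval e b)) psB // subrr.
- by apply: Ieq; rewrite psK // subrr.
- have Ia := IH a (or_introl erefl).
  have Iab : I (beval e b - beval e a) := IH (imp a b) (or_intror erefl).
  have := idealB II (idealB II Ia I0) Iab.
  by rewrite sub0r opprK subrK.
- exact: (idealB II (IH a (or_introl erefl)) (IH b (or_intror erefl))).
- exact: (ideal_ps II (IH a erefl)).
- exact: (ideal_mono II (IH (pos (imp a b)) erefl)).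
Qed.

(** * Order, principal ideals and disjointness in an l-group *)

Definition ple a b := ps (a - b) = 0.

Section Order.
Hypothesis AA : bal_algebra.

Lemma ple_refl a : ple a a.
Proof. by rewrite /ple subrr ps0. Qed.

Lemma ple_addr c a b : ple a b -> ple (a + c) (b + c).
Proof. by rewrite /ple opprD addrACA subrr addr0. Qed.

Lemma ple_anti a b : ple a b -> ple b a -> a = b.
Proof.
rewrite /ple -[b - a]opprB => h1 h2; apply/eqP; rewrite -subr_eq0.
by rewrite -(psB AA (a - b)) h1 h2 subrr.
Qed.

(* [u <= 0] is [ps u = 0]; if also [v <= 0] then [u + v <= v], and monotonicity
   of [ps] gives [ps (u + v) <= ps v = 0]. *)
Lemma ple_trans b a c : ple a b -> ple b c -> ple a c.
Proof.
rewrite /ple => h1 h2; have := @ps_mono AA (b - c) (a - c).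
have -> : (a - c) - (b - c) = a - b by rewrite opprB addrA subrK.
by move=> /(_ h1); rewrite h2 subr0 psK.
Qed.

Lemma ple_add a b c d : ple a b -> ple c d -> ple (a + c) (b + d).
Proof.
move=> ab cd; apply: (ple_trans (ple_addr c ab)).
by rewrite ![b + _]addrC; apply: ple_addr.
Qed.

Lemma ple_opp a b : ple a b -> ple (- b) (- a).
Proof. by rewrite /ple opprK addrC. Qed.

Lemma ple_ps a b : ple a b -> ple (ps a) (ps b).
Proof. exact: ps_mono. Qed.

Lemma ps_ge0 a : ple 0 (ps a).
Proof.
rewrite /ple sub0r; have := psB AA (ps a); rewrite psK //.
by move/eqP; rewrite subr_eq addrC -subr_eq subrr eq_sym => /eqP.
Qed.

Lemma ple_ps_id a : ple a (ps a).
Proof.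
have := ps_ge0 (- a); rewrite /ple sub0r => <-; congr (ps _).
by rewrite -{1}(psB AA a) addrAC subrr sub0r.
Qed.

Lemma ge0_ps a : ple 0 a -> ps a = a.
Proof. by rewrite /ple sub0r -{3}(psB AA a) => ->; rewrite subr0. Qed.

Lemma ple_ps_lub a c : ple a c -> ple 0 c -> ple (ps a) c.
Proof. by move=> ac /ge0_ps c0; rewrite -c0; apply: ple_ps. Qed.

Lemma ple_mulrn a b k : ple a b -> ple (a *+ k) (b *+ k).
Proof.
move=> ab; elim: k => [|k IH]; first exact: ple_refl.
by rewrite !mulrS; apply: ple_add.
Qed.

Lemma ple_mulrn_ge0 a k : ple 0 a -> ple 0 (a *+ k).
Proof. by move=> /(ple_mulrn k); rewrite mul0rn. Qed.

Lemma ple_subl a b c : ple (a - c) b = ple a (b + c).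
Proof. by rewrite /ple opprD addrA addrAC. Qed.

Lemma ple_subr a b c : ple a (b - c) = ple (a + c) b.
Proof. by rewrite /ple opprB addrA addrAC. Qed.

Definition bounded_by u a := exists k, ple a (u *+ k) /\ ple (- a) (u *+ k).

(** The clause for monotonicity is the substantial one: from [(b - a)^+ <= k u] follows
    [b <= k u + a^+], whose right side is nonnegative, hence [b^+ - a^+ <= k u]. *)
Lemma bounded_by_ideal u : ple 0 u -> bal_ideal (bounded_by u).
Proof.
move=> u0; split.
- by exists 0%N; rewrite oppr0; split; apply: ple_refl.
- move=> a b [k [ak ak']] [l [bl bl']]; exists (l + k)%N; rewrite mulrnDr.
  split; first exact: ple_add.
  by rewrite opprB addrC; apply: ple_add.
- move=> a [k [ak _]]; exists k; have uk := ple_mulrn_ge0 k u0; split.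
    exact: ple_ps_lub.
  apply: (@ple_trans 0) => //.
  by rewrite -oppr0; apply: ple_opp; apply: ps_ge0.
- move=> a b [k [abk _]]; exists k; have uk := ple_mulrn_ge0 k u0; split; last first.
    apply: (@ple_trans 0) => //.
    by rewrite -oppr0; apply: ple_opp; apply: ps_ge0.
  apply: ple_ps_lub => //; rewrite ple_subl; apply: ple_ps_lub; last first.
    by rewrite -[0]addr0; apply: ple_add => //; apply: ps_ge0.
  rewrite -[b](subrK a); apply: ple_add; last exact: ple_ps_id.
  exact: (ple_trans (ple_ps_id _)).
Qed.

(** Expresses that the meet of [p] and [q] is at most 0 without having meets. *)
Definition disjoint_pos p q := forall v, ple v p -> ple v q -> ple v 0.

Lemma disjoint_posC p q : disjoint_pos p q -> disjoint_pos q p.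
Proof. by move=> h v vq vp; apply: h. Qed.

(** If [v <= p] and [v <= (k+1) q], then [v - q] is below both [p] and [k q], so [v <= q] by
    induction. *)
Lemma disjoint_pos_mulrn p q k :
  ple 0 q -> disjoint_pos p q -> disjoint_pos p (q *+ k).
Proof.
move=> q0 pq; elim: k => [|k IH] v vp; first by rewrite mulr0n.
rewrite mulrS addrC -ple_subl => vqk; apply: pq => //.
rewrite -[q]add0r -ple_subl; apply: IH => //; apply: ple_trans vp.
by rewrite ple_subl -{1}[v]addr0; apply: ple_add; first exact: ple_refl.
Qed.

(** Since [(-t)^+ = t^+ - t], a common lower bound [v] makes [t^+ - v] an upper bound of both [t]
    and 0, hence of [t^+]. *)
Lemma disjoint_ps t : disjoint_pos (ps t) (ps (- t)).
Proof.
have -> : ps (- t) = ps t - t.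
  by rewrite -{3}(psB AA t) opprB [RHS]addrC subrK.
move=> v vp; rewrite ple_subr => vq.
have : ple (ps t) (ps t - v).
  apply: ple_ps_lub; first by rewrite ple_subr addrC.
  by rewrite ple_subr add0r.
by rewrite ple_subr -[X in ple _ X]add0r addrC -ple_subl addrK.
Qed.

Lemma bounded_by_ps0 t s :
  bounded_by (ps t) s -> bounded_by (ps (- t)) s -> s = 0.
Proof.
move=> [k [sk sk']] [l [sl sl']].
have D : disjoint_pos (ps t *+ k) (ps (- t) *+ l).
  apply: disjoint_pos_mulrn; first exact: ps_ge0.
  apply: disjoint_posC; apply: disjoint_pos_mulrn; first exact: ps_ge0.
  by apply: disjoint_posC; apply: disjoint_ps.
apply: ple_anti; first exact: D.
by rewrite -[s]opprK -oppr0; apply: ple_opp; apply: D.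
Qed.

End Order.
End BalAlgebra.

(** * Lindenbaum algebras and prime theories *)

(** Monotonicity of [R] lets one concatenated list serve all members of [s]; this collects the
    finitely many premises used by the premises of a rule. *)
Lemma seq_choice (T U : eqType) (s : seq T) (Q : U -> Prop)
    (R : T -> set U -> Prop) :
  (forall x A B, A `<=` B -> R x A -> R x B)%classic ->
  (forall x, x \in s -> exists2 r : seq U,
     (forall y, y \in r -> Q y) & R x [set` r]%classic) ->
  exists2 r : seq U,
    (forall y, y \in r -> Q y) & forall x, x \in s -> R x [set` r]%classic.
Proof.
move=> Rmono; elim: s => [|x s IH] H; first by exists [::].
have [r1 Q1 R1] := H x (mem_head _ _).
have [y ys|r2 Q2 R2] := IH; first by apply: H; rewrite inE ys orbT.
exists (r1 ++ r2) => [y|y]; first by rewrite mem_cat => /orP[/Q1|/Q2].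
rewrite inE => /orP[/eqP ->|/R2 {}R2].
  by apply: Rmono R1 => z /=; rewrite mem_cat => ->.
by apply: Rmono R2 => z /=; rewrite mem_cat => ->; rewrite orbT.
Qed.

Definition finitary (t : signature) (L : logic t) : Prop :=
  forall G phi, L G phi -> exists2 r : seq (form t nat),
    (forall g, g \in r -> G g) & L [set` r]%classic phi.

Lemma entails_mono (t : signature) (L : logic t) G H phi :
  (G `<=` H)%classic -> L G phi -> L H phi.
Proof. by move=> GH; apply: entails_cut => g /GH; apply: entails_refl. Qed.

Lemma least_logic_finitary (t : signature) R :
  (forall D phi, R D phi -> exists2 r : seq (form t nat),
     (forall g, g \in r -> D g) & least_logic R [set` r]%classic phi) ->
  finitary (least_logic R).
Proof.
move=> Rfin G phi; elim=> [g Gg|s D psi /Rfin [r rD Lr] _ IH].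
  exists [:: g] => [h|]; first by rewrite inE => /eqP ->.
  by apply: entails_refl; rewrite /= inE.
have [//|g /rD /IH //|r' r'G Lr'] := @seq_choice _ _ r G
  (fun g D => least_logic R D (subst s g)).
  by move=> x A B; apply: entails_mono.
exists r' => //.
apply: entails_cut (entails_subst s Lr) => _ [g rg <-]; exact: Lr'.
Qed.

Lemma Bal0_finitary : finitary Bal0.
Proof.
apply: least_logic_finitary => D phi RD.
suff [r Dr] : exists r : seq bform, D = [set` r]%classic.
  exists r => [g rg|]; first by rewrite Dr.
  by rewrite -Dr; apply: least_logic_contains.
have E0 : exists r : seq bform, set0 = [set` r]%classic.
  by exists [::]; apply/seteqP; split.
have E1 a : exists r : seq bform, [set a]%classic = [set` r]%classic.
  by exists [:: a]; apply/seteqP; split=> x /=; rewrite inE => /eqP.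
have E2 a b : exists r : seq bform, [set a; b]%classic = [set` r]%classic.
  exists [:: a; b]; apply/seteqP; split=> x /=; rewrite !inE.
    by case=> ->; rewrite eqxx ?orbT.
  by case/orP => /eqP ->; [left|right].
by case: RD.
Qed.

Section Lindenbaum.
Local Open Scope ring_scope.
Variable G : set bform.

Lemma beq_sym a b : beq G a b -> beq G b a.
Proof. by case. Qed.

Lemma beq_trans b a c : beq G a b -> beq G b c -> beq G a c.
Proof. by move=> [? ?] [? ?]; split; apply: (@Bal0_trans _ _ b). Qed.

Definition lind : Type :=
  {X : set bform | exists a, X = [set b | beq G a b]%classic}.

Definition lcls (a : bform) : lind := exist _ _ (ex_intro _ a erefl).

Lemma lcls_eq a b : lcls a = lcls b <-> beq G a b.
Proof.
split=> [/(congr1 sval) /= E|E]; last first.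
  rewrite /lcls; apply: eq_exist; apply/seteqP; split=> c /=; last exact: beq_trans.
  exact/beq_trans/beq_sym.
have : [set c | beq G b c]%classic b by exact: beq_refl.
by rewrite -E.
Qed.

Definition lrep (x : lind) : bform := projT1 (cid (svalP x)).

Lemma lrepK x : lcls (lrep x) = x.
Proof.
rewrite /lrep; case: cid => a /=; case: x => X p /= E; exact: eq_exist.
Qed.

Lemma lind_ind (P : lind -> Prop) : (forall a, P (lcls a)) -> forall x, P x.
Proof. by move=> H x; rewrite -[x]lrepK. Qed.

Definition limp (x y : lind) := lcls (imp (lrep x) (lrep y)).
Definition lpos (x : lind) := lcls (pos (lrep x)).

Lemma limpE a b : limp (lcls a) (lcls b) = lcls (imp a b).
Proof. by apply/lcls_eq; apply: beq_imp; apply/lcls_eq; rewrite lrepK. Qed.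

Lemma lposE a : lpos (lcls a) = lcls (pos a).
Proof. by apply/lcls_eq; apply: beq_pos; apply/lcls_eq; rewrite lrepK. Qed.

HB.instance Definition _ := gen_eqMixin lind.
HB.instance Definition _ := gen_choiceMixin lind.

Definition lzero := lcls bzero.
Definition lopp x := limp x lzero.
Definition ladd x y := limp (lopp x) y.

Lemma limp_xx x : limp x x = lzero.
Proof.
by elim/lind_ind: x => a; rewrite limpE; apply/lcls_eq; apply: Bal0_zero.
Qed.

Lemma limp_swap x y z : limp x (limp y z) = limp y (limp x z).
Proof.
elim/lind_ind: x => a; elim/lind_ind: y => b; elim/lind_ind: z => c.
by rewrite !limpE; apply/lcls_eq; split; apply: Bal0_ax (bal_C _ _ _).
Qed.

Lemma limpK x y : limp (limp x y) y = x.
Proof.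
elim/lind_ind: x => a; elim/lind_ind: y => b.
rewrite !limpE; apply/lcls_eq; split; first exact: Bal0_ax (bal_N _ _).
by apply: Bal0_swap; apply: Bal0_id.
Qed.

Lemma ladd_swap x y z : ladd x (ladd y z) = ladd y (ladd x z).
Proof. exact: limp_swap. Qed.

(** With [y] written as [(y -> 0) -> 0], the swap law exchanges the premises [-x] and [-y]. *)
Lemma laddC : commutative ladd.
Proof. by move=> x y; rewrite -{1}[y](limpK _ lzero) /ladd limp_swap limpK. Qed.

Lemma laddA : associative ladd.
Proof. by move=> x y z; rewrite [ladd y z]laddC ladd_swap laddC. Qed.

Lemma ladd0 : left_id lzero ladd.
Proof. by move=> x; rewrite /ladd /lopp limp_xx -{1}(limp_xx x) limpK. Qed.

Lemma laddN : left_inverse lzero lopp ladd.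
Proof. by move=> x; rewrite /ladd /lopp limpK limp_xx. Qed.

HB.instance Definition _ :=
  GRing.isZmodule.Build lind laddA laddC ladd0 laddN.

Lemma limpB x y : limp x y = y - x.
Proof.
rewrite [RHS]addrC; change (limp x y = ladd (lopp x) y).
by rewrite /ladd /lopp limpK.
Qed.

Lemma lcls0 a : lcls a = 0 <-> Bal0 G a.
Proof.
change (lcls a = lzero <-> Bal0 G a); split => [/lcls_eq [_ h]|h].
  by apply: Bal0_mp h; apply: Bal0_id.
by apply/lcls_eq; split; apply: Bal0_G => //; apply: Bal0_id.
Qed.

Lemma lcls_eq_imp a b : lcls a = lcls b <-> Bal0 G (imp a b).
Proof.
rewrite -lcls0 -limpE limpB; split=> [->|/eqP]; first exact: subrr.
by rewrite subr_eq0 => /eqP ->.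
Qed.

Lemma lind_algebra : bal_algebra lpos.
Proof.
split.
- change (lpos lzero = 0); rewrite lposE; apply/lcls0.
  have h : Bal0 G bzero by exact: Bal0_id.
  by apply: entails_cut (least_logic_contains (bal_pos bzero)) => _ ->.
- elim/lind_ind => a; rewrite !lposE; apply/lcls_eq_imp.
  exact: Bal0_ax (bal_P a).
- elim/lind_ind => a; have := @Bal0_ax G _ (bal_L bzero a).
  move=> /lcls_eq_imp; rewrite -!(limpE, lposE) !limpB.
  by rewrite subrr subr0 sub0r.
- elim/lind_ind => a; elim/lind_ind => b.
  rewrite (lposE a) (lposE b) -!limpB (limpE a b) (limpE (pos a)).
  rewrite (lposE (imp a b)) (lposE (imp (pos a) (pos b))) => /lcls0 h.
  apply/lcls0.
  by apply: entails_cut (least_logic_contains (bal_mono a b)) => _ ->.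
Qed.

Lemma beval_lcls phi : beval lpos (lcls \o Var) phi = lcls phi.
Proof.
elim/bform_ind: phi => // [a b IHa IHb|a IH].
  by rewrite beval_imp IHa IHb -limpE limpB.
by rewrite beval_pos IH lposE.
Qed.

(* Adding [pos t] to [G] proves only elements bounded by multiples of [t^+],
   and [t^+], [(-t)^+] are disjoint. *)
Lemma Bal0_cases t phi :
  Bal0 (G `|` [set pos t])%classic phi ->
  Bal0 (G `|` [set pos (bneg t)])%classic phi -> Bal0 G phi.
Proof.
have AA := lind_algebra.
have key u : Bal0 (G `|` [set pos u])%classic phi ->
    bounded_by lpos (lpos (lcls u)) (lcls phi).
  have u0 := ps_ge0 AA (lcls u).
  move=> /(bal_ideal_sound (e := lcls \o Var) AA (bounded_by_ideal AA u0)).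
  rewrite beval_lcls; apply=> g; rewrite beval_lcls => -[Gg|->].
    have /lcls0 -> : Bal0 G g by exact: entails_refl.
    exact: ideal0 (bounded_by_ideal AA u0).
  exists 1%N; rewrite mulr1n -lposE; split; first exact: ple_refl.
  apply: (ple_trans AA (b := 0)) => //.
  by rewrite -oppr0; apply: ple_opp.
have E : lcls (bneg t) = - lcls t by rewrite /bneg -limpE limpB; apply: sub0r.
move=> /key h1 /key; rewrite E => h2.
by apply/lcls0; apply: bounded_by_ps0 AA _ _ h1 h2.
Qed.

End Lindenbaum.

(** Zorn's lemma gives a maximal set of extra premises that keeps [phi] unprovable. If neither
    [pos t] nor [pos (bneg t)] followed from it, adding either one would prove [phi], against
    [Bal0_cases]. *)
Lemma Bal0_prime G phi : ~ Bal0 G phi -> exists Th : set bform,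
  [/\ (G `<=` Th)%classic, ~ Bal0 Th phi &
      forall t, Bal0 Th (pos t) \/ Bal0 Th (pos (bneg t))].
Proof.
move=> Gphi; pose P (X : set bform) := ~ Bal0 (G `|` X)%classic phi.
have [F FP Ftot|M [PM Mmax]] := @Zorn_bigcup _ P.
  rewrite /P => /Bal0_finitary [r rF Hr].
  (* The finitely many premises used lie in one member of the chain; the chain may be empty, hence
     the alternative [X = set0]. *)
  suff [X [FX rX]] : exists X, (F X \/ X = set0) /\
      {in r, forall g, (G `|` X)%classic g}.
    have XP : P X by case: FX => [/FP//|->]; rewrite /P setU0.
    by apply: XP; apply: entails_mono Hr.
  elim: r rF {Hr} => [|g r IH] rF; first by exists set0; split; [right|].
  have [h hr|X [FX rX]] := IH; first by apply: rF; rewrite inE hr orbT.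
  have [Gg|[Y FY Yg]] := rF g (mem_head _ _).
    by exists X; split=> // h; rewrite inE => /orP[/eqP ->|/rX //]; left.
  case: FX => [FX|X0]; last first.
    exists Y; split; first by left.
    move=> h; rewrite inE => /orP[/eqP -> //|/rX]; first by right.
    by rewrite X0 setU0; left.
  have [XY|YX] := Ftot _ _ FX FY.
    exists Y; split; first by left.
    move=> h; rewrite inE => /orP[/eqP ->|/rX []]; [by right|by left|].
    by move=> /XY; right.
  exists X; split; first by left.
  move=> h; rewrite inE => /orP[/eqP ->|/rX //]; right; exact: YX.
exists (G `|` M)%classic; split; [by move=> g; left|exact: PM|move=> t].
apply: contrapT => /not_orP [nt nt'].
have key u : ~ Bal0 (G `|` M)%classic (pos u) ->
    Bal0 (G `|` M `|` [set pos u])%classic phi.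
  move=> nu; apply: contrapT; rewrite -setUA; apply: Mmax; split.
    by move=> g; left.
  move=> h; apply: nu; apply: entails_refl; right.
  by apply: h; right.
by apply: PM; apply: Bal0_cases (key _ nt) (key _ nt').
Qed.

(** * Fourier-Motzkin elimination *)

Section FourierMotzkin.
Local Open Scope ring_scope.

(** The midpoint of the largest lower and the smallest upper bound works; defaults take care of
    empty lists. *)
Lemma rat_separation (L U : seq rat) :
  (forall l u, l \in L -> u \in U -> l < u) ->
  exists x, (forall l, l \in L -> l < x) /\ (forall u, u \in U -> x < u).
Proof.
move=> LU.
have ub (s : seq rat) (b : rat) : exists2 m : rat,
    (forall x, x \in s -> x <= m) & m = b \/ m \in s.
  elim: s => [|y s [m sm ms]]; first by exists b => //; left.
  exists (Num.max y m) => [x|].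
    by rewrite inE le_max => /orP[/eqP ->|/sm ->]; rewrite ?lexx ?orbT.
  case: leP => _; last by right; apply: mem_head.
  by case: ms => ?; [left|right; rewrite inE; apply/orP; right].
case: U LU => [|u U] LU.
  have [m Lm _] := ub L 0; exists (m + 1); split=> // l /Lm lm; lra.
(* The default lies strictly below every element of [u :: U], so [m] is below the minimum of that
   list even when [m] is not in [L]. That minimum is [- m']. *)
have [m Lm mL] := ub L (- `|u| - 1 - \sum_(v <- U) `|v|).
have [m' Um m'U] := ub [seq - v | v <- u :: U] (- u).
have {m'U} m'U : - m' \in u :: U.
  case: m'U => [->|/mapP[v vU ->]]; rewrite opprK //; exact: mem_head.
have {}Um v : v \in u :: U -> - m' <= v.
  by move=> vU; have := Um (- v) (map_f _ vU); rewrite lerNl.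
have mm' : m < - m'.
  case: mL => [mE|mL]; last exact: LU.
  rewrite mE; move: m'U; rewrite inE => /orP[/eqP ->|m'U].
    have : 0 <= \sum_(v <- U) `|v| by apply: sumr_ge0 => ? _; apply: normr_ge0.
    have := ler_norm (- u); rewrite normrN; lra.
  rewrite (big_rem _ m'U) /=.
  have : 0 <= \sum_(v <- rem (- m') U) `|v| by apply: sumr_ge0 => ? _; apply: normr_ge0.
  have := ler_norm (- - m'); rewrite [`|- - _|]normrN.
  have := normr_ge0 u; lra.
exists ((m - m') / 2%:R); split=> [l /Lm|v /Um]; lra.
Qed.

Variables (A : zmodType) (P : A -> Prop).
Hypothesis PD : forall a b, P a -> P b -> P (a + b).
Hypothesis P_anti : forall a, P a -> P (- a) -> a = 0.
Hypothesis P_total : forall a, P a \/ P (- a).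

Definition sgA (a : A) : int :=
  if a == 0 then 0 else if `[< P a >] then 1 else -1.

Lemma sgA0 : sgA 0 = 0.
Proof. by rewrite /sgA eqxx. Qed.

Lemma sgA_eq0 a : (sgA a == 0) = (a == 0).
Proof. by rewrite /sgA; have [//|a0] := eqVneq a 0; case: asboolP. Qed.

Lemma sgAN a : sgA (- a) = - sgA a.
Proof.
rewrite /sgA oppr_eq0; case: eqP => [_|a0]; first by rewrite oppr0.
case: asboolP => Pa; case: asboolP => Pa' //; last by case: (P_total a).
by case: a0; apply: P_anti.
Qed.

Lemma sgA1P a : (sgA a = 1) <-> a <> 0 /\ P a.
Proof.
rewrite /sgA; case: eqP => [->|a0]; first by split=> [|[]].
by case: asboolP => Pa; split=> // -[].
Qed.

Lemma sgA1D a b : sgA a = 1 -> sgA b = 1 -> sgA (a + b) = 1.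
Proof.
move=> /sgA1P[a0 Pa] /sgA1P[b0 Pb]; apply/sgA1P; split; last exact: PD.
move=> /eqP; rewrite addr_eq0 => /eqP ab; apply: b0; apply: P_anti => //.
by rewrite -ab.
Qed.

Lemma sgA_cases a : [\/ sgA a = 0, sgA a = 1 | sgA a = -1].
Proof.
rewrite /sgA; case: ifP => _; first by constructor 1.
by case: ifP => _; [constructor 2|constructor 3].
Qed.

Lemma sgA_mulrn1 a n : sgA a = 1 -> sgA (a *+ n.+1) = 1.
Proof.
by move=> a1; elim: n => [//|n IH]; rewrite mulrS; apply: sgA1D.
Qed.

Lemma sgA_mulrn a n : sgA (a *+ n) = (0 < n)%N%:R * sgA a.
Proof.
case: n => [|n]; first by rewrite mulr0n sgA0 mul0r.
rewrite mul1r; case: (sgA_cases a) => [/eqP| |] a1.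
- by rewrite sgA_eq0 in a1; rewrite (eqP a1) mul0rn.
- by rewrite sgA_mulrn1.
- by rewrite -{1}[a]opprK mulNrn sgAN sgA_mulrn1 ?a1 // sgAN a1.
Qed.

Lemma sgA_mulrz a (c : int) : sgA (a *~ c) = sgz c * sgA a.
Proof.
case: c => n; first by rewrite -pmulrn sgA_mulrn; case: n.
by rewrite NegzE mulrNz sgAN -pmulrn sgA_mulrn mulN1r mul1r.
Qed.

Definition lfA n (v : nat -> int) (a : nat -> A) := \sum_(i < n) a i *~ v i.

Definition lfQ n (v : nat -> int) (x : nat -> rat) :=
  \sum_(i < n) (v i)%:~R * x i.

Lemma sgA_same a b (c : int) : sgA a = c -> sgA b = c -> sgA (a + b) = c.
Proof.
case: (sgA_cases a) => E <-.
- by move/eqP: E; rewrite sgA_eq0 => /eqP ->; rewrite add0r sgA0.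
- by rewrite E; apply: sgA1D.
- rewrite E => bN; rewrite -[a + b]opprK sgAN opprD sgA1D // sgAN ?E ?bN //.
Qed.

Lemma sgz_unit (c : int) : c != 0 -> sgz c * sgz c = 1.
Proof. by case: (sgzP c). Qed.

(* The sign of [r i + al * c i] is determined by those of [r i] (if [c i = 0])
   and of the combinations [r i * c j - r j * c i], which eliminate [al]. *)
Lemma fourier_motzkin_step (I : finType) (c : I -> int) (r : I -> A) (al : A)
    (rho : I -> rat) :
  (forall i j, sgz (rho i * (c j)%:~R - rho j * (c i)%:~R) =
               sgA (r i *~ c j - r j *~ c i)) ->
  (forall i, sgz (rho i) = sgA (r i)) ->
  exists xi : rat, forall i, sgz (rho i + (c i)%:~R * xi) = sgA (r i + al *~ c i).
Proof.
move=> H2 H1; pose f i := r i + al *~ c i.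
have {}H2 i j : sgz (rho i * (c j)%:~R - rho j * (c i)%:~R) =
    sgA (f i *~ c j - f j *~ c i).
  rewrite H2 /f !mulrzDl -!mulrzA [c j * c i]mulrC; congr sgA.
  by rewrite opprD addrACA subrr addr0.
have cR i : c i != 0 -> (c i)%:~R != 0 :> rat by rewrite intr_eq0.
(* A form that involves [al] and vanishes there leaves only one candidate for [xi], its root over
   Q. *)
have [[j [cj fj]]|nj] := pselect (exists j, c j != 0 /\ f j = 0).
  exists (- rho j / (c j)%:~R) => i; rewrite -/(f i).
  have sj : sgz (c j) != 0 by rewrite sgz_eq0.
  apply: (mulIf sj); rewrite -(@sgz_int rat (c j)) -sgzM mulrDl.
  have -> : (c i)%:~R * (- rho j / (c j)%:~R) * (c j)%:~R = - (rho j * (c i)%:~R).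
    by field; apply: cR.
  by rewrite H2 fj mul0rz subr0 sgA_mulrz sgz_int mulrC.
(* [th i] is the root of the i-th form and [si i] the sign that [xi - th i] must have; in this case
   it is nonzero whenever [c i] is. The hypothesis on pairs says that the lower thresholds are below
   the upper ones. *)
pose th i := - rho i / (c i)%:~R.
pose si i := sgz (c i) * sgA (f i).
have siE i : c i != 0 -> sgA (f i) = sgz (c i) * si i.
  by move=> ci; rewrite /si mulrA sgz_unit ?mul1r.
have ci0 i : si i != 0 -> c i != 0.
  by apply: contra => /eqP c0; rewrite /si c0 sgz0 mul0r.
have thE i xi : c i != 0 -> rho i + (c i)%:~R * xi = (c i)%:~R * (xi - th i).
  by move=> /cR ci; rewrite /th; field.
have [l u /mapP[i + ->] /mapP[j + ->]|xi [Lxi Uxi]] := @rat_separation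
    [seq th i | i <- enum I & si i == 1] [seq th i | i <- enum I & si i == -1].
  rewrite !mem_filter => /andP[/eqP sii _] /andP[/eqP sjj _].
  have ci : c i != 0 by apply: ci0; rewrite sii.
  have cj : c j != 0 by apply: ci0; rewrite sjj.
  rewrite -subr_gt0 -sgz_gt0.
  suff -> : sgz (th j - th i) = 1 by [].
  have sij : sgz (c i) * sgz (c j) != 0 by rewrite mulf_neq0 ?sgz_eq0.
  apply: (mulIf sij); rewrite -!(@sgz_int rat) -!sgzM mul1r.
  have -> : (th j - th i) * ((c i)%:~R * (c j)%:~R) =
      rho i * (c j)%:~R - rho j * (c i)%:~R.
    by rewrite /th; field; rewrite !cR.
  rewrite H2; apply: sgA_same; rewrite ?sgAN sgA_mulrz siE //.
    by rewrite sii mulr1 sgzM !sgz_int mulrC.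
  by rewrite sjj sgzM !sgz_int mulrN1 mulrN opprK.
exists xi => i; rewrite -/(f i).
have [c0|ci] := eqVneq (c i) 0; first by rewrite /f c0 mul0r mulr0z !addr0.
rewrite thE // sgzM sgz_int siE //; congr (_ * _).
have mi : i \in enum I by rewrite mem_enum.
have [si1|si1] : si i = 1 \/ si i = -1.
- have fi : sgA (f i) <> 0.
    by move/eqP; rewrite sgA_eq0 => /eqP fi; case: nj; exists i.
  rewrite /si; case: (sgzP (c i)) ci => // _ _; case: (sgA_cases (f i)) => // ->;
  by [left|right].
- rewrite si1; apply/eqP; rewrite sgz_cp0 subr_gt0.
  by apply: Lxi; apply/mapP; exists i; rewrite // mem_filter si1 eqxx.
- rewrite si1; apply/eqP; rewrite sgz_cp0 subr_lt0.
  by apply: Uxi; apply/mapP; exists i; rewrite // mem_filter si1 eqxx.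
Qed.

Lemma fourier_motzkin n (I : finType) (V : I -> nat -> int) (a : nat -> A) :
  exists x : nat -> rat, forall i, sgz (lfQ n (V i) x) = sgA (lfA n (V i) a).
Proof.
elim: n I V => [|n IH] I V.
  by exists (fun=> 0) => i; rewrite /lfQ /lfA !big_ord0 sgz0 sgA0.
(* Pairs give the combinations free of the n-th variable; single indices give the original forms,
   which [lfQ n] and [lfA n] cut off before that variable. *)
pose W (k : I * I + I) : nat -> int := match k with
  | inl (i, j) => fun k => V i k * V j n - V j k * V i n
  | inr i => V i end.
have [x Hx] := IH _ W.
have [i j|i|xi Hxi] := @fourier_motzkin_step I (fun i => V i n)
  (fun i => lfA n (V i) a) (a n) (fun i => lfQ n (V i) x).
- have := Hx (inl (i, j)); rewrite /W /lfQ /lfA.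
  rewrite !mulr_suml !mulrz_suml -!sumrB => H.
  transitivity (sgz (\sum_(i0 < n) (V i i0 * V j n - V j i0 * V i n)%:~R * x i0)).
    by congr sgz; apply: eq_bigr => k _; rewrite rmorphB !rmorphM /=; ring.
  rewrite H; congr sgA; apply: eq_bigr => k _.
  by rewrite mulrzBr !mulrzA.
- exact: (Hx (inr i)).
exists (fun k => if k == n then xi else x k) => i.
rewrite /lfQ /lfA !big_ord_recr /= eqxx -Hxi; congr (sgz (_ + _)).
by apply: eq_bigr => k _; rewrite ltn_eqF.
Qed.

End FourierMotzkin.

(** * Completeness over the rationals *)

Fixpoint subforms (t : signature) (X : Type) (phi : form t X) : seq (form t X) :=
  phi :: match phi with
         | Var _ => [::]
         | App f a => flatten [seq subforms (a i) | i <- enum 'I_(ar f)]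
         end.

Lemma subforms_refl (t : signature) (X : Type) (phi : form t X) :
  phi \in subforms phi.
Proof. by case: phi => *; apply: mem_head. Qed.

Lemma subforms_arg (t : signature) (X : Type) (f : t)
    (a : 'I_(ar f) -> form t X) i :
  {subset subforms (a i) <= subforms (App f a)}.
Proof.
move=> psi H; rewrite /= inE; apply/orP; right; apply/flattenP.
by exists (subforms (a i)) => //; apply: map_f; rewrite mem_enum.
Qed.

Lemma subforms_imp (a b : bform) :
  {subset subforms a <= subforms (imp a b)} /\
  {subset subforms b <= subforms (imp a b)}.
Proof.
by split; [apply: (@subforms_arg bal_sig nat BImp (two a b) ord0)|
           apply: (@subforms_arg bal_sig nat BImp (two a b) ord_max)].
Qed.

Lemma subforms_pos (a : bform) : {subset subforms a <= subforms (pos a)}.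
Proof. exact: (@subforms_arg bal_sig nat BPos (fun=> a) ord0). Qed.

Section RationalSemantics.
Local Open Scope ring_scope.

Definition rps (x : rat) : rat := Num.max x 0.

Lemma rat_algebra : bal_algebra rps.
Proof.
split=> [|a|a|a b]; rewrite /rps.
- by rewrite maxxx.
- by rewrite -maxA maxxx.
- by case: (leP a 0); case: (leP (- a) 0); lra.
- by case: (leP (b - a) 0); case: (leP b 0); case: (leP a 0) => *;
    case: leP; lra.
Qed.

Definition grp_interp (f : grp_sig) : ('I_(ar f) -> rat) -> rat :=
  match f return ('I_(@ar grp_sig f) -> rat) -> rat with
  | GAdd => fun b : 'I_2 -> rat => b ord0 + b ord_max
  | GNeg => fun b : 'I_1 -> rat => - b ord0
  | GZero => fun=> 0
  | GJoin => fun b : 'I_2 -> rat => Num.max (b ord0) (b ord_max)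
  | GMeet => fun b : 'I_2 -> rat => Num.min (b ord0) (b ord_max)
  end.

Definition geval (X : Type) := @eval grp_sig rat grp_interp X.

Lemma beval_to_bal e phi : beval rps e (to_bal phi) = geval e phi.
Proof.
elim: phi => // f a IH; rewrite /geval /= -!/(@geval _).
case: f a IH => a IH /=;
  rewrite ?(beval_imp, beval_pos, IH) ?subrr ?sub0r ?opprK /rps //.
- exact: addrC.
- rewrite -/(geval e (a ord0)) -/(geval e (a ord_max)).
  move: (geval e (a ord0)) (geval e (a ord_max)) => x y.
  by case: (leP x y); case: (leP (y - x) 0); lra.
- rewrite -/(geval e (a ord0)) -/(geval e (a ord_max)).
  move: (geval e (a ord0)) (geval e (a ord_max)) => x y.
  by case: (leP x y); case: (leP (- y + x) 0); lra.
Qed.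

Section Completeness.
Variables (Gam : seq bform) (phi : bform).
Hypothesis valid : forall e : nat -> rat,
  (forall g, g \in Gam -> beval rps e g = 0) -> beval rps e phi = 0.

Section LinearForms.
Variables (A : zmodType) (ps : A -> A) (AA : bal_algebra ps).
Hypothesis total : forall a, ple ps 0 a \/ ple ps 0 (- a).
Variables (n : nat) (a : nat -> A).

(* The linear form that computes a formula at [a] when the sign of each
   argument of [pos] is read off at [a]. *)
Definition lin_interp (f : bal_sig) :
    ('I_(ar f) -> nat -> int) -> nat -> int :=
  match f return ('I_(@ar bal_sig f) -> nat -> int) -> nat -> int with
  | BImp => fun v k => v ord_max k - v ord0 k
  | BPos => fun v => if `[< ple ps 0 (lfA n (v ord0) a) >] then v ord0 else fun=> 0
  end.

Definition lin := eval lin_interp (fun x k => (k == x)%:Z).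

Lemma lfA_lin psi :
  (forall x, Var x \in subforms psi -> (x < n)%N) ->
  beval ps a psi = lfA n (lin psi) a.
Proof.
elim/bform_ind: psi => [x|b c IHb IHc|b IH] vars.
- have xn : (x < n)%N by apply: vars; apply: mem_head.
  rewrite /lfA (bigD1 (Ordinal xn)) // /lin /= eqxx mulr1z big1 ?addr0 // => i.
  by rewrite -val_eqE /= => /negPf ->.
- have [sb sc] := subforms_imp b c.
  rewrite beval_imp IHb ?IHc => [|x /sc /vars//|x /sb /vars //].
  by rewrite /lfA -sumrB; apply: eq_bigr => i _; rewrite -mulrzBr.
- have IH' := IH (fun x h => vars x (subforms_pos h)).
  rewrite beval_pos IH' /lin /= -/lin; case: asboolP => h; first exact: ge0_ps.
  have := total (lfA n (lin b) a) => -[//|].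
  rewrite /ple sub0r opprK => ->.
  by rewrite /lfA big1 // => i _; rewrite mulr0z.
Qed.

(** If [x] reproduces the signs that the linear forms of the subformulas have at [a], every [pos]
    takes the same branch at [x] as at [a]. *)
Lemma lfQ_lin psi (x : nat -> rat) :
  (forall y, Var y \in subforms psi -> (y < n)%N) ->
  (forall chi, chi \in subforms psi ->
     sgz (lfQ n (lin chi) x) = sgA (ple ps 0) (lfA n (lin chi) a)) ->
  beval rps x psi = lfQ n (lin psi) x.
Proof.
elim/bform_ind: psi => [y|b c IHb IHc|b IH] vars sg.
- have yn : (y < n)%N by apply: vars; apply: mem_head.
  rewrite /lfQ (bigD1 (Ordinal yn)) // /lin /= eqxx mul1r big1 ?addr0 // => i.
  by rewrite -val_eqE /= => /negPf ->; rewrite mul0r.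
- have [sb sc] := subforms_imp b c.
  rewrite beval_imp IHb ?IHc =>
    [|z /sc /vars//|z /sc /sg//|z /sb /vars //|z /sb /sg//].
  rewrite /lfQ -sumrB; apply: eq_bigr => i _.
  by rewrite /lin /= rmorphB mulrBl.
- rewrite beval_pos IH => [|y /subforms_pos /vars//|c /subforms_pos /sg//].
  have := sg _ (subforms_pos (subforms_refl b)).
  rewrite /lin /= -/lin /rps; case: asboolP => h s.
    apply/max_idPl; rewrite -sgz_ge0 s /sgA; case: ifP => // _.
    by case: asboolP.
  rewrite [RHS]big1 => [|i _]; last by rewrite mul0r.
  apply/max_idPr; rewrite -sgz_le0 s /sgA; case: ifP => // _.
  by case: asboolP.
Qed.

End LinearForms.

(** In the Lindenbaum group of a prime theory the canonical valuation annihilates [Gam] but not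
    [phi]. A rational point with the same signs on all subformulas has the same zeros among them, so
    it refutes validity. *)
Lemma Bal0_complete : Bal0 [set` Gam]%classic phi.
Proof.
apply: contrapT => /Bal0_prime [Th [GTh nphi tot]].
pose A := lind Th; pose a : nat -> A := @lcls Th \o Var.
have AA := lind_algebra Th.
have total (x : A) : ple (@lpos Th) 0 x \/ ple (@lpos Th) 0 (- x).
  elim/lind_ind: x => b; rewrite /ple !sub0r opprK.
  have E : - lcls Th b = lcls Th (bneg b).
    by rewrite /bneg -limpE limpB; apply/esym/sub0r.
  by rewrite E !lposE !lcls0; case: (tot b); [right|left].
pose s := flatten [seq subforms g | g <- phi :: Gam].
have sP g : g \in phi :: Gam -> {subset subforms g <= s}.
  by move=> gG x xg; apply/flattenP; exists (subforms g) => //; apply: map_f.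
pose n := \max_(psi <- s) (if psi is Var x then x.+1 else 0)%N.
have vars x : Var x \in s -> (x < n)%N.
  by move=> xs; rewrite /n (big_rem _ xs) /= leq_maxl.
have PD (b c : A) : ple (@lpos Th) 0 b -> ple (@lpos Th) 0 c ->
    ple (@lpos Th) 0 (b + c).
  by rewrite -{3}[0]addr0; apply: ple_add.
have PA (b : A) : ple (@lpos Th) 0 b -> ple (@lpos Th) 0 (- b) -> b = 0.
  by move=> b0 /(ple_opp); rewrite opprK oppr0 => b0'; apply: ple_anti b0.
have [x Hx] := fourier_motzkin PD PA total n
   (fun i : 'I_(size s) => lin (@lpos Th) n a (nth phi s i)) a.
have {}Hx chi : chi \in s -> sgz (lfQ n (lin (@lpos Th) n a chi) x) =
    sgA (ple (@lpos Th) 0) (lfA n (lin (@lpos Th) n a chi) a).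
  move=> cs; have ci : (index chi s < size s)%N by rewrite index_mem.
  by have := Hx (Ordinal ci); rewrite /= nth_index.
have zero g : g \in phi :: Gam -> (beval rps x g == 0) = (lcls Th g == 0).
  move=> /sP gs; rewrite (lfQ_lin (n := n) (a := a) (ps := @lpos Th)); last first.
  - by move=> chi /gs /Hx.
  - by move=> y /gs /vars.
  rewrite -sgz_eq0 Hx ?gs ?subforms_refl // sgA_eq0 -lfA_lin ?beval_lcls //.
  by move=> y /gs /vars.
apply: nphi; apply/lcls0/eqP; rewrite -zero ?mem_head //; apply/eqP.
apply: valid => g gG; apply/eqP; rewrite zero ?inE ?gG ?orbT //.
apply/eqP; apply/eqP; apply/lcls0; apply: entails_refl; exact: GTh.
Qed.

End Completeness.

Lemma Bal0_sound (G : set bform) phi (e : nat -> rat) :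
  Bal0 G phi -> (forall g, G g -> beval rps e g = 0) -> beval rps e phi = 0.
Proof.
move=> Gphi Ge.
have II : bal_ideal rps (fun x : rat => x = 0).
  split=> // [a b -> ->|a ->|a b]; first by rewrite subrr.
    by rewrite (ps0 rat_algebra).
  exact: ps_mono rat_algebra a b.
exact: bal_ideal_sound rat_algebra II Ge Gphi.
Qed.

Lemma Bal_sound (G : set (form grp_sig nat)) phi (e : nat -> rat) :
  Bal G phi -> (forall g, G g -> geval e g = 0) -> geval e phi = 0.
Proof.
rewrite -beval_to_bal => /Bal0_sound H Ge; apply: H => _ [g Gg <-].
by rewrite beval_to_bal Ge.
Qed.

Lemma Bal_complete (Gam : seq (form grp_sig nat)) phi :
  (forall e, (forall g, g \in Gam -> geval e g = 0) -> geval e phi = 0) ->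
  Bal [set` Gam]%classic phi.
Proof.
move=> valid; have : Bal0 [set` map to_bal Gam]%classic (to_bal phi).
  apply: Bal0_complete => e He; rewrite beval_to_bal; apply: valid => g gG.
  by rewrite -beval_to_bal He // map_f.
by apply: entails_mono => _ /mapP[g gG ->]; exists g.
Qed.

Lemma Bal_finitary : finitary Bal.
Proof.
move=> G phi /Bal0_finitary [r rG Hr].
have [r' r'G rE] : exists2 r' : seq (form grp_sig nat),
    (forall g, g \in r' -> G g) & r = map to_bal r'.
  elim: r rG {Hr} => [|g r IH] rG; first by exists [::].
  have [h hr|r' r'G ->] := IH; first by apply: rG; rewrite inE hr orbT.
  have [g' Gg' <-] := rG g (mem_head _ _).
  by exists (g' :: r') => // h; rewrite inE => /orP[/eqP ->|/r'G].
exists r' => //; move: Hr; rewrite rE.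
by apply: entails_mono => _ /mapP[g gG ->]; exists g.
Qed.

(* The terms bounded by multiples of [\sum |g|] form an ideal of the l-group of
   functions on valuations. *)
Lemma Bal0_Lipschitz (Gam : seq bform) phi :
  (forall e : nat -> rat, (forall g, g \in Gam -> beval rps e g = 0) ->
     beval rps e phi = 0) ->
  exists M : nat, forall e : nat -> rat,
    `|beval rps e phi| <= (\sum_(g <- Gam) `|beval rps e g|) *+ M.
Proof.
move=> /Bal0_complete H.
pose A : zmodType := (nat -> rat) -> rat.
pose ps (f : A) : A := fun e => rps (f e).
have AA : bal_algebra ps.
  have [r0 rK rB rM] := rat_algebra.
  split=> [|a|a|a b h]; apply/funext => e; rewrite /ps.
  - exact: r0.
  - exact: rK.
  - exact: rB.
  - by apply: rM; have := congr1 (@^~ e) h.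
pose u : A := fun e => \sum_(g <- Gam) `|beval rps e g|.
have u0 : ple ps 0 u.
  apply/funext => e; rewrite /ps /rps /= sub0r; apply/max_idPr.
  by rewrite oppr_le0; apply: sumr_ge0 => ? _; apply: normr_ge0.
(* The generic valuation: under it a formula takes as value the function sending each rational
   valuation to the value of the formula there. *)
pose v : nat -> A := fun x e => e x.
have vE psi : beval ps v psi = (fun e => beval rps e psi) :> A.
  by elim/bform_ind: psi => // [a b IHa IHb|a IH];
    rewrite ?(beval_imp, beval_pos) ?IHa ?IHb ?IH.
have bE k (f : A) : ple ps f (u *+ k) <-> forall e, f e <= u e *+ k.
  have uk e : (u *+ k) e = u e *+ k by rewrite natmulfctE.
  split=> [h e|h].
    have := congr1 (@^~ e) h; rewrite /ps /rps /= -subr_le0 -uk => h'.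
    by apply/max_idPr.
  by apply/funext => e; apply/max_idPr; rewrite subr_le0 uk.
have [//|k []] := bal_ideal_sound (e := v) AA (bounded_by_ideal AA u0) _ H.
  move=> g gG; rewrite vE; exists 1%N; split; apply/bE => e;
  rewrite mulr1n /u (big_rem _ gG) /=;
  rewrite -[X in X <= _]addr0; apply: lerD.
  - exact: ler_norm.
  - by apply: sumr_ge0 => ? _; apply: normr_ge0.
  - by have := ler_norm (- beval rps e g); rewrite normrN.
  - by apply: sumr_ge0 => ? _; apply: normr_ge0.
move=> /bE h1 /bE h2; exists k => e.
have E : beval ps v phi e = beval rps e phi by have := congr1 (@^~ e) (vE phi).
have h1e : beval rps e phi <= u e *+ k by rewrite -E; apply: h1.
have h2e : - beval rps e phi <= u e *+ k by rewrite -E; apply: h2.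
by rewrite ler_norml h1e andbT lerNl.
Qed.

Lemma geval_Lipschitz (Gam : seq (form grp_sig nat)) phi :
  (forall e, (forall g, g \in Gam -> geval e g = 0) -> geval e phi = 0) ->
  exists M : nat, forall e,
    `|geval e phi| <= (\sum_(g <- Gam) `|geval e g|) *+ M.
Proof.
move=> valid.
have [e He|M HM] := @Bal0_Lipschitz (map to_bal Gam) (to_bal phi).
  rewrite beval_to_bal; apply: valid => g gG.
  by rewrite -beval_to_bal He // map_f.
exists M => e; have := HM e; rewrite beval_to_bal big_map.
by under eq_bigr do rewrite beval_to_bal.
Qed.

End RationalSemantics.

(** * Consequences in expansions of Bal *)

Lemma rename_subst (t1 t2 : signature) (m : sig_map t1 t2) (X Y : Type)
    (s : X -> form t1 Y) phi :
  rename m (subst s phi) = subst (rename m \o s) (rename m phi).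
Proof. by elim: phi => //= f a IH; congr App; apply/funext => i; apply: IH. Qed.

Lemma translate_subst (t r1 r2 : signature) (T : translation t r1 r2)
    (X Y : Type) (s : X -> form (expand t r1) Y) phi :
  translate T (subst s phi) = subst (translate T \o s) (translate T phi).
Proof.
elim: phi => //= -[g|h] a IH /=; first by congr App; apply/funext => i; apply: IH.
by rewrite subst_comp; congr subst; apply/funext => i; apply: IH.
Qed.

Lemma rename_expand_base (t r1 r2 : signature) (m : sig_map r1 r2) (X : Type)
    (phi : form t X) :
  rename (expand_map t m) (rename (base_map t r1) phi) =
  rename (base_map t r2) phi.
Proof.
elim: phi => //= f a IH; congr App; apply/funext => i.
by rewrite IH; congr (rename _ (a _)); apply: val_inj.
Qed.

Lemma translate_base (t r1 r2 : signature) (T : translation t r1 r2) (X : Type)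
    (phi : form t X) :
  translate T (rename (base_map t r1) phi) = rename (base_map t r2) phi.
Proof. by elim: phi => //= f a IH; congr App; apply/funext => i; apply: IH. Qed.

(** Meant for renamings, translations and their composites: since they commute with substitution,
    only the generating rules need checking. *)
Lemma least_logic_map (t1 t2 : signature) (h : form t1 nat -> form t2 nat)
    (L : logic t2) R :
  (forall s phi, h (subst s phi) = subst (h \o s) (h phi)) ->
  (forall D phi, R D phi -> L (h @` D)%classic (h phi)) ->
  forall G phi, least_logic R G phi -> L (h @` G)%classic (h phi).
Proof.
move=> hs RL G phi; elim=> [g Gg|s D psi /RL LD _ IH].
  by apply: entails_refl; exists g.
rewrite hs; apply: entails_cut (entails_subst (h \o s) LD) => _ [_ [g Dg <-] <-].
by rewrite -hs; apply: IH.
Qed.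

Section FreeVariables.
Variables (t : signature) (X : eqType).

Fixpoint fvars (phi : form t X) : seq X :=
  match phi with
  | Var x => [:: x]
  | App f a => flatten [seq fvars (a i) | i <- enum 'I_(ar f)]
  end.

Lemma fvars_arg (f : t) (a : 'I_(ar f) -> form t X) i :
  {subset fvars (a i) <= fvars (App f a)}.
Proof.
move=> x xa; apply/flattenP; exists (fvars (a i)) => //.
by apply: map_f; rewrite mem_enum.
Qed.

Lemma eq_in_subst_rename (t' : signature) (m : sig_map t t') (Y : Type)
    (s s' : X -> form t' Y) phi : {in fvars phi, s =1 s'} ->
  subst s (rename m phi) = subst s' (rename m phi).
Proof.
elim: phi => [x|f a IH] ss /=; first by apply: ss; apply: mem_head.
by congr App; apply/funext => i; apply: IH => x /fvars_arg /ss.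
Qed.

Lemma eq_in_eval D (M : forall f : t, ('I_(ar f) -> D) -> D) (e e' : X -> D) phi :
  {in fvars phi, e =1 e'} -> eval M e phi = eval M e' phi.
Proof.
elim: phi => [x|f a IH] ee /=; first by apply: ee; apply: mem_head.
by congr (M _); apply/funext => i; apply: IH => x /fvars_arg /ee.
Qed.

End FreeVariables.

Definition fsubst (r : signature) (X Y : Type)
    (s : X -> form (expand grp_sig r) Y) (phi : form grp_sig X) :=
  subst s (rename (base_map grp_sig r) phi).

Lemma fsubst_subst (r : signature) (X Y Z : Type)
    (s : Y -> form (expand grp_sig r) Z) (s' : X -> form grp_sig Y) phi :
  fsubst s (subst s' phi) = fsubst (fsubst s \o s') phi.
Proof. by rewrite /fsubst rename_subst subst_comp. Qed.

Lemma subst_fsubst (r : signature) (X Y Z : Type)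
    (s : Y -> form (expand grp_sig r) Z) (s' : X -> form (expand grp_sig r) Y) phi :
  subst s (fsubst s' phi) = fsubst (subst s \o s') phi.
Proof. by rewrite /fsubst subst_comp. Qed.

Lemma translate_fsubst (r1 r2 : signature) (T : translation grp_sig r1 r2)
    (X Y : Type) (s : X -> form (expand grp_sig r1) Y) phi :
  translate T (fsubst s phi) = fsubst (translate T \o s) phi.
Proof. by rewrite /fsubst translate_subst translate_base. Qed.

Lemma rename_fsubst (r1 r2 : signature) (m : sig_map r1 r2)
    (X Y : Type) (s : X -> form (expand grp_sig r1) Y) phi :
  rename (expand_map grp_sig m) (fsubst s phi) =
  fsubst (rename (expand_map grp_sig m) \o s) phi.
Proof. by rewrite /fsubst rename_subst rename_expand_base. Qed.

Definition fimp (r : signature) (Y : Type) (a b : form (expand grp_sig r) Y) :=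
  fsubst (two a b) gimp.

Definition extends_Bal (r : signature) (L : logic (expand grp_sig r)) :=
  forall G phi, Bal G phi ->
    L (rename (base_map grp_sig r) @` G)%classic (rename (base_map grp_sig r) phi).

Section RationalConsequence.
Local Open Scope ring_scope.
Variable X : eqType.
Implicit Types (Gam : seq (form grp_sig X)) (phi : form grp_sig X).

Definition rat_valid Gam phi :=
  forall e : X -> rat, (forall g, g \in Gam -> geval e g = 0) -> geval e phi = 0.

Let vars Gam phi := flatten [seq fvars g | g <- phi :: Gam].

Let fvars_vars Gam phi g : g \in phi :: Gam -> {subset fvars g <= vars Gam phi}.
Proof. by move=> gG x xg; apply/flattenP; exists (fvars g) => //; apply: map_f. Qed.

Let coded (xs : seq X) phi := subst (fun x => @Var grp_sig _ (index x xs)) phi.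

Let rat_valid_coded Gam phi xs : rat_valid Gam phi ->
  forall e, (forall g, g \in map (coded xs) Gam -> geval e g = 0) ->
    geval e (coded xs phi) = 0.
Proof.
move=> V e He; rewrite /geval eval_subst; apply: V => g gG.
by have := He _ (map_f (coded xs) gG); rewrite /geval eval_subst.
Qed.

(** The bridge from Q to any expansion: the terms [s x] are substituted for variables, so their new
    connectives are opaque. Variables are coded by their positions in a finite list because [Bal] is
    defined over [nat]. *)
Lemma Bal_instance (r : signature) (L : logic (expand grp_sig r))
    (s : X -> form (expand grp_sig r) nat) Gam phi G :
  extends_Bal L -> rat_valid Gam phi ->
  (forall g, g \in Gam -> L G (fsubst s g)) -> L G (fsubst s phi).
Proof.
move=> LB /rat_valid_coded V LG; pose xs := vars Gam phi.
have /LB := Bal_complete (V xs).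
pose s' k := nth (Var 0) (map s xs) k.
have s'E g : g \in phi :: Gam ->
    subst s' (rename (base_map grp_sig r) (coded xs g)) = fsubst s g.
  move=> gG; rewrite -/(fsubst s' _) fsubst_subst.
  apply: eq_in_subst_rename => x /(fvars_vars gG) xg /=.
  by rewrite /fsubst /= /s' (nth_map x) ?index_mem ?nth_index.
move=> /(entails_subst s'); rewrite s'E ?mem_head //; apply: entails_cut.
move=> _ [_ [_ /= /mapP[g gG ->] <-] <-].
by rewrite s'E; [apply: LG|rewrite inE gG orbT].
Qed.

Lemma rat_valid_Lipschitz Gam phi : rat_valid Gam phi ->
  exists M : nat, forall e : X -> rat,
    `|geval e phi| <= (\sum_(g <- Gam) `|geval e g|) *+ M.
Proof.
pose xs := vars Gam phi; move=> /(@rat_valid_coded _ _ xs) /geval_Lipschitz [M HM].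
exists M => e; pose e' k := nth 0 (map e xs) k.
have e'E g : g \in phi :: Gam -> geval e' (coded xs g) = geval e g.
  move=> gG; rewrite /geval eval_subst; apply: eq_in_eval => x.
  move=> /(fvars_vars gG) xg /=.
  by rewrite /e' (nth_map x) ?index_mem ?nth_index.
have := HM e'; rewrite e'E ?mem_head // big_map.
rewrite [X in _ <= X *+ _ -> _]big_seq => /le_trans; apply.
rewrite lerMn2r; apply/orP; right; rewrite [leRHS]big_seq; apply: ler_sum => g gG.
by rewrite e'E // inE gG orbT.
Qed.

End RationalConsequence.

Section ExpandedSemantics.
Local Open Scope ring_scope.
Variables (r : signature) (I : forall h : r, ('I_(ar h) -> rat) -> rat).

Definition xinterp (f : expand grp_sig r) : ('I_(ar f) -> rat) -> rat :=
  match f return ('I_(@ar (expand grp_sig r) f) -> rat) -> rat with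
  | inl g => @grp_interp g
  | inr h => @I h
  end.

Definition xeval (X : Type) := @eval (expand grp_sig r) rat xinterp X.

Lemma xeval_base (X : Type) (e : X -> rat) phi :
  xeval e (rename (base_map grp_sig r) phi) = geval e phi.
Proof.
apply: eval_rename => f b; congr grp_interp.
by apply/funext => i /=; rewrite cast_ord_id.
Qed.

Lemma xeval_fsubst (X Y : Type) (e : Y -> rat)
    (s : X -> form (expand grp_sig r) Y) phi :
  xeval e (fsubst s phi) = geval (xeval e \o s) phi.
Proof. by rewrite /fsubst /xeval eval_subst -/(@xeval _) xeval_base. Qed.

Lemma geval_gimp (e : 'I_2 -> rat) : geval e gimp = e ord_max - e ord0.
Proof. by rewrite /geval /= addrC. Qed.

End ExpandedSemantics.

Section NatMultiples.
Local Open Scope ring_scope.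

Definition gadd (X : Type) (a b : form grp_sig X) : form grp_sig X :=
  @App grp_sig X GAdd (two a b).

Definition gmuln (X : Type) p (y : form grp_sig X) := iter p.-1 (gadd y) y.

Lemma geval_gmuln (X : Type) (e : X -> rat) p y :
  (0 < p)%N -> geval e (gmuln p y) = p%:R * geval e y.
Proof.
case: p => // p _; rewrite /gmuln /=; elim: p => [|p IH]; first by rewrite mul1r.
by rewrite [in RHS]mulrS mulrDl mul1r -IH.
Qed.

(* [x -> p y] for the variables [x, y] *)
Definition gdiv_axiom p : form grp_sig 'I_2 :=
  subst (two (Var ord0) (gmuln p (Var ord_max))) gimp.

Lemma geval_gdiv_axiom (e : 'I_2 -> rat) p : (0 < p)%N ->
  geval e (gdiv_axiom p) = p%:R * e ord_max - e ord0.
Proof.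
move=> p0; rewrite /gdiv_axiom /geval eval_subst -/(@geval _) geval_gimp.
by rewrite -/(@geval _) /= geval_gmuln.
Qed.

End NatMultiples.

(** * The logics Bal^S *)

Section DivisibilityLogic.
Local Open Scope ring_scope.
Variable S : set nat.
Hypothesis S_prime : (S `<=` primes_set)%classic.

Lemma S_gt0 (h : div_sig S) : (0 < sval h)%N.
Proof. by case: h => p /= /S_prime; apply: prime_gt0. Qed.

Definition div_interp (h : div_sig S) (b : 'I_(ar h) -> rat) : rat :=
  b ord0 / (sval h)%:R.

Definition deval (X : Type) := @xeval (div_sig S) div_interp X.

Lemma div_axiomE (h : div_sig S) (x : divf S) :
  div_axiom h x = fsubst (two x (div_app h x)) (gdiv_axiom (sval h)).
Proof.
rewrite fsubst_subst; congr subst; apply/funext => -[[|[|//]] ?];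
  rewrite /two //= /div_mul /gmuln.
elim: (sval h).-1 => //= n ->; congr App; apply/funext => i.
by case: i => -[|[|]].
Qed.

Lemma BalS_extends : extends_Bal (BalS S).
Proof. by move=> G phi H; apply: least_logic_contains; constructor. Qed.

Lemma BalS_axiom G h x : BalS S G (div_axiom h x).
Proof.
apply: (@entails_mono _ _ set0) => [? []|].
by apply: least_logic_contains; constructor.
Qed.

Lemma deval_div_axiom (e : nat -> rat) h x : deval e (div_axiom h x) = 0.
Proof.
rewrite div_axiomE /deval xeval_fsubst geval_gdiv_axiom ?S_gt0 //=.
rewrite /div_interp mulrC divfK ?subrr //.
by rewrite pnatr_eq0 -lt0n S_gt0.
Qed.

Lemma BalS_sound G phi (e : nat -> rat) : BalS S G phi ->
  (forall g, G g -> deval e g = 0) -> deval e phi = 0.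
Proof.
move=> H Ge; elim: H => [g /Ge//|s D psi RD _ IH].
rewrite /deval /xeval eval_subst; move: IH.
case: RD => [D' psi' H|h x] IH.
  rewrite -/(@xeval _ _ _) xeval_base; apply: Bal_sound H _ => g Gg.
  have := IH _ (ex_intro2 _ _ _ Gg erefl).
  by rewrite /deval /xeval eval_subst -/(@xeval _ _ _) xeval_base.
exact: deval_div_axiom.
Qed.

(* Each maximal subformula [d_p a] becomes the variable named [d_p a]; together
   with [flat_axioms] this reduces consequence in [BalS] to consequence in
   [Bal]. *)
Fixpoint flat (phi : divf S) : form grp_sig (divf S) :=
  match phi with
  | Var x => Var (Var x)
  | App f a =>
      match f return ('I_(@ar (expand grp_sig (div_sig S)) f) -> divf S) ->
        ('I_(@ar (expand grp_sig (div_sig S)) f) -> form grp_sig (divf S)) ->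
        form grp_sig (divf S) with
      | inl g => fun _ b => @App grp_sig _ g b
      | inr h => fun b _ => Var (@App (expand grp_sig (div_sig S)) _ (inr h) b)
      end a (fun i => flat (a i))
  end.

Lemma fsubst_flat phi : fsubst id (flat phi) = phi.
Proof.
elim: phi => //= -[g|h] a IH //=; rewrite /fsubst /=; congr App.
by apply/funext => i; rewrite -[RHS]IH cast_ord_id.
Qed.

(** For the variable named [d_p a] this is the axiom relating it to [a], with [a] itself flattened
    so that nested divisions stay linked. *)
Definition flat_axioms (phi : divf S) : seq (form grp_sig (divf S)) :=
  match phi with
  | Var x => [::]
  | App f a =>
      match f return ('I_(@ar (expand grp_sig (div_sig S)) f) -> divf S) ->
        seq (form grp_sig (divf S)) with
      | inl g => fun=> [::]
      | inr h => fun b =>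
          [:: subst (two (flat (b ord0)) (Var (div_app h (b ord0))))
                (gdiv_axiom (sval h))]
      end a
  end.

Lemma flat_axioms_derivable G phi ax :
  ax \in flat_axioms phi -> BalS S G (fsubst id ax).
Proof.
case: phi => [//|[//|h] b]; rewrite mem_seq1 => /eqP ->.
rewrite fsubst_subst.
rewrite [_ \o _](_ : _ = two (b ord0) (div_app h (b ord0))); last first.
  by apply/funext => -[[|[|//]] ?]; rewrite /two /= ?fsubst_flat.
by rewrite -div_axiomE; apply: BalS_axiom.
Qed.

(** Division by p is unique in Q, so the axioms force the variable named [d_p a] to take the value
    of [a] divided by p. *)
Lemma geval_flat (E : divf S -> rat) phi :
  (forall psi ax, psi \in subforms phi -> ax \in flat_axioms psi ->
     geval E ax = 0) ->
  geval E (flat phi) = deval (E \o Var) phi.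
Proof.
elim: phi => //= -[g|h] a IH H.
  rewrite /geval /=; congr grp_interp; apply/funext => i.
  by apply: IH => psi ax /subforms_arg /H; apply.
have := H _ _ (mem_head _ _) (mem_head _ _).
rewrite /geval eval_subst -/(@geval _) geval_gdiv_axiom ?S_gt0 //.
have p0 : (sval h)%:R != 0 :> rat by rewrite pnatr_eq0 -lt0n S_gt0.
rewrite -/(@geval _) /two /= -/(@geval _) IH => [/eqP|psi ax]; last first.
  by move=> /subforms_arg /H; apply.
rewrite subr_eq0 /deval /= /div_interp => /eqP <-.
rewrite mulrC mulKf //; congr E.
rewrite /div_app; congr App; apply/funext => i; by rewrite (ord1 i).
Qed.

Lemma BalS_complete (Gam : seq (divf S)) phi :
  (forall e, (forall g, g \in Gam -> deval e g = 0) -> deval e phi = 0) ->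
  BalS S [set` Gam]%classic phi.
Proof.
move=> V; rewrite -[phi]fsubst_flat.
pose s := flatten [seq subforms g | g <- phi :: Gam].
have sP g : g \in phi :: Gam -> {subset subforms g <= s}.
  by move=> gG x xg; apply/flattenP; exists (subforms g) => //; apply: map_f.
pose ax := flatten [seq flat_axioms psi | psi <- s].
apply: (Bal_instance (Gam := map flat Gam ++ ax)) BalS_extends _ _.
  move=> E HE; have axE g : g \in phi :: Gam -> geval E (flat g) = deval (E \o Var) g.
    move=> /sP gs; apply: geval_flat => psi a /gs psis apsi; apply: HE.
    rewrite mem_cat; apply/orP; right; apply/flattenP.
    by exists (flat_axioms psi) => //; apply: map_f.
  rewrite axE ?mem_head //; apply: V => g gG.
  rewrite -axE ?inE ?gG ?orbT //; apply: HE.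
  by rewrite mem_cat map_f.
move=> g; rewrite mem_cat => /orP[/mapP[g' gG ->]|/flattenP[l /mapP[psi _ ->]]].
  by rewrite fsubst_flat; apply: entails_refl.
exact: flat_axioms_derivable.
Qed.

Lemma BalS_finitary : finitary (BalS S).
Proof.
apply: least_logic_finitary => D phi RD; case: RD => [G psi /Bal_finitary|h x].
  move=> [r rG Hr].
  exists (map (rename (base_map grp_sig (div_sig S))) r).
    by move=> _ /mapP[g /rG Gg ->]; exists g.
  apply: entails_mono (BalS_extends Hr) => _ [g gr <-]; exact: map_f.
by exists [::] => //; apply: BalS_axiom.
Qed.

End DivisibilityLogic.

Lemma BalS_expansion (S S' : set nat) (sub : (S `<=` S')%classic) :
  is_expansion (expand_map grp_sig (div_map sub)) (BalS S) (BalS S').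
Proof.
move=> G phi; apply: least_logic_map => [s psi|D psi]; first exact: rename_subst.
case=> [D' chi H|h x].
  rewrite rename_expand_base; have := @BalS_extends S' _ _ H.
  apply: entails_mono => _ [g Dg <-].
  by exists (rename (base_map _ _) g); [exists g|rewrite rename_expand_base].
rewrite div_axiomE rename_fsubst [_ \o _](_ : _ =
  two (rename (expand_map grp_sig (div_map sub)) x)
      (div_app (div_map sub h) (rename (expand_map grp_sig (div_map sub)) x))).
  by have := @div_axiomE S' (div_map sub h) => /= <-; apply: BalS_axiom.
by apply/funext => -[[|[|//]] ?].
Qed.

Lemma deval_rename (S S' : set nat) (sub : (S `<=` S')%classic)
    (X : Type) (e : X -> rat) phi :
  deval e (rename (expand_map grp_sig (div_map sub)) phi) = deval e phi.
Proof.
apply: eval_rename => -[g|h] b /=; last first.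
  by rewrite /div_interp /= cast_ord_id.
by congr grp_interp; apply/funext => i /=; rewrite cast_ord_id.
Qed.

(** Q is divisible by every prime, so one rational interpretation is sound for [BalS S'] and
    complete for finite consequence in [BalS S]. *)
Lemma BalS_conservative (S S' : set nat) (sub : (S `<=` S')%classic) :
  (S' `<=` primes_set)%classic ->
  conservative (expand_map grp_sig (div_map sub)) (BalS S) (BalS S').
Proof.
move=> S'P G phi /BalS_finitary [r rG Hr].
have [r' r'G rE] : exists2 r' : seq (divf S), (forall g, g \in r' -> G g) &
    r = map (rename (expand_map grp_sig (div_map sub))) r'.
  elim: r rG {Hr} => [|g r IH] rG; first by exists [::].
  have [h hr|r' r'G ->] := IH; first by apply: rG; rewrite inE hr orbT.
  have [g' Gg' <-] := rG g (mem_head _ _).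
  by exists (g' :: r') => // h; rewrite inE => /orP[/eqP ->|/r'G].
have SP : (S `<=` primes_set)%classic by move=> p /sub /S'P.
have /(entails_mono (L := BalS S)) : BalS S [set` r']%classic phi.
  apply: BalS_complete => // e He; rewrite -(deval_rename sub).
  apply: BalS_sound Hr _ => // g; rewrite rE => /mapP[g' g'r ->].
  by rewrite deval_rename He.
by apply=> g /r'G.
Qed.

Lemma BalS_morphism (S S' : set nat) (sub : (S `<=` S')%classic) :
  has_morphism (BalS S) (BalS S').
Proof.
exists (fun h => @App (expand grp_sig (div_sig S')) 'I_1 (inr (div_map sub h)) Var).
move=> G phi; apply: least_logic_map => [s psi|D psi]; first exact: translate_subst.
case=> [D' chi H|h x].
  rewrite translate_base; have := @BalS_extends S' _ _ H.
  apply: entails_mono => _ [g Dg <-].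
  by exists (rename (base_map _ _) g); [exists g|rewrite translate_base].
rewrite div_axiomE translate_fsubst; set T := (X in translate X).
rewrite [_ \o _](_ : _ = two (translate T x) (div_app (div_map sub h) (translate T x))).
  by have := @div_axiomE S' (div_map sub h) => /= <-; apply: BalS_axiom.
by apply/funext => -[[|[|//]] ?].
Qed.

(** * Algebraic expansions *)

Definition sumf (A B C : Type) (f : A -> C) (g : B -> C) (v : A + B) : C :=
  match v with inl a => f a | inr b => g b end.

Lemma sumf_comp (A B C D : Type) (f : A -> C) (g : B -> C) (h : C -> D) :
  h \o sumf f g = sumf (h \o f) (h \o g).
Proof. by apply/funext => -[]. Qed.

Lemma comp_two (T U : Type) (h : T -> U) a b : h \o two a b = two (h a) (h b).
Proof. by apply/funext => -[[|[|]]]. Qed.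

Definition holds_inst (r : signature) (L : logic (expand grp_sig r))
    (P : system grp_sig) G a b :=
  forall phi, sys_forms P phi -> L G (fsubst (sumf a b) phi).
Arguments holds_inst {r} L P G a b.

Section FamilyLogic.
Variable Sigma : set (system grp_sig).
Notation fsig := (family_sig Sigma).

Definition fam_app (P : {P | Sigma P}) (j : 'I_(n_out (sval P)))
    (X : Type) (a : 'I_(n_in (sval P)) -> form (expand grp_sig fsig) X) :
    form (expand grp_sig fsig) X :=
  @App (expand grp_sig fsig) X (inr (existT _ P j)) a.

Lemma Bal_ae_extends : extends_Bal (Bal_ae Sigma).
Proof.
by move=> G phi H; apply: least_logic_contains; apply: family_base.
Qed.

Let Bal_ae_member (P : {P | Sigma P}) s G D phi :
  system_expansion Bal [set gimp]%classic (sval P) D phi ->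
  (forall g, D g ->
     Bal_ae Sigma G (subst s (rename (expand_map grp_sig (member_map P)) g))) ->
  Bal_ae Sigma G (subst s (rename (expand_map grp_sig (member_map P)) phi)).
Proof.
move=> H GD; have := least_logic_contains (family_member H).
move=> /(entails_subst s); apply: entails_cut => _ [_ [g Dg <-] <-]; exact: GD.
Qed.

(** The rules of a member know only its own connectives, whereas [a] may contain those of the whole
    family. The instance at distinct variables is therefore taken first and [a] substituted
    afterwards. *)
Lemma Bal_ae_exists (P : {P | Sigma P}) G a :
  holds_inst (Bal_ae Sigma) (sval P) G a (fun j => fam_app j a).
Proof.
move=> phi Pphi; pose n := n_in (sval P).
pose va (i : 'I_n) : form (expand grp_sig (system_sig (sval P))) nat := Var (val i).
pose s k := oapp a (Var 0) (insub k).
have sE i : s (val (i : 'I_n)) = a i by rewrite /s valK.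
pose vf j := @App (expand grp_sig (system_sig (sval P))) _ (inr j) va.
suff -> : fsubst (sumf a (fun j => fam_app j a)) phi =
    subst s (rename (expand_map grp_sig (member_map P)) (fsubst (sumf va vf) phi)).
  apply: (Bal_ae_member (D := set0)) => //.
  by apply: least_logic_contains; apply: system_exists; exists phi.
rewrite rename_fsubst subst_fsubst !sumf_comp; congr (fsubst (sumf _ _)).
  by apply/funext => i; rewrite /= sE.
apply/funext => j /=; rewrite /fam_app; congr App; apply/funext => i /=.
by rewrite -sE.
Qed.

Lemma Bal_ae_unique (P : {P | Sigma P}) G a b c j :
  holds_inst (Bal_ae Sigma) (sval P) G a b ->
  holds_inst (Bal_ae Sigma) (sval P) G a c ->
  Bal_ae Sigma G (fimp (b j) (c j)).
Proof.
move=> Hb Hc; pose n := n_in (sval P); pose m := n_out (sval P).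
pose X : countType := (('I_n + 'I_m) + 'I_m)%type.
pose var (x : X) : form (expand grp_sig (system_sig (sval P))) nat := Var (pickle x).
pose va i := var (inl (inl i)); pose vb i := var (inl (inr i)).
pose vc i := var (inr i).
pose s k := oapp (sumf (sumf a b) c) (Var 0) (unpickle k).
have sE x : s (pickle (x : X)) = sumf (sumf a b) c x by rewrite /s pickleK.
have := @Bal_ae_member P s G
  (system_inst (sval P) va vb `|` system_inst (sval P) va vc)%classic
  (fimp (vb j) (vc j)).
rewrite rename_fsubst subst_fsubst !comp_two /= !sE /=; apply.
  by apply: least_logic_contains; apply: system_unique.
move=> g [] [phi Pphi <-]; rewrite -/(fsubst _ _) rename_fsubst subst_fsubst.
  rewrite [X in fsubst X _](_ : _ = sumf a b); first exact: Hb.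
  by apply/funext => -[i|i] /=; rewrite sE.
rewrite [X in fsubst X _](_ : _ = sumf a c); first exact: Hc.
by apply/funext => -[i|i] /=; rewrite sE.
Qed.

Lemma Bal_ae_morphism (L2 : expansion grp_sig)
    (T : translation grp_sig fsig (new_sig L2)) :
  extends_Bal L2 ->
  (forall (P : {P | Sigma P}) a,
     holds_inst L2 (sval P) set0%classic a
       (fun j => subst a (T (existT _ P j)))) ->
  (forall (P : {P | Sigma P}) G a b c j, holds_inst L2 (sval P) G a b ->
     holds_inst L2 (sval P) G a c -> L2 G (fimp (b j) (c j))) ->
  is_morphism (L1 := Bal_ae Sigma) (L2 := L2) T.
Proof.
move=> L2B L2e L2u G phi.
have base D psi : Bal D psi -> L2
    (translate T @` (rename (base_map grp_sig fsig) @` D))%classic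
    (translate T (rename (base_map grp_sig fsig) psi)).
  move=> /L2B; rewrite translate_base; apply: entails_mono => _ [g Dg <-].
  by exists (rename (base_map _ _) g); [exists g|rewrite translate_base].
apply: least_logic_map => [|D psi [{}D {}psi|P {}D {}psi]].
- exact: translate_subst.
- exact: base.
pose h := translate T \o @rename _ _ (expand_map grp_sig (member_map P)) nat.
rewrite image_comp; apply: (@least_logic_map _ _ h L2).
  by move=> s chi; rewrite /h /= rename_subst translate_subst.
move=> {}D {}psi [{}D {}psi /base|a {}psi [chi Pchi <-]|a b c j _ ->].
- rewrite /h /= !rename_expand_base; apply: entails_mono => _ [_ [g Dg <-] <-].
  by exists (rename (base_map _ _) g); [exists g|rewrite /h /= !rename_expand_base].
- rewrite -/(fsubst _ _).
  pose fa j := @App (expand grp_sig (system_sig (sval P))) nat (inr j) a.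
  rewrite -[h _]/(h (fsubst (sumf a fa) chi)).
  suff -> : h (fsubst (sumf a fa) chi) =
      fsubst (sumf (h \o a) (fun j => subst (h \o a) (T (existT _ P j)))) chi.
    by apply: entails_mono (L2e P (h \o a) chi Pchi) => ? [].
  rewrite /h /= rename_fsubst translate_fsubst !sumf_comp.
  congr (fsubst (sumf _ _)); apply/funext => j /=; congr subst.
  by apply/funext => i /=; rewrite cast_ord_id.
- rewrite -[h _]/(h (fimp (b j) (c j))).
  have -> : h (fimp (b j) (c j)) = fimp (h (b j)) (h (c j)).
    change (translate T (rename (expand_map grp_sig (member_map P))
      (fsubst (two (b j) (c j)) gimp)) = fimp (h (b j)) (h (c j))).
    by rewrite rename_fsubst translate_fsubst !comp_two.
  apply: (L2u P _ (h \o a) (h \o b) (h \o c)) => chi Pchi.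
  - apply: entails_refl; exists (fsubst (sumf a b) chi); first by left; exists chi.
    by rewrite /h /= rename_fsubst translate_fsubst !sumf_comp.
  - apply: entails_refl; exists (fsubst (sumf a c) chi); first by right; exists chi.
    by rewrite /h /= rename_fsubst translate_fsubst !sumf_comp.
Qed.

End FamilyLogic.

(** * Derived rules and replacement in expansions of Bal *)

Section DerivedRules.
Local Open Scope ring_scope.
Variables (r : signature) (L : logic (expand grp_sig r)).
Hypothesis LB : extends_Bal L.
Notation xform := (form (expand grp_sig r) nat).

Definition gimpf (X : Type) (a b : form grp_sig X) := subst (two a b) gimp.

Lemma geval_gimpf (X : Type) (e : X -> rat) a b :
  geval e (gimpf a b) = geval e b - geval e a.
Proof. by rewrite /geval eval_subst -/(@geval _) geval_gimp. Qed.

Lemma fsubst_gimpf (X Y : Type) (s : X -> form (expand grp_sig r) Y) a b :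
  fsubst s (gimpf a b) = fimp (fsubst s a) (fsubst s b).
Proof. by rewrite fsubst_subst comp_two. Qed.

Lemma fimp_mp G (a b : xform) : L G a -> L G (fimp a b) -> L G b.
Proof.
move=> La Lab.
apply: (Bal_instance (s := two a b) (Gam := [:: Var ord0; gimp])
  (phi := Var ord_max)) => //.
  move=> e He; have := He gimp; rewrite geval_gimp !inE eqxx orbT => /(_ isT).
  have := He (Var ord0); rewrite mem_head => /(_ isT) /= -> /eqP.
  by rewrite subr0 => /eqP.
by move=> g; rewrite !inE => /orP[] /eqP ->.
Qed.

(** Replacement inside a base formula is a rationally valid consequence in two copies of the
    variables. Replacement under new connectives is a separate matter, settled by uniqueness. *)
Lemma fsubst_congr (X : finType) (s s' : X -> xform) G phi :
  (forall x, L G (fimp (s x) (s' x))) ->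
  L G (fsubst s phi) -> L G (fsubst s' phi).
Proof.
move=> ss Ls; pose v1 x : form grp_sig (X + X) := Var (inl x).
pose v2 x : form grp_sig (X + X) := Var (inr x).
have -> : fsubst s' phi = fsubst (sumf s s') (subst v2 phi) by rewrite fsubst_subst.
apply: (Bal_instance
  (Gam := subst v1 phi :: [seq gimpf (v1 x) (v2 x) | x <- enum X])) => //.
  move=> e He; rewrite /geval eval_subst; have := He _ (mem_head _ _).
  rewrite /geval eval_subst => <-; congr (eval _ _ _); apply/funext => x /=.
  apply/eqP; rewrite -subr_eq0 -[e (inr x)]/(geval e (v2 x)) -[e _]/(geval e (v1 x)).
  rewrite -geval_gimpf He // inE; apply/orP; right.
  by apply: map_f; rewrite mem_enum.
move=> g; rewrite inE => /orP[/eqP ->|/mapP[x _ ->]]; first by rewrite fsubst_subst.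
by rewrite fsubst_gimpf; apply: ss.
Qed.

Lemma fimp_refl G (a : xform) : L G (fimp a a).
Proof.
rewrite -[fimp a a](fsubst_gimpf (two a a) (Var ord0) (Var ord0)).
apply: (Bal_instance (Gam := [::])) => // e _.
by rewrite geval_gimpf subrr.
Qed.

Lemma fimp_trans G (b a c : xform) : L G (fimp a b) -> L G (fimp b c) -> L G (fimp a c).
Proof.
move=> Lab Lbc; have := @fsubst_congr 'I_2 (two a b) (two a c) G gimp.
by apply=> // -[[|[|//]] ?]; rewrite /two //=; apply: fimp_refl.
Qed.

Lemma fimp_sym G (a b : xform) : L G (fimp a b) -> L G (fimp b a).
Proof.
move=> Lab; have := @fsubst_congr 'I_2 (two a a) (two b a) G gimp.
apply; last exact: fimp_refl.
by move=> -[[|[|//]] ?]; rewrite /two //=; apply: fimp_refl.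
Qed.

Lemma fimp_App G (g : grp_sig) (a b : 'I_(ar g) -> xform) :
  (forall i, L G (fimp (a i) (b i))) ->
  L G (fimp (@App (expand grp_sig r) _ (inl g) a)
            (@App (expand grp_sig r) _ (inl g) b)).
Proof.
move=> ab.
have E c : @App (expand grp_sig r) _ (inl g) c = fsubst c (@App grp_sig _ g Var).
  by rewrite /fsubst /=; congr App; apply/funext => i /=; rewrite cast_ord_id.
have E2 (s : 'I_(ar g) + 'I_(ar g) -> xform) :
    fimp (@App (expand grp_sig r) _ (inl g) (s \o inl))
      (@App (expand grp_sig r) _ (inl g) (s \o inr)) =
    fsubst s (gimpf (@App grp_sig _ g (Var \o inl)) (@App grp_sig _ g (Var \o inr))).
  rewrite fsubst_gimpf !E /fsubst /=; congr (fimp (App _ _) (App _ _)).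
apply: (eq_rect _ (L G) _ _ (esym (E2 (sumf a b)))).
apply: (@fsubst_congr _ (sumf a a)); last by rewrite -E2; apply: fimp_refl.
by move=> [i|i] //=; apply: fimp_refl.
Qed.

Lemma entails_inst G (s : nat -> xform) phi : L set0%classic phi -> L G (subst s phi).
Proof. by move=> /(entails_subst s); apply: entails_mono => _ [? []]. Qed.

End DerivedRules.

(** * Rigidity: endomorphisms are provably the identity *)

Section Rigidity.

Definition compose_translation (t r1 r2 r3 : signature)
  (T : translation t r1 r2) (S : translation t r2 r3) : translation t r1 r3 :=
  fun h => translate S (T h).

Lemma translate_comp (t r1 r2 r3 : signature)
  (T : translation t r1 r2) (S : translation t r2 r3) X (phi : form _ X) :
  translate S (translate T phi) = translate (compose_translation T S) phi.
Proof.
elim: phi => //= -[g|h] a IH /=; first by congr App; apply/funext => i; apply: IH.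
by rewrite translate_subst; congr subst; apply/funext => i; apply: IH.
Qed.

Lemma is_morphism_comp (t : signature) (L1 L2 L3 : expansion t)
  (T : translation t (new_sig L1) (new_sig L2))
  (S : translation t (new_sig L2) (new_sig L3)) :
  is_morphism T -> is_morphism S ->
  is_morphism (L1 := L1) (L2 := L3) (compose_translation T S).
Proof.
move=> MT MS G phi /MT /MS; rewrite translate_comp; apply: entails_mono.
by move=> _ [_ [g Gg <-] <-]; exists g => //; rewrite translate_comp.
Qed.

Lemma has_morphism_trans (t : signature) (L2 L1 L3 : expansion t) :
  has_morphism L1 L2 -> has_morphism L2 L3 -> has_morphism L1 L3.
Proof.
by move=> [T MT] [S MS]; exists (compose_translation T S); apply: is_morphism_comp.
Qed.

Definition rigid (L : expansion grp_sig) :=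
  forall T, is_morphism (L1 := L) (L2 := L) T ->
  forall phi, L set0%classic (fimp phi (translate T phi)).

Lemma rigid_equipollent (L1 L2 : expansion grp_sig) :
  extends_Bal L1 -> extends_Bal L2 -> rigid L1 -> rigid L2 ->
  has_morphism L1 L2 -> has_morphism L2 L1 -> equipollent L1 L2.
Proof.
move=> B1 B2 R1 R2 [T MT] [S MS]; exists T, S; split=> // phi;
  rewrite translate_comp.
- have H G := entails_mono (@sub0set _ G) (R1 _ (is_morphism_comp MT MS) phi).
  split; first exact: (fimp_mp B1 (entails_refl _ _) (H _)).
  exact: (fimp_mp B1 (entails_refl _ _) (fimp_sym B1 (H _))).
- have H G := entails_mono (@sub0set _ G) (R2 _ (is_morphism_comp MS MT) phi).
  split; first exact: (fimp_mp B2 (entails_refl _ _) (H _)).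
  exact: (fimp_mp B2 (entails_refl _ _) (fimp_sym B2 (H _))).
Qed.

Lemma equipollent_morphisms (L1 L2 : expansion grp_sig) :
  equipollent L1 L2 -> has_morphism L1 L2 /\ has_morphism L2 L1.
Proof. by move=> [T [S [MT MS _ _]]]; split; [exists T|exists S]. Qed.

Lemma rigid_criterion (L : expansion grp_sig) :
  extends_Bal L ->
  (forall (h : new_sig L) a b, (forall i, L set0%classic (fimp (a i) (b i))) ->
     L set0%classic (fimp (@App (expand grp_sig (new_sig L)) nat (inr h) a)
                          (@App (expand grp_sig (new_sig L)) nat (inr h) b))) ->
  (forall T h b, is_morphism (L1 := L) (L2 := L) T ->
     L set0%classic (fimp (@App (expand grp_sig (new_sig L)) nat (inr h) b)
                          (subst b (T h)))) ->
  rigid L.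
Proof.
move=> LB congr_new LT T MT; elim=> [x|[g|h] a IH]; first exact: (fimp_refl LB _ (Var x)).
  exact: (fimp_App LB).
apply: (fimp_trans LB (congr_new h a (translate T \o a) IH)).
exact: LT.
Qed.

(** A morphism [T] preserves the existence theorems, so [f(b)] and the image of [f] at [b] both
    solve Phi at [b] and uniqueness identifies them. Uniqueness also gives congruence: if [a] and
    [b] are equal, [f(b)] solves Phi at [a]. *)
Lemma Bal_ae_rigid Sigma : rigid (Bal_ae Sigma).
Proof.
apply: rigid_criterion => [|[P j] a b ab|T [P j] b MT]; first exact: Bal_ae_extends.
  apply: (@Bal_ae_unique Sigma P _ a (fun j => fam_app j a) (fun j => fam_app j b)).
    exact: Bal_ae_exists.
  move=> phi Pphi.
  apply: (@fsubst_congr _ _ (@Bal_ae_extends Sigma) _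
    (sumf b (fun j => fam_app j b))).
    move=> [i|i]; last exact: (fimp_refl (@Bal_ae_extends Sigma) _ _).
    exact: (fimp_sym (@Bal_ae_extends Sigma) (ab i)).
  exact: Bal_ae_exists.
apply: (@Bal_ae_unique Sigma P _ b (fun j => fam_app j b)
  (fun j => subst b (T (existT _ P j)))).
  exact: Bal_ae_exists.
move=> phi Pphi; pose n := n_in (sval P).
pose va (i : 'I_n) : form (expand grp_sig (family_sig Sigma)) nat := Var (val i).
pose s k := oapp b (Var 0) (insub k).
have /MT := @Bal_ae_exists Sigma P set0%classic va phi Pphi.
rewrite image_set0 translate_fsubst sumf_comp => /(entails_inst set0%classic s).
rewrite subst_fsubst sumf_comp /=.
rewrite [X in sumf X _](_ : _ = b); last first.
  by apply/funext => i; rewrite /= /s valK.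
rewrite [X in sumf _ X](_ : _ = (fun j => subst b (T (existT _ P j)))) //.
apply/funext => k /=; rewrite subst_comp; congr subst.
by apply/funext => i /=; rewrite /s valK.
Qed.

End Rigidity.

Lemma geval_subst (X Y : Type) (s : X -> form grp_sig Y) (e : Y -> rat) phi :
  geval e (subst s phi) = geval (geval e \o s) phi.
Proof. exact: eval_subst. Qed.

Lemma BalS_morphism_criterion (S : set nat) (L2 : expansion grp_sig)
    (T : translation grp_sig (div_sig S) (new_sig L2)) :
  extends_Bal L2 ->
  (forall h x, L2 set0%classic
     (fsubst (two x (subst (fun=> x) (T h))) (gdiv_axiom (sval h)))) ->
  is_morphism (L1 := BalS S) (L2 := L2) T.
Proof.
move=> L2B L2T G phi; apply: least_logic_map => [s psi|D psi].
  exact: translate_subst.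
case=> [D' chi H|h x].
  rewrite translate_base; have := L2B _ _ H.
  apply: entails_mono => _ [g Dg <-].
  by exists (rename (base_map _ _) g); [exists g|rewrite translate_base].
rewrite div_axiomE translate_fsubst comp_two.
exact: entails_mono (@sub0set _ _) (L2T h (translate T x)).
Qed.

Section DivUnique.
Local Open Scope ring_scope.
Variables (r : signature) (L : logic (expand grp_sig r)).
Hypothesis LB : extends_Bal L.

Lemma gdiv_unique p G (x y z : form (expand grp_sig r) nat) : (0 < p)%N ->
  L G (fsubst (two x y) (gdiv_axiom p)) -> L G (fsubst (two x z) (gdiv_axiom p)) ->
  L G (fimp y z).
Proof.
move=> p0 Ly Lz; pose v (i : 'I_2) : form grp_sig ('I_2 + 'I_1) := Var (inl i).
pose w : form grp_sig ('I_2 + 'I_1) := Var (inr ord0).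
pose s := sumf (two x y) (fun _ : 'I_1 => z).
have -> : fimp y z = fsubst s (gimpf (v ord_max) w) by rewrite fsubst_gimpf.
pose g1 := subst v (gdiv_axiom p); pose g2 := subst (two (v ord0) w) (gdiv_axiom p).
apply: (Bal_instance (Gam := [:: g1; g2])) => //.
  move=> e He; rewrite geval_gimpf /v /w /=.
  have := He g1 (mem_head _ _).
  have : geval e g2 = 0 by apply: He; rewrite !inE eqxx orbT.
  rewrite (geval_subst v) (geval_subst (two _ _)) !geval_gdiv_axiom //=.
  have : p%:R != 0 :> rat by rewrite pnatr_eq0 -lt0n.
  move=> pn0 h1 h2; apply: (mulfI pn0); lra.
by move=> g; rewrite !inE => /orP[] /eqP ->; rewrite fsubst_subst ?comp_two.
Qed.

End DivUnique.

Lemma BalS_rigid (S : set nat) : (S `<=` primes_set)%classic -> rigid (BalS S).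
Proof.
move=> SP; have LB := @BalS_extends S.
have appE h b : @App (expand grp_sig (div_sig S)) nat (inr h) b = div_app h (b ord0).
  by rewrite /div_app; congr App; apply/funext => i; rewrite (ord1 i).
have step h G x c : BalS S G (fsubst (two x c) (gdiv_axiom (sval h))) ->
    BalS S G (fimp (div_app h x) c).
  apply: (gdiv_unique LB (S_gt0 SP h)).
  by rewrite -div_axiomE; apply: BalS_axiom.
apply: rigid_criterion => // [h a b ab|T h b MT]; rewrite !appE; apply: step.
  apply: (@fsubst_congr _ _ LB _ (two (b ord0) (div_app h (b ord0)))).
    move=> -[[|[|//]] ?]; last exact: (fimp_refl LB).
    exact: (fimp_sym LB (ab ord0)).
  by rewrite -div_axiomE; apply: BalS_axiom.
have /MT := @BalS_axiom S set0%classic h (Var 0).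
rewrite div_axiomE translate_fsubst comp_two image_set0.
move=> /(@entails_inst _ _ set0%classic (fun=> b ord0)).
rewrite subst_fsubst comp_two /= subst_comp.
rewrite [X in subst X](_ : _ = b) //.
by apply/funext => i; rewrite (ord1 i).
Qed.

(** * Localizations of the integers and the invariance of S *)

Section PrimeSupport.
Local Open Scope ring_scope.
Variable S : set nat.

(* [q] lies in the localization of the integers at the primes of [S] *)
Definition in_loc (q : rat) := forall p, prime p -> (p %| `|denq q|)%N -> S p.

(** Any denominator [N] will do, since the reduced denominator is coprime to the numerator and hence
    divides [N]. *)
Lemma in_locP (q : rat) (N : nat) (z : int) : (0 < N)%N ->
  (forall p, prime p -> (p %| N)%N -> S p) -> q * N%:R = z%:~R -> in_loc q.
Proof.
move=> N0 NS qN p pp pq; apply: NS => //; apply: dvdn_trans pq _.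
have : numq q * N%:Z = z * denq q.
  apply: (@intr_inj rat); rewrite !rmorphM /= numqE -qN -pmulrn.
  exact: mulrAC.
move=> /(congr1 absz); rewrite !abszM /= => E.
have := coprime_num_den q; rewrite coprime_sym => /Gauss_dvdr <-.
by rewrite E dvdn_mull.
Qed.

Lemma in_loc_ex (q : rat) : in_loc q ->
  exists N z, [/\ (0 < N)%N, forall p, prime p -> (p %| N)%N -> S p & q * N%:R = z%:~R].
Proof.
move=> qS; exists `|denq q|%N, (numq q); split=> //.
  by rewrite absz_gt0 denq_neq0.
by rewrite numqE -[in RHS]absz_denq.
Qed.

Lemma in_loc_int (z : int) : in_loc z%:~R.
Proof.
apply: (@in_locP _ 1 z) => //; last by rewrite mulr1.
by move=> p pp; rewrite dvdn1 => /eqP p1; rewrite p1 in pp.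
Qed.

Lemma in_loc0 : in_loc 0.
Proof. by have := @in_loc_int 0; rewrite mulr0z. Qed.

Lemma in_locD (q q' : rat) : in_loc q -> in_loc q' -> in_loc (q + q').
Proof.
move=> /in_loc_ex [N [z [N0 NS qN]]] /in_loc_ex [N' [z' [N0' NS' qN']]].
apply: (@in_locP _ (N * N')%N (z * N'%:Z + z' * N%:Z)).
- by rewrite muln_gt0 N0.
- by move=> p pp; rewrite Euclid_dvdM // => /orP[/NS|/NS']; apply.
- by rewrite rmorphD !rmorphM /= -qN -qN' -!pmulrn; ring.
Qed.

Lemma in_locN (q : rat) : in_loc q -> in_loc (- q).
Proof. by rewrite /in_loc denqN. Qed.

Lemma in_loc_div (q : rat) p : prime p -> S p -> in_loc q -> in_loc (q / p%:R).
Proof.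
move=> pp Sp /in_loc_ex [N [z [N0 NS qN]]].
apply: (@in_locP _ (p * N)%N z).
- by rewrite muln_gt0 N0 prime_gt0.
- move=> p' pp'; rewrite Euclid_dvdM // => /orP[|/NS]; last exact.
  by rewrite dvdn_prime2 // => /eqP ->.
- rewrite natrM mulrA divfK //.
  by rewrite pnatr_eq0 -lt0n prime_gt0.
Qed.

Hypothesis S_prime : (S `<=` primes_set)%classic.

Lemma in_loc_deval (X : Type) (e : X -> rat) (phi : form (expand grp_sig (div_sig S)) X) :
  (forall x, in_loc (e x)) -> in_loc (deval e phi).
Proof.
move=> eS; elim: phi => [x|[[]|h] a IH]; rewrite /deval /xeval /= -?/(@xeval _ _ _).
- exact: eS.
- by apply: in_locD; apply: IH.
- by apply: in_locN; apply: IH.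
- exact: in_loc0.
- by rewrite /Num.max; case: ifP => _; apply: IH.
- by rewrite /Num.min; case: ifP => _; apply: IH.
- rewrite /div_interp; apply: in_loc_div; last exact: IH.
    by case: h {a IH} => p Sp; apply: S_prime.
  exact: svalP.
Qed.

End PrimeSupport.

(** At the valuation constantly 1 the translation of [d_p] must take the value 1/p, while terms of
    [BalS S'] take values in Z[1/S'] there. *)
Lemma BalS_has_morphism (S S' : set nat) :
  (S `<=` primes_set)%classic -> (S' `<=` primes_set)%classic ->
  has_morphism (BalS S) (BalS S') -> (S `<=` S')%classic.
Proof.
move=> SP SP' [T MT] p Sp; pose h : div_sig S := exist _ p Sp.
have /MT := @BalS_axiom S set0%classic h (Var 0).
rewrite div_axiomE translate_fsubst comp_two image_set0.
move=> H; pose t : divf S' := subst (fun=> Var 0) (T h).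
have /eqP := BalS_sound SP' (e := fun=> 1%R) H (fun _ => False_ind _).
rewrite /deval xeval_fsubst geval_gdiv_axiom ?(S_gt0 SP h) // subr_eq0 => /eqP E.
have {}E : (p%:R * deval (fun=> 1) t = 1)%R by exact: E.
have /in_loc_ex [N [z [N0 NS tN]]] : in_loc S' (deval (fun=> 1%R) t).
  by apply: in_loc_deval => // _; have := @in_loc_int S' 1; rewrite mulr1z.
apply: NS; first exact: SP.
have : (N%:Z = p%:Z * z)%R.
  by apply: (@intr_inj rat); rewrite !rmorphM /= -tN mulrA -!pmulrn E mul1r.
by move=> /(congr1 absz); rewrite abszM /= => ->; apply: dvdn_mulr.
Qed.

(** * Piecewise linear solution maps *)

Section Germs.
Local Open Scope ring_scope.
Variable X : finType.
Implicit Types (e d : X -> rat) (phi : form grp_sig X) (l : {ffun X -> rat}).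

Lemma geval_homogeneous (Y : Type) (c : rat) (e : Y -> rat) (phi : form grp_sig Y) :
  0 <= c -> geval (fun x => c * e x) phi = c * geval e phi.
Proof.
move=> c0; elim: phi => // f a IH; rewrite /geval /= -!/(@geval _).
case: f a IH => a IH /=; rewrite ?IH.
- by rewrite mulrDr -!IH.
- by rewrite mulrN -!IH.
- by rewrite mulr0.
- by rewrite maxr_pMr // -!IH.
- by rewrite minr_pMr // -!IH.
Qed.

Definition lform l e := \sum_x l x * e x.

Lemma lform_line l e d (eps : rat) :
  lform l (fun x => e x + eps * d x) = lform l e + eps * lform l d.
Proof.
rewrite /lform mulr_sumr -big_split /=; apply: eq_bigr => x _.
by rewrite mulrDr mulrCA.
Qed.

Lemma lformD l l' e : lform (l + l') e = lform l e + lform l' e.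
Proof.
by rewrite /lform -big_split /=; apply: eq_bigr => x _; rewrite ffunE mulrDl.
Qed.

Lemma lformN l e : lform (- l) e = - lform l e.
Proof.
by rewrite /lform -sumrN /=; apply: eq_bigr => x _; rewrite ffunE mulNr.
Qed.

Lemma lform0 e : lform 0 e = 0.
Proof. by rewrite /lform big1 // => x _; rewrite ffunE mul0r. Qed.

Definition pieces_interp (f : grp_sig) :
    ('I_(ar f) -> seq {ffun X -> rat}) -> seq {ffun X -> rat} :=
  match f return ('I_(@ar grp_sig f) -> seq {ffun X -> rat}) ->
      seq {ffun X -> rat} with
  | GAdd => fun b : 'I_2 -> _ => [seq u + v | u <- b ord0, v <- b ord_max]
  | GNeg => fun b : 'I_1 -> _ => [seq - u | u <- b ord0]
  | GZero => fun=> [:: 0]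
  | GJoin => fun b : 'I_2 -> _ => b ord0 ++ b ord_max
  | GMeet => fun b : 'I_2 -> _ => b ord0 ++ b ord_max
  end.

Definition pieces : form grp_sig X -> seq {ffun X -> rat} :=
  eval pieces_interp (fun x => [:: [ffun y => (y == x)%:R]]).

(** The interval contains 0, so a linear form found along a ray also gives the value at its origin
    ([germ0]). *)
Definition eventually (Q : rat -> Prop) :=
  exists2 eps0 : rat, 0 < eps0 & forall eps, 0 <= eps <= eps0 -> Q eps.

Lemma eventually_and Q Q' :
  eventually Q -> eventually Q' -> eventually (fun eps => Q eps /\ Q' eps).
Proof.
move=> [a a0 Qa] [b b0 Qb]; exists (Num.min a b); first by rewrite lt_min a0.
move=> eps /andP[e0]; rewrite le_min => /andP[ea eb].
by split; [apply: Qa|apply: Qb]; rewrite e0.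
Qed.

Lemma eventually_mono (Q Q' : rat -> Prop) :
  (forall eps, 0 <= eps -> Q eps -> Q' eps) -> eventually Q -> eventually Q'.
Proof.
move=> QQ' [a a0 Qa]; exists a => // eps he; apply: QQ'; last exact: Qa.
by case/andP: he.
Qed.

Lemma eventually_all (T : eqType) (s : seq T) (Q : T -> rat -> Prop) :
  (forall t, t \in s -> eventually (Q t)) ->
  eventually (fun eps => forall t, t \in s -> Q t eps).
Proof.
elim: s => [|t s IH] H; first by exists 1.
have [u us|//] := eventually_and (H t (mem_head _ _)) (IH _).
  by apply: H; rewrite inE us orbT.
move=> a a0 Qa; exists a => // eps /Qa [Qt Qs] u.
by rewrite inE => /orP[/eqP -> //|/Qs].
Qed.

Lemma affine_neq0 (a b : rat) : a != 0 -> eventually (fun eps => a + eps * b != 0).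
Proof.
move=> a0; have na : 0 < `|a| by rewrite normr_gt0.
have nb := normr_ge0 b.
(* Up to this bound [eps * |b|] stays below [|a|]; the added 1 covers [b = 0]. *)
exists (`|a| / (2%:R * (`|b| + 1))); first by apply: divr_gt0 => //; lra.
move=> eps /andP[e0 e1]; apply/eqP => /eqP; rewrite addr_eq0 => /eqP E.
have : `|a| = eps * `|b| by rewrite E normrN normrM ger0_norm.
have : eps * (2%:R * (`|b| + 1)) <= `|a| by rewrite -ler_pdivlMr //; lra.
nra.
Qed.

Lemma affine_sign (a b : rat) :
  eventually (fun eps => 0 <= a + eps * b) \/ eventually (fun eps => a + eps * b <= 0).
Proof.
have pos (u v : rat) : 0 < u -> eventually (fun eps => 0 <= u + eps * v).
  move=> u0; have nv := normr_ge0 v; exists (u / (`|v| + 1)).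
    by apply: divr_gt0 => //; lra.
  move=> eps /andP[e0]; rewrite ler_pdivlMr; last lra.
  have := ler_norm (- v); rewrite normrN; nra.
have [a0|a0|->] := ltgtP a 0; last first.
- have [b0|b0] := leP 0 b; [left|right]; exists 1 => // eps /andP[e0 _]; nra.
- by left; apply: pos.
- right; have [|x x0 H] := pos (- a) (- b); first by rewrite oppr_gt0.
  by exists x => // eps /H; lra.
Qed.

(** Along a ray the difference of two linear forms is affine in [eps] and keeps a weak sign near 0,
    so each join or meet settles on one of its arguments. The candidates in [pieces phi] depend on
    neither [e] nor [d]. *)
Lemma germ phi e d : exists2 l, l \in pieces phi &
  eventually (fun eps => geval (fun x => e x + eps * d x) phi =
                         lform l (fun x => e x + eps * d x)).
Proof.
elim: phi => [y|f a IH].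
  exists [ffun z => (z == y)%:R]; first exact: mem_head.
  exists 1 => // eps _; rewrite /lform (bigD1 y) //= ffunE eqxx mul1r big1 ?addr0 //.
  by move=> z zy; rewrite ffunE (negPf zy) mul0r.
case: f a IH => a IH.
- have [l la H] := IH ord0; have [l' la' H'] := IH ord_max.
  exists (l + l'); first exact: allpairs_f.
  apply: eventually_mono (eventually_and H H') => eps _ [].
  by rewrite lformD => <- <-.
- have [l la H] := IH ord0; exists (- l); first exact: map_f.
  by apply: eventually_mono H => eps _; rewrite lformN => <-.
- by exists 0; [apply: mem_head|exists 1 => // eps _; rewrite lform0].
- have [l la H] := IH ord0; have [l' la' H'] := IH ord_max.
  have key := affine_sign (lform l e - lform l' e) (lform l d - lform l' d).
  case: key => H2.
    exists l; first by rewrite /pieces /= mem_cat; apply/orP; left.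
    apply: eventually_mono (eventually_and (eventually_and H H') H2).
    move=> eps _ [[E E'] h]; rewrite /geval /= -!/(@geval _) E E' !lform_line.
    by apply/max_idPl; lra.
  exists l'; first by rewrite /pieces /= mem_cat; apply/orP; right.
  apply: eventually_mono (eventually_and (eventually_and H H') H2).
  move=> eps _ [[E E'] h]; rewrite /geval /= -!/(@geval _) E E' !lform_line.
  by apply/max_idPr; lra.
- have [l la H] := IH ord0; have [l' la' H'] := IH ord_max.
  have key := affine_sign (lform l e - lform l' e) (lform l d - lform l' d).
  case: key => H2.
    exists l'; first by rewrite /pieces /= mem_cat; apply/orP; right.
    apply: eventually_mono (eventually_and (eventually_and H H') H2).
    move=> eps _ [[E E'] h]; rewrite /geval /= -!/(@geval _) E E' !lform_line.
    by apply/min_idPr; lra.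
  exists l; first by rewrite /pieces /= mem_cat; apply/orP; left.
  apply: eventually_mono (eventually_and (eventually_and H H') H2).
  move=> eps _ [[E E'] h]; rewrite /geval /= -!/(@geval _) E E' !lform_line.
  by apply/min_idPl; lra.
Qed.

Lemma germ0 phi e d l : eventually (fun eps => geval (fun x => e x + eps * d x) phi =
                         lform l (fun x => e x + eps * d x)) -> geval e phi = lform l e.
Proof.
have E : (fun x => e x + 0 * d x) = e by apply/funext => x; rewrite mul0r addr0.
by move=> [a a0 /(_ 0)]; rewrite E; apply; rewrite lexx ltW.
Qed.

End Germs.

Lemma common_denominator (X : finType) (e : X -> rat) :
  exists N (v : X -> int), (0 < N)%N /\ forall k, (N%:R * e k = (v k)%:~R)%R.
Proof.
pose D := (\prod_i `|denq (e i)|)%N; exists D.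
have Dx k : exists z : int, (D%:R * e k = z%:~R)%R.
  rewrite /D (bigD1 k) //=; set q := (\prod_(i | _) _)%N.
  exists (q%:Z * numq (e k))%R.
  by rewrite natrM [in RHS]rmorphM /= numqE -[in RHS]absz_denq -!pmulrn; ring.
have [v Hv] := choice Dx; exists v; split=> //.
by rewrite prodn_gt0 // => k; rewrite absz_gt0 denq_neq0.
Qed.

(** * Matrices covering the solution map *)

Section Solutions.
Local Open Scope ring_scope.
Variables (n m : nat) (Fs : seq (form grp_sig ('I_n + 'I_m))).
Implicit Types (x : 'I_n -> rat) (z : 'I_m -> rat) (M : 'M[rat]_(n, m)).

Definition sol x z := forall phi, phi \in Fs -> geval (sumf x z) phi = 0.

Lemma sol_scale (c : rat) x z :
  0 <= c -> sol x z -> sol (fun i => c * x i) (fun j => c * z j).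
Proof.
move=> c0 xz phi phiF; rewrite [sumf _ _](_ : _ = (fun v => c * sumf x z v)).
  by rewrite geval_homogeneous // xz // mulr0.
by apply/funext => -[].
Qed.

Hypothesis uniq_sol : forall x z z', sol x z -> sol x z' -> z = z'.

Definition apply_mx M x : 'I_m -> rat := fun j => \sum_i x i * M i j.

Lemma apply_mx_line M x d (eps : rat) :
  apply_mx M (fun i => x i + eps * d i) =
  (fun j => apply_mx M x j + eps * apply_mx M d j).
Proof.
apply/funext => j; rewrite /apply_mx mulr_sumr -big_split /=.
by apply: eq_bigr => i _; rewrite mulrDl mulrA.
Qed.

Lemma sumf_line x z dx dz (eps : rat) :
  (fun v => sumf x z v + eps * sumf dx dz v) =
  sumf (fun i => x i + eps * dx i) (fun j => z j + eps * dz j).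
Proof. by apply/funext => -[]. Qed.

(* Uniqueness makes the linear forms vanishing at a solution [(x, z)] determine
   [z]: a direction [(0, w)] killed by all of them leads to further solutions. *)
Lemma sol_linear_cover : exists Ms : seq 'M[rat]_(n, m),
  forall x z, sol x z -> exists2 M, M \in Ms & z = apply_mx M x.
Proof.
pose W := flatten [seq pieces phi | phi <- Fs].
pose w (c : 'I_(size W)) := nth 0 W c.
(* The vanishing of the forms in [E] at [(x, z)] reads [z * Rm E = - x * Pm E]. If [Rm E] has full
   row rank, its pseudo-inverse gives [z = x * ME E], and there are finitely many sets [E]. *)
pose Rm (E : {set 'I_(size W)}) : 'M[rat]_(m, size W) :=
  \matrix_(j, c) (if c \in E then w c (inr j) else 0).
pose Pm (E : {set 'I_(size W)}) : 'M[rat]_(n, size W) :=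
  \matrix_(i, c) (if c \in E then w c (inl i) else 0).
pose ME E := - (Pm E *m pinvmx (Rm E)).
exists [seq ME E | E <- enum {set 'I_(size W)}] => x z xz.
pose E := [set c | lform (w c) (sumf x z) == 0].
exists (ME E); first by apply: map_f; rewrite mem_enum.
have free : row_free (Rm E).
  apply: inj_row_free => v vR; pose dz j := v 0 j.
  pose d : 'I_n + 'I_m -> rat := sumf (fun=> 0) dz.
  have Ed c : c \in E -> lform (w c) d = 0.
    move=> cE; have := congr1 (fun A : 'rV_(size W) => A 0 c) vR.
    rewrite !mxE => <-; rewrite /lform big_sumType /= big1 ?add0r => [|i _].
      by apply: eq_bigr => j _; rewrite mxE cE mulrC.
    by rewrite mulr0.
  have [|eps0 e0 H] := @eventually_all _ Fs (fun phi eps =>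
      geval (fun u => sumf x z u + eps * d u) phi = 0).
    move=> phi phiF; have [l lp Hl] := germ phi (sumf x z) d.
    have lW : l \in W by apply/flattenP; exists (pieces phi) => //; apply: map_f.
    have lc : (index l W < size W)%N by rewrite index_mem.
    have wl : w (Ordinal lc) = l by rewrite /w /= nth_index.
    have l0 : lform l (sumf x z) = 0 by rewrite -(germ0 Hl) xz.
    have ld : lform l d = 0 by rewrite -wl Ed // inE wl l0.
    by apply: eventually_mono Hl => eps _ ->; rewrite lform_line l0 ld mulr0 addr0.
  have := H eps0; rewrite lexx ltW // => /(_ isT).
  rewrite sumf_line => Hs.
  have /(uniq_sol xz) E2 : sol x (fun j => z j + eps0 * dz j).
    move=> phi /Hs <-; congr (geval (sumf _ _) _).
    by apply/funext => i; rewrite mulr0 addr0.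
  apply/rowP => j; rewrite !mxE; have /eqP := congr1 (@^~ j) E2.
  rewrite -subr_eq0 opprD addrA subrr sub0r oppr_eq0 mulf_eq0 gt_eqF //=.
  by move=> /eqP.
pose zr : 'rV[rat]_m := \row_j z j; pose xr : 'rV[rat]_n := \row_i x i.
have zR : zr *m Rm E = - (xr *m Pm E).
  apply/rowP => c; rewrite !mxE; apply/eqP; rewrite -addr_eq0 addrC.
  have [cE|cE] := boolP (c \in E); last first.
    by rewrite !big1 ?addr0 // => i _; rewrite !mxE (negPf cE) mulr0.
  move: (cE); rewrite inE /lform big_sumType /= => /eqP s0.
  apply/eqP; rewrite -[RHS]s0.
  by congr (_ + _); apply: eq_bigr => i _; rewrite !mxE cE mulrC.
have zE : zr = xr *m ME E.
  by rewrite -[LHS](mulmxKp free) zR /ME mulNmx mulmxN (mulmxA xr).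
apply/funext => j; have := congr1 (fun A : 'rV_m => A 0 j) zE.
rewrite !mxE => ->; apply: eq_bigr => i _; by rewrite mxE.
Qed.

Hypothesis ex_sol : forall x, exists z, sol x z.

Definition covers (Ms : seq 'M[rat]_(n, m)) :=
  forall x, exists2 M, M \in Ms & sol x (apply_mx M x).

Variable S : set nat.
Hypothesis sol_in_loc : forall (v : 'I_n -> int) z,
  sol (fun i => (v i)%:~R) z -> forall j, in_loc S (z j).

Definition mx_in_loc M := forall i j, in_loc S (M i j).

(* A matrix needed at some [x0] is the only one to solve at [x0 + eps * d] for
   small [eps]; clearing denominators, its rows are differences of solutions
   at integer points. *)
Lemma covers_drop M Ms : covers (M :: Ms) -> ~ mx_in_loc M -> covers Ms.
Proof.
move=> cov nM x; apply: contrapT => ncov; apply: nM => i j.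
pose dx (i' : 'I_n) : rat := (i' == i)%:R.
have [|eps0 e0 H] := @eventually_all _ Ms (fun M' eps =>
    ~ sol (fun i => x i + eps * dx i) (apply_mx M' (fun i => x i + eps * dx i))).
  move=> M' M'Ms.
  have [phi phiF nz] : exists2 phi, phi \in Fs & geval (sumf x (apply_mx M' x)) phi != 0.
    apply: contrapT => h; apply: ncov; exists M' => // phi phiF.
    by apply: contrapT => /eqP h2; apply: h; exists phi.
  have [l _ Hl] := germ phi (sumf x (apply_mx M' x)) (sumf dx (apply_mx M' dx)).
  rewrite (germ0 Hl) in nz.
  have := affine_neq0 (lform l (sumf dx (apply_mx M' dx))) nz.
  move=> /(eventually_and Hl); apply: eventually_mono => eps _ [E1 E2] /(_ _ phiF).
  by rewrite apply_mx_line -sumf_line E1 lform_line => /eqP; apply/negP.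
have only eps : 0 <= eps <= eps0 ->
    sol (fun i => x i + eps * dx i) (apply_mx M (fun i => x i + eps * dx i)).
  move=> /H He; have [M'] := cov (fun i => x i + eps * dx i).
  by rewrite inE => /orP[/eqP -> //|/He].
have [D [v0 [D0 Dx]]] := common_denominator x.
(* The factor [D] makes [N x] integral and the other one gives [1/N <= eps0]. Thus [N x] and
   [N x + e_i], which is [N (x + e_i / N)], are integer points where [M] gives the solution; their
   difference isolates row [i] of [M]. *)
pose N := (D * (Num.bound (eps0^-1)).+1)%N.
have N0 : (0 < N)%N by rewrite muln_gt0 D0.
have Nx k : exists z : int, N%:R * x k = z%:~R.
  exists (v0 k * (Num.bound (eps0^-1)).+1%:Z).
  by rewrite natrM [in RHS]rmorphM /= -Dx -!pmulrn; ring.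
have NR : 0 < N%:R :> rat by rewrite ltr0n.
have Nn0 : N%:R != 0 :> rat by rewrite gt_eqF.
have Neps : N%:R^-1 <= eps0.
  rewrite -[leRHS]invrK lef_pV2 ?posrE ?invr_gt0 //.
  apply: le_trans (ltW (archi_boundP _)) _; first by rewrite invr_ge0 ltW.
  by rewrite ler_nat; apply: leq_trans (leqnSn _) (leq_pmull _ _).
have [v vE] : exists v : 'I_n -> int, forall k, N%:R * x k = (v k)%:~R.
  by have [v Hv] := choice Nx; exists v.
have s0 := sol_scale (ltW NR) (only 0 _).
have s1 := sol_scale (ltW NR) (only N%:R^-1 _).
have i0 : in_loc S (N%:R * apply_mx M x j).
  have := @sol_in_loc v (fun j => N%:R * apply_mx M x j) _ j; apply.
  have := s0; rewrite lexx ltW // => /(_ isT).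
  rewrite [X in sol X](_ : _ = (fun k => (v k)%:~R)); last first.
    by apply/funext => k; rewrite mul0r addr0 vE.
  by rewrite apply_mx_line; under [X in sol _ X]funext do rewrite mul0r addr0.
have i1 : in_loc S (N%:R * apply_mx M x j + apply_mx M dx j).
  have := @sol_in_loc (fun k => v k + (k == i)%:Z)
     (fun j => N%:R * apply_mx M x j + apply_mx M dx j) _ j; apply.
  have := s1; rewrite Neps invr_ge0 ltW // => /(_ isT).
  rewrite [X in sol X](_ : _ = (fun k => (v k + (k == i)%:Z)%:~R)); last first.
    apply/funext => k; rewrite mulrDr mulVKf // vE rmorphD /=.
    by congr (_ + _); rewrite /dx; case: (k == i).
  rewrite apply_mx_line; under [X in sol _ X]funext do rewrite mulrDr mulVKf //.
  by [].
have : in_loc S (apply_mx M dx j).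
  rewrite -[apply_mx _ _ _](addKr (N%:R * apply_mx M x j)).
  by apply: in_locD => //; apply: in_locN.
rewrite /apply_mx (bigD1 i) //= /dx eqxx mul1r big1 ?addr0 // => k /negPf ki.
by rewrite ki mul0r.
Qed.

Lemma sol_in_loc_cover : exists2 Ms, covers Ms & forall M, M \in Ms -> mx_in_loc M.
Proof.
have [Ms HMs] := sol_linear_cover.
(* The empty list is generalized to the accumulator [keep] of matrices already found to have entries
   in the localization; each other matrix is dropped by [covers_drop]. *)
have {HMs} cov : covers (Ms ++ [::]).
  move=> x; have [z xz] := ex_sol x; have [M MMs zE] := HMs _ _ xz.
  by exists M; rewrite ?cats0 // -zE.
have : forall M, M \in [::] -> mx_in_loc M by move=> M; rewrite in_nil.
elim: Ms [::] cov => [|M Ms IH] keep cov keep_ok; first by exists keep.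
have [gM|bM] := pselect (mx_in_loc M); last first.
  by apply: (IH keep) => //; apply: covers_drop bM.
apply: (IH (M :: keep)) => [x|M']; last first.
  by rewrite inE => /orP[/eqP -> //|/keep_ok].
have [M' M'M sM'] := cov x; exists M' => //.
by move: M'M; rewrite !(mem_cat, inE) => /orP[/orP[]|] ->; rewrite ?orbT.
Qed.

End Solutions.

(** * Rational functions given by terms of Bal^S *)

Section Representable.
Local Open Scope ring_scope.
Variables (S : set nat) (n : nat).
Implicit Types f g : ('I_n -> rat) -> rat.

Definition representable f :=
  exists tau : form (expand grp_sig (div_sig S)) 'I_n, forall e, deval e tau = f e.

Lemma eq_representable f g : f =1 g -> representable f -> representable g.
Proof. by move=> fg [tau H]; exists tau => e; rewrite H. Qed.

Lemma representable_var i : representable (fun e => e i).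
Proof. by exists (Var i). Qed.

Lemma representable_geval (X : Type) (fs : X -> ('I_n -> rat) -> rat) phi :
  (forall v, representable (fs v)) ->
  representable (fun e => geval (fun v => fs v e) phi).
Proof.
move=> /choice [tau Htau]; exists (fsubst tau phi) => e.
by rewrite /deval xeval_fsubst; congr geval; apply/funext => v; apply: Htau.
Qed.

Let op2 (g : grp_sig) (H : 2 = ar g) f1 f2 (f : rat -> rat -> rat) :
  (forall b : 'I_(ar g) -> rat,
     grp_interp b = f (b (cast_ord H ord0)) (b (cast_ord H ord_max))) ->
  representable f1 -> representable f2 -> representable (fun e => f (f1 e) (f2 e)).
Proof.
move=> Hf r1 r2.
have := @representable_geval _ (two f1 f2)
  (@App grp_sig 'I_2 g (fun i => Var (cast_ord (esym H) i))).
move=> h; apply: eq_representable (h _) => [e|]; last by case=> [[|[|]]].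
by rewrite /geval /= Hf !cast_ordK.
Qed.

Lemma representableD f g : representable f -> representable g ->
  representable (fun e => f e + g e).
Proof.
by apply: (@op2 GAdd erefl) => b; congr (b _ + b _); apply: val_inj.
Qed.

Lemma representable_min f g : representable f -> representable g ->
  representable (fun e => Num.min (f e) (g e)).
Proof.
by apply: (@op2 GMeet erefl) => b; congr (Num.min (b _) (b _)); apply: val_inj.
Qed.

Lemma representable_max f g : representable f -> representable g ->
  representable (fun e => Num.max (f e) (g e)).
Proof.
by apply: (@op2 GJoin erefl) => b; congr (Num.max (b _) (b _)); apply: val_inj.
Qed.

Lemma representableN f : representable f -> representable (fun e => - f e).
Proof.
move=> rf; apply: (@representable_geval 'I_1 (fun=> f) (@App grp_sig _ GNeg Var)) => _.
exact: rf.
Qed.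

Lemma representable0 : representable (fun=> 0).
Proof.
apply: (@representable_geval 'I_0 (fun _ _ => 0) (@App grp_sig _ GZero Var)).
by case.
Qed.

Lemma representable_sum (I : Type) (s : seq I) (fs : I -> ('I_n -> rat) -> rat) :
  (forall i, representable (fs i)) -> representable (fun e => \sum_(i <- s) fs i e).
Proof.
move=> rf; elim: s => [|i s IH].
  by apply: eq_representable representable0 => e; rewrite big_nil.
apply: eq_representable (representableD (rf i) IH) => e.
by rewrite big_cons.
Qed.

Lemma representable_norm f : representable f -> representable (fun e => `|f e|).
Proof.
move=> rf; apply: eq_representable (representable_max rf (representableN rf)) => e.
have [h|h] := leP 0 (f e).
  by rewrite ger0_norm //; apply/max_idPl; lra.
by rewrite ltr0_norm //; apply/max_idPr; lra.
Qed.

Lemma representable_mulrn f k : representable f -> representable (fun e => f e *+ k).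
Proof.
move=> rf; elim: k => [|k IH].
  by apply: eq_representable representable0 => e; rewrite mulr0n.
by apply: eq_representable (representableD rf IH) => e; rewrite mulrS.
Qed.

Lemma representable_mulrz f (k : int) :
  representable f -> representable (fun e => k%:~R * f e).
Proof.
move=> rf; case: k => k.
  by apply: eq_representable (representable_mulrn k rf) => e; rewrite -pmulrn mulr_natl.
apply: eq_representable (representableN (representable_mulrn k.+1 rf)) => e.
by rewrite NegzE mulrNz mulNr -pmulrn mulr_natl.
Qed.

Lemma representable_div_prime f p :
  S p -> representable f -> representable (fun e => f e / p%:R).
Proof.
move=> Sp [tau H].
exists (@App (expand grp_sig (div_sig S)) _ (inr (exist _ p Sp)) (fun=> tau)) => e.
by rewrite /deval /xeval /= -/(@xeval _ _ _) /div_interp -H.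
Qed.

(** Only prime divisions are connectives, so [N] is divided out one smallest prime factor at a
    time. *)
Lemma representable_divn f N :
  (0 < N)%N -> (forall p, prime p -> (p %| N)%N -> S p) ->
  representable f -> representable (fun e => f e / N%:R).
Proof.
elim/ltn_ind: N => N IH N0 NS rf.
have [N1|N1] := leqP N 1.
  apply: eq_representable rf => e; rewrite (_ : N = 1%N) ?divr1 //.
  by case: N N0 N1 {IH NS} => [|[]].
pose p := pdiv N; have pp : prime p := pdiv_prime N1.
have pN : (p %| N)%N := pdiv_dvd N.
have NE : N = (N %/ p * p)%N by rewrite divnK.
have M0 : (0 < N %/ p)%N by rewrite divn_gt0 ?prime_gt0 // dvdn_leq.
have := representable_div_prime (NS p pp pN) (IH (N %/ p)%N _ M0 _ rf).
have lt : (N %/ p < N)%N by rewrite ltn_Pdiv ?prime_gt1.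
have dv q : prime q -> (q %| N %/ p)%N -> S q.
  by move=> pq qN; apply: NS => //; rewrite NE dvdn_mulr.
move=> /(_ lt dv); apply: eq_representable => e.
by rewrite [in RHS]NE natrM invfM mulrA.
Qed.

Lemma representable_scale f q :
  in_loc S q -> representable f -> representable (fun e => q * f e).
Proof.
move=> /in_loc_ex [N [z [N0 NS qN]]] rf.
apply: eq_representable (representable_divn N0 NS (representable_mulrz z rf)) => e.
by rewrite -qN mulrAC mulfK // pnatr_eq0 -lt0n.
Qed.

Lemma representable_bigmin f (T : eqType) (s : seq T)
    (fs : T -> ('I_n -> rat) -> rat) :
  representable f -> (forall t, t \in s -> representable (fs t)) ->
  representable (fun e => \big[Num.min/f e]_(t <- s) fs t e).
Proof.
move=> rf; elim: s => [|t s IH] rfs.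
  by apply: eq_representable rf => e; rewrite big_nil.
have rs u : u \in s -> representable (fs u).
  by move=> us; apply: rfs; rewrite inE us orbT.
have [tau Htau] := representable_min (rfs t (mem_head _ _)) (IH rs).
by exists tau => e; rewrite Htau big_cons.
Qed.

Lemma bigmin_eq (T : eqType) (s : seq T) (F : T -> rat) (c : rat) t0 :
  t0 \in s -> F t0 = c -> (forall t, t \in s -> c <= F t) -> forall a, c <= a ->
  \big[Num.min/a]_(t <- s) F t = c.
Proof.
move=> t0s Ft0 H a ca; apply/eqP; rewrite eq_le; apply/andP; split.
  rewrite -Ft0; elim: s t0s {H} => // t s IH.
  rewrite inE big_cons ge_min => /orP[/eqP <-|/IH ->]; by rewrite ?lexx ?orbT.
elim: s H {t0s} => [|t s IH] H; first by rewrite big_nil.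
rewrite big_cons le_min H ?mem_head // IH // => u us.
by apply: H; rewrite inE us orbT.
Qed.

(* The solution map is the McShane extension [min_M (M x + K * err_M x)]:
   if the matrix [M] is wrong at [x], its error term, by the Lipschitz
   estimate for uniqueness, compensates the deviation from the solution. *)
Lemma representable_solution (m : nat) (Fs : seq (form grp_sig ('I_n + 'I_m))) :
  (forall x z z', sol Fs x z -> sol Fs x z' -> z = z') ->
  (forall x, exists z, sol Fs x z) ->
  (forall (v : 'I_n -> int) z, sol Fs (fun i => (v i)%:~R) z ->
     forall j, in_loc S (z j)) ->
  exists tau : 'I_m -> form (expand grp_sig (div_sig S)) 'I_n,
    forall e, sol Fs e (fun j => deval e (tau j)).
Proof.
move=> U E loc; have [Ms cov Mloc] := sol_in_loc_cover U E loc.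
suff H j : exists tau : form (expand grp_sig (div_sig S)) 'I_n,
    forall e z, sol Fs e z -> deval e tau = z j.
  have [tau Htau] := choice H; exists tau => e; have [z ez] := E e.
  suff -> : (fun j => deval e (tau j)) = z by [].
  by apply/funext => j; apply: Htau.
pose v1 : 'I_n + 'I_m -> form grp_sig (('I_n + 'I_m) + 'I_m) := fun v => Var (inl v).
pose v2 : 'I_n + 'I_m -> form grp_sig (('I_n + 'I_m) + 'I_m) :=
  sumf (fun i => Var (inl (inl i))) (fun k => Var (inr k)).
(* Uniqueness, stated in variables [x, z, z'], is a valid consequence. Its Lipschitz form bounds
   [|z'_j - z_j|] by [K] times the total failure of the system at [(x, z)] and [(x, z')]. *)
have [e He|K HK] := @rat_valid_Lipschitz _
    (map (subst v1) Fs ++ map (subst v2) Fs)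
    (gimpf (Var (inl (inr j))) (Var (inr j))).
  rewrite geval_gimpf /=; apply/eqP; rewrite subr_eq0; apply/eqP.
  pose x i := e (inl (inl i)); pose z k := e (inl (inr k)); pose z' k := e (inr k).
  apply: (congr1 (@^~ j) (_ : z' = z)); apply: (U x) => phi phiF.
    have := He (subst v2 phi); rewrite geval_subst mem_cat map_f ?orbT // => /(_ isT) <-.
    by congr geval; apply/funext => -[].
  have := He (subst v1 phi); rewrite geval_subst mem_cat map_f // => /(_ isT) <-.
  by congr geval; apply/funext => -[].
pose err M e := \sum_(phi <- Fs) `|geval (sumf e (apply_mx M e)) phi|.
have bound M e z : sol Fs e z -> `|apply_mx M e j - z j| <= err M e *+ K.
  move=> ez; have := HK (sumf (sumf e z) (apply_mx M e)).
  rewrite geval_gimpf /= big_cat !big_map /=.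
  rewrite big1_seq ?add0r => [|phi /= phiF]; last first.
    rewrite geval_subst [X in geval X](_ : _ = sumf e z) ?ez ?normr0 //.
  congr (_ <= _ *+ _); apply: eq_bigr => phi _; rewrite geval_subst.
  by congr (`|geval _ _|); apply/funext => -[].
(* A cover is nonempty; [M0] supplies the initial value of the minimum, for which Q offers no top
   element. *)
have [M0 M0Ms _] := cov (fun=> 0).
pose cand M e := apply_mx M e j + err M e *+ K.
have rep_cand M : M \in Ms -> representable (cand M).
  move=> /Mloc Ml.
  have rA k : representable (fun e => apply_mx M e k).
    apply: representable_sum => i.
    apply: eq_representable (representable_scale (Ml i k) (representable_var i)) => e.
    exact: mulrC.
  apply: representableD (rA j) _; apply: representable_mulrn.
  apply: representable_sum => phi; apply: representable_norm.
  have := @representable_geval _ (sumf (fun i e => e i) (fun k e => apply_mx M e k)) phi.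
  move=> h; apply: eq_representable (h _) => [e|[i|k]]; last exact: rA.
    by congr geval; apply/funext => -[].
  exact: representable_var.
have [tau Htau] := representable_bigmin (rep_cand M0 M0Ms) rep_cand.
exists tau => e z ez; rewrite Htau.
have [M1 M1Ms eM1] := cov e; have M1z := U _ _ _ eM1 ez.
have ge M : M \in Ms -> z j <= cand M e.
  move=> _; have := bound M e z ez; rewrite ler_norml => /andP[h _].
  by rewrite /cand; lra.
apply: bigmin_eq M1Ms _ ge _ (ge _ M0Ms).
rewrite /cand /err M1z big1_seq ?mul0rn ?addr0 // => phi /= phiF.
by rewrite ez ?normr0.
Qed.

End Representable.

(** * Classification of algebraic expansions *)

Section GroupTerms.
Local Open Scope ring_scope.
Variable X : Type.
Implicit Types a b : form grp_sig X.

Definition gzero a := @App grp_sig X GZero (fun=> a).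
Definition gneg a := @App grp_sig X GNeg (fun=> a).
Definition gpart a := @App grp_sig X GJoin (two a (gzero a)).

Definition gmulz (k : int) a :=
  match k with
  | Posz n => iter n (gadd a) (gzero a)
  | Negz n => gneg (iter n.+1 (gadd a) (gzero a))
  end.

Lemma geval_gpart e a : geval e (gpart a) = Num.max (geval e a) 0.
Proof. by []. Qed.

Lemma geval_gadd e a b : geval e (gadd a b) = geval e a + geval e b.
Proof. by []. Qed.

Lemma geval_gneg e a : geval e (gneg a) = - geval e a.
Proof. by []. Qed.

Lemma geval_gmulz e k a : geval e (gmulz k a) = k%:~R * geval e a.
Proof.
have H n : geval e (iter n (gadd a) (gzero a)) = n%:R * geval e a.
  elim: n => [|n IH]; first by rewrite mul0r.
  by rewrite [in RHS]mulrS mulrDl mul1r -IH.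
case: k => n; first by rewrite -pmulrn -H.
by rewrite NegzE mulrNz mulNr -pmulrn -H.
Qed.

End GroupTerms.

Lemma subst_gpart (X Y : Type) (s : X -> form grp_sig Y) a :
  subst s (gpart a) = gpart (subst s a).
Proof. by rewrite /gpart /=; congr App; apply/funext => -[[|[|//]] ?]. Qed.

Lemma subst_gmulz (X Y : Type) (s : X -> form grp_sig Y) k a :
  subst s (gmulz k a) = gmulz k (subst s a).
Proof.
have H n : subst s (iter n (gadd a) (gzero a)) =
    iter n (gadd (subst s a)) (gzero (subst s a)).
  elim: n => // n IH; rewrite !iterS -IH /gadd /=; congr App.
  by apply/funext => -[[|[|//]] ?].
case: k => n; first exact: H.
by rewrite /gmulz -H.
Qed.

Definition solves (P : system grp_sig) x z :=
  forall phi, sys_forms P phi -> geval (sumf x z) phi = 0%R.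
Arguments solves : clear implicits.

Definition unique_solutions (P : system grp_sig) :=
  forall x z z', solves P x z -> solves P x z' -> z = z'.

Lemma solves_sol (P : system grp_sig) : exists Fs : seq (form grp_sig _),
  sys_forms P = [set` Fs]%classic /\
  forall x z, solves P x z <-> sol Fs x z.
Proof.
have /finite_seqP [Fs FsE] := @sys_finite _ P; exists Fs; split=> // x z.
by rewrite /solves FsE.
Qed.

Lemma solves_scale (P : system grp_sig) (c : rat) x z : (0 <= c)%R ->
  solves P x z -> solves P (fun i => c * x i)%R (fun j => c * z j)%R.
Proof.
by have [Fs [_ H]] := solves_sol P; rewrite !H; apply: sol_scale.
Qed.

Section UniqueRule.
Local Open Scope ring_scope.

(** Uniqueness over Q is a quasi-identity in three blocks of variables, so it becomes derivable in
    every extension of Bal. *)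
Lemma unique_solutions_rule (r : signature) (L : logic (expand grp_sig r))
    (P : system grp_sig) G a b c j :
  extends_Bal L -> unique_solutions P ->
  holds_inst L P G a b -> holds_inst L P G a c -> L G (fimp (b j) (c j)).
Proof.
move=> LB U Hb Hc; have [Fs [FsE FsP]] := solves_sol P.
pose n := n_in P; pose m := n_out P.
pose v1 : 'I_n + 'I_m -> form grp_sig (('I_n + 'I_m) + 'I_m) := fun v => Var (inl v).
pose v2 : 'I_n + 'I_m -> form grp_sig (('I_n + 'I_m) + 'I_m) :=
  sumf (fun i => Var (inl (inl i))) (fun k => Var (inr k)).
pose s := sumf (sumf a b) c.
have -> : fimp (b j) (c j) = fsubst s (gimpf (Var (inl (inr j))) (Var (inr j))).
  by rewrite fsubst_gimpf.
apply: (Bal_instance (Gam := map (subst v1) Fs ++ map (subst v2) Fs)) => //.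
  move=> e He.
  rewrite geval_gimpf /=; apply/eqP; rewrite subr_eq0; apply/eqP.
  pose x i := e (inl (inl i)); pose z k := e (inl (inr k)); pose z' k := e (inr k).
  apply: (congr1 (@^~ j) (_ : z' = z)); apply: (U x); apply/FsP => phi phiF.
    have := He (subst v2 phi); rewrite geval_subst mem_cat map_f ?orbT // => /(_ isT) <-.
    by congr geval; apply/funext => -[].
  have := He (subst v1 phi); rewrite geval_subst mem_cat map_f // => /(_ isT) <-.
  by congr geval; apply/funext => -[].
move=> g; rewrite mem_cat => /orP[] /mapP[phi phiF ->]; rewrite fsubst_subst.
  by apply: Hb; rewrite FsE.
rewrite [_ \o _](_ : _ = sumf a c); first by apply: Hc; rewrite FsE.
by apply/funext => -[].
Qed.

End UniqueRule.

(** * Consistency forces unique solvability over Q *)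

Section Consistency.
Local Open Scope ring_scope.

Definition inconsistent (r : signature) (L : logic (expand grp_sig r)) :=
  L set0%classic (Var 0).

Lemma inconsistentP (r : signature) (L : logic (expand grp_sig r)) :
  inconsistent L -> forall G phi, L G phi.
Proof. by move=> H G phi; have := entails_inst G (fun=> phi) H. Qed.

(** Substituting [-v] for [v] proves the negative part as well, and [v] is the difference of the
    two. *)
Lemma pos_inconsistent (r : signature) (L : logic (expand grp_sig r)) :
  extends_Bal L ->
  L set0%classic (fsubst (fun=> Var 0%N) (gpart (Var (ord0 : 'I_1)))) -> inconsistent L.
Proof.
move=> LB H; pose s : 'I_1 -> form (expand grp_sig r) nat := fun=> Var 0%N.
pose v : form grp_sig 'I_1 := Var ord0.
apply: (Bal_instance (s := s) (phi := v) (Gam := [:: gpart v; gpart (gneg v)])) => //.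
  move=> e He; have h1 := He _ (mem_head _ _).
  have : geval e (gpart (gneg v)) = 0 by apply: He; rewrite !inE eqxx orbT.
  move: h1; rewrite !geval_gpart /geval /=.
  by case: (leP (e ord0) 0); case: (leP (- e ord0) 0); lra.
move=> g; rewrite !inE => /orP[] /eqP -> //.
have -> : gpart (gneg v) = subst (fun=> gneg v) (gpart v).
  by rewrite subst_gpart.
rewrite fsubst_subst.
by have := entails_inst set0%classic (fun=> fsubst s (gneg v)) H; rewrite subst_fsubst.
Qed.

Variables (Sigma : set (system grp_sig)) (P : {P | Sigma P}).
Hypothesis consistent : ~ inconsistent (Bal_ae Sigma).

Let LB := @Bal_ae_extends Sigma.

(** By homogeneity [N z g] and [N z' g], with [g = v^+], are provably solutions at [N x g]. The
    uniqueness rule equates them, and where [z_j] and [z'_j] differ this proves [g]. *)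
Lemma consistent_unique : unique_solutions (sval P).
Proof.
move=> x z z' xz xz'; apply/funext => j; apply: contrapT => zz'; apply: consistent.
pose n := n_in (sval P); pose m := n_out (sval P).
have [N [v [N0 vE]]] := common_denominator (sumf (sumf x z) z').
pose g := gpart (Var (ord0 : 'I_1)).
pose t w : form grp_sig 'I_1 := gmulz (v w) g.
pose s : 'I_1 -> form (expand grp_sig (family_sig Sigma)) nat := fun=> Var 0%N.
pose c i := fsubst s (t (inl (inl i))).
have tE e w : geval e (t w) = geval e g * N%:R * sumf (sumf x z) z' w.
  by rewrite geval_gmulz -vE; ring.
have g0 e : 0 <= geval e g by rewrite geval_gpart le_max lexx orbT.
have inst y u : solves (sval P) x y -> (forall k, sumf (sumf x z) z' (u k) = y k) ->
    holds_inst (Bal_ae Sigma) (sval P) set0%classic c (fun k => fsubst s (t (u k))).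
  move=> xy uy phi Pphi; pose b := sumf (fun i => t (inl (inl i))) (t \o u).
  rewrite [X in fsubst X _](_ : _ = fsubst s \o b); last by apply/funext => -[].
  rewrite -fsubst_subst; apply: (Bal_instance (Gam := [::])) => // e _.
  have := @solves_scale (sval P) (geval e g * N%:R) x y _ xy.
  rewrite mulr_ge0 // => /(_ isT _ Pphi) <-; rewrite geval_subst.
  congr geval; apply/funext => -[i|k] /=; rewrite tE //.
  by rewrite uy.
have := @Bal_ae_unique Sigma P _ _ _ _ j
  (inst z (fun k => inl (inr k)) xz (fun=> erefl)) (inst z' inr xz' (fun=> erefl)).
rewrite -fsubst_gimpf => H; apply: (pos_inconsistent LB).
apply: (Bal_instance (phi := g) (Gam := [:: gimpf (t (inl (inr j))) (t (inr j))])) => //.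
  move=> e /(_ _ (mem_head _ _)); rewrite geval_gimpf !tE /= -mulrBr => /eqP.
  rewrite !mulf_eq0 => /orP[/orP[/eqP //|]|].
    by rewrite pnatr_eq0; case: N N0 {vE tE inst}.
  by rewrite subr_eq0 => /eqP E; case: zz'.
by move=> h; rewrite inE => /eqP ->.
Qed.

(** The connectives provide a solution at [N x g] with [g = v^+]. At a rational valuation with
    [g > 0] it would scale back to a solution at [x]; if there is none, [g = 0] follows and is
    provable. *)
Lemma consistent_exists x : exists z, solves (sval P) x z.
Proof.
apply: contrapT => nz; apply: consistent; have [Fs [FsE FsP]] := solves_sol (sval P).
pose n := n_in (sval P); pose m := n_out (sval P).
have [N [v [N0 vE]]] := common_denominator x.
pose g : form grp_sig ('I_1 + 'I_m) := gpart (Var (inl ord0)).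
pose a i := gmulz (v i) g.
pose b : 'I_n + 'I_m -> form grp_sig ('I_1 + 'I_m) := sumf a (fun k => Var (inr k)).
pose s0 : 'I_1 + 'I_m -> form (expand grp_sig (family_sig Sigma)) nat := fun=> Var 0%N.
pose s : 'I_1 + 'I_m -> form (expand grp_sig (family_sig Sigma)) nat :=
  sumf (fun=> Var 0%N) (fun k => fam_app k (fsubst s0 \o a)).
apply: (pos_inconsistent LB).
have -> : fsubst (fun=> Var 0%N) (gpart (Var (ord0 : 'I_1))) = fsubst s g.
  have -> : g = subst (fun=> Var (inl ord0)) (gpart (Var (ord0 : 'I_1))).
    by rewrite subst_gpart.
  by rewrite fsubst_subst.
apply: (Bal_instance (Gam := map (subst b) Fs)) => //.
  move=> e He; have : 0 <= geval e g by rewrite geval_gpart le_max lexx orbT.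
  rewrite le_eqVlt => /orP[/eqP //|g0]; case: nz.
  have c0 : 0 < geval e g * N%:R by rewrite mulr_gt0 // ltr0n.
  exists (fun k => (geval e g * N%:R)^-1 * e (inr k)).
  rewrite [x](_ : _ =
    (fun i => (geval e g * N%:R)^-1 * (geval e g * N%:R * x i))); last first.
    by apply/funext => i; rewrite mulKf // gt_eqF.
  apply: solves_scale; first by rewrite invr_ge0 ltW.
  apply/FsP => phi phiF; rewrite -(He _ (map_f _ phiF)) geval_subst.
  congr geval; apply/funext => -[i|k] //=.
  by rewrite /a geval_gmulz -vE [RHS]mulrC mulrA.
move=> _ /mapP[phi phiF ->]; rewrite fsubst_subst.
have -> : fsubst s \o b = sumf (fsubst s0 \o a) (fun k => fam_app k (fsubst s0 \o a)).
  pose v0 : form grp_sig 'I_1 := Var ord0.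
  have aE i : a i = subst (fun=> Var (inl ord0)) (gmulz (v i) (gpart v0)).
    by rewrite subst_gmulz subst_gpart.
  by apply/funext => -[i|k] //=; rewrite aE !fsubst_subst.
by apply: Bal_ae_exists; rewrite FsE.
Qed.

End Consistency.

Section Classification.
Local Open Scope ring_scope.

Lemma Bal_ae_to_BalS (Sigma : set (system grp_sig)) (S : set nat) :
  (S `<=` primes_set)%classic ->
  (forall P : {P | Sigma P}, unique_solutions (sval P)) ->
  (forall P : {P | Sigma P}, exists tau : 'I_(n_out (sval P)) ->
     form (expand grp_sig (div_sig S)) 'I_(n_in (sval P)),
     forall e, solves (sval P) e (fun j => deval e (tau j))) ->
  has_morphism (Bal_ae Sigma) (BalS S).
Proof.
move=> SP U H; pose tau P := projT1 (cid (H P)).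
have tauE P : forall e, solves (sval P) e (fun j => deval e (tau P j)).
  exact: (projT2 (cid (H P))).
exists (fun f : family_sig Sigma => tau (projT1 f) (projT2 f)).
apply: Bal_ae_morphism => [|P a phi Pphi|P G a b c j].
- exact: BalS_extends.
- apply: (@entails_mono _ _ [set` [::]]%classic) => //.
  apply: BalS_complete => // e _; rewrite /deval xeval_fsubst sumf_comp.
  have := tauE P (xeval (@div_interp S) e \o a) phi Pphi; rewrite -[RHS]/(0) => <-.
  congr (geval (sumf _ _) _); apply/funext => j /=.
  by rewrite /xeval eval_subst.
- exact: unique_solutions_rule (@BalS_extends S) (U P).
Qed.

(** If the denominator is [b p] and [u * numq q + w * p = 1], dividing by p gives
    [u b q + w = 1/p]. *)
Lemma bezout_denq (q : rat) p : prime p -> (p %| `|denq q|)%N ->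
  exists al be : int, al%:~R * q + be%:~R = p%:R^-1.
Proof.
move=> pp pq; have [b bE] : exists b : nat, denq q = (b * p)%N%:Z.
  by exists (`|denq q| %/ p)%N; rewrite divnK // absz_denq.
have cop : coprimez (numq q) p%:Z.
  rewrite /coprimez /gcdz /= -/(coprime _ _); apply: coprime_dvdr pq _.
  exact: coprime_num_den.
have /coprimezP [[u w] /= uw] := cop; exists (u * b%:Z), w.
have p0 : p%:R != 0 :> rat by rewrite pnatr_eq0 -lt0n prime_gt0.
have E : u%:~R * (q * (b%:R * p%:R)) + w%:~R * p%:R = 1 :> rat.
  have := congr1 (fun z : int => z%:~R : rat) uw.
  by rewrite rmorphD !rmorphM /= numqE bE -!pmulrn natrM.
by apply: (mulIf p0); rewrite mulVf // -[RHS]E rmorphM /= -pmulrn; ring.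
Qed.

(** With [al * z_j + be = 1/p], the solution at [v u^+] has j-th coordinate [z_j u^+], so [al] times
    it plus [be u^+] is [u^+ / p]. Subtracting the same expression for the negative part gives
    [u / p], because the solution map respects only nonnegative factors. *)
Lemma BalS_to_Bal_ae (Sigma : set (system grp_sig)) (S : set nat) :
  (S `<=` primes_set)%classic ->
  (forall p, S p -> exists (P : {P | Sigma P}) (v : _ -> int) z j,
     [/\ unique_solutions (sval P), solves (sval P) (fun i => (v i)%:~R) z &
         (p %| `|denq (z j)|)%N]) ->
  has_morphism (BalS S) (Bal_ae Sigma).
Proof.
move=> SP H; have LB := @Bal_ae_extends Sigma.
suff key (h : div_sig S) : exists tau : form (expand grp_sig (family_sig Sigma)) 'I_1,
    forall x, Bal_ae Sigma set0%classic
      (fsubst (two x (subst (fun=> x) tau)) (gdiv_axiom (sval h))).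
  have [T HT] := choice key; exists T; exact: BalS_morphism_criterion.
case: h => p Sp /=; have pp := SP p Sp.
have [P [v [z [j [U vz pz]]]]] := H p Sp.
have [al [be albe]] := bezout_denq pp pz.
have [Fs [FsE FsP]] := solves_sol (sval P).
pose n := n_in (sval P); pose m := n_out (sval P).
pose X := ('I_1 + ('I_m + 'I_m))%type.
pose u1 : form grp_sig 'I_1 := Var ord0.
pose a1 (i : 'I_n) := gmulz (v i) (gpart u1).
pose a2 (i : 'I_n) := gmulz (v i) (gpart (gneg u1)).
pose u : form grp_sig X := Var (inl ord0).
pose y1 k : form grp_sig X := Var (inr (inl k)).
pose y2 k : form grp_sig X := Var (inr (inr k)).
pose lift1 := subst (fun _ : 'I_1 => u).
pose B := gadd (gadd (gmulz al (y1 j)) (gmulz be (gpart u)))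
  (gneg (gadd (gmulz al (y2 j)) (gmulz be (gpart (gneg u))))).
pose s Y (x : form (expand grp_sig (family_sig Sigma)) Y) :=
  sumf (fun _ : 'I_1 => x)
    (sumf (fun k => fam_app k (fun i => fsubst (fun=> x) (a1 i)))
          (fun k => fam_app k (fun i => fsubst (fun=> x) (a2 i)))).
exists (fsubst (s 'I_1 (Var ord0)) B) => x.
have -> : subst (fun=> x) (fsubst (s 'I_1 (Var ord0)) B) = fsubst (s _ x) B.
  rewrite subst_fsubst /s !sumf_comp; congr (fsubst (sumf _ (sumf _ _)) B);
  by apply/funext => k; congr App; apply/funext => i; apply: subst_fsubst.
have -> : fsubst (two x (fsubst (s _ x) B)) (gdiv_axiom p) =
    fsubst (s _ x) (subst (two u B) (gdiv_axiom p)).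
  by rewrite [RHS]fsubst_subst comp_two.
pose c1 := sumf (lift1 \o a1) y1; pose c2 := sumf (lift1 \o a2) y2.
apply: (@Bal_instance _ _ (Bal_ae Sigma) (s _ x) (map (subst c1) Fs ++
    map (subst c2) Fs) (subst (two u B) (gdiv_axiom p)) _ LB).
  move=> e He.
  have sol1 : solves (sval P) (fun i => geval e (lift1 (a1 i))) (fun k => e (inr (inl k))).
    apply/FsP => phi phiF.
    have <- := He (subst c1 phi); last by rewrite mem_cat map_f.
    by rewrite geval_subst; congr geval; apply/funext => -[].
  have sol2 : solves (sval P) (fun i => geval e (lift1 (a2 i))) (fun k => e (inr (inr k))).
    apply/FsP => phi phiF.
    have <- := He (subst c2 phi); last by rewrite mem_cat map_f ?orbT.
    by rewrite geval_subst; congr geval; apply/funext => -[].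
  pose g1 := Num.max (e (inl ord0)) 0; pose g2 := Num.max (- e (inl ord0)) 0.
  have g1P : 0 <= g1 by rewrite le_max lexx orbT.
  have g2P : 0 <= g2 by rewrite le_max lexx orbT.
  have E1 : e (inr (inl j)) = g1 * z j.
    suff /(congr1 (@^~ j)) : (fun k => e (inr (inl k))) = (fun k => g1 * z k) by [].
    apply: U sol1 _; have := solves_scale g1P vz; congr (solves _ _ _).
    apply/funext => i.
    by rewrite /lift1 /a1 subst_gmulz subst_gpart geval_gmulz mulrC.
  have E2 : e (inr (inr j)) = g2 * z j.
    suff /(congr1 (@^~ j)) : (fun k => e (inr (inr k))) = (fun k => g2 * z k) by [].
    apply: U sol2 _; have := solves_scale g2P vz; congr (solves _ _ _).
    apply/funext => i.
    by rewrite /lift1 /a2 subst_gmulz subst_gpart geval_gmulz mulrC.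
  rewrite geval_subst geval_gdiv_axiom ?prime_gt0 //.
  rewrite -[LHS]/(p%:R * geval e B - e (inl ord0)).
  have -> : geval e B = (al%:~R * z j + be%:~R) * (g1 - g2).
    rewrite /B !geval_gadd geval_gneg geval_gadd !geval_gmulz !geval_gpart.
    rewrite [geval e (y1 j)]E1 [geval e (y2 j)]E2.
    rewrite -[Num.max (geval e u) 0]/g1 -[Num.max (geval e (gneg u)) 0]/g2.
    ring.
  rewrite albe mulVKf; last by rewrite pnatr_eq0 -lt0n prime_gt0.
  rewrite /g1 /g2; case: (leP (e (inl ord0)) 0); case: (leP (- e (inl ord0)) 0); lra.
move=> g; rewrite mem_cat => /orP[] /mapP[phi phiF ->]; rewrite fsubst_subst.
  rewrite [_ \o _](_ : _ = sumf (fun i => fsubst (fun=> x) (a1 i))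
    (fun k => fam_app k (fun i => fsubst (fun=> x) (a1 i)))).
    by apply: Bal_ae_exists; rewrite FsE.
  by apply/funext => -[i|k] //=; rewrite /lift1 fsubst_subst.
rewrite [_ \o _](_ : _ = sumf (fun i => fsubst (fun=> x) (a2 i))
  (fun k => fam_app k (fun i => fsubst (fun=> x) (a2 i)))).
  by apply: Bal_ae_exists; rewrite FsE.
by apply/funext => -[i|k] //=; rewrite /lift1 fsubst_subst.
Qed.

Definition solution_primes (Sigma : set (system grp_sig)) : set nat :=
  [set p | prime p /\ exists (P : {P | Sigma P}) (v : _ -> int) z j,
     solves (sval P) (fun i => (v i)%:~R) z /\ (p %| `|denq (z j)|)%N]%classic.

Lemma Bal_ae_classification Sigma : ~ inconsistent (Bal_ae Sigma) ->
  exists2 S : set nat, (S `<=` primes_set)%classic &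
    has_morphism (Bal_ae Sigma) (BalS S) /\ has_morphism (BalS S) (Bal_ae Sigma).
Proof.
move=> cons; pose S := solution_primes Sigma.
have SP : (S `<=` primes_set)%classic by move=> p [].
exists S => //; split; last first.
  apply: BalS_to_Bal_ae => // p [pp [P [v [z [j [vz pz]]]]]].
  by exists P, v, z, j; split=> //; apply: consistent_unique.
apply: Bal_ae_to_BalS => // [P|P]; first exact: consistent_unique.
have [Fs [FsE FsP]] := solves_sol (sval P).
have [x z z'|x|v z|tau Htau] := @representable_solution S _ _ Fs.
- by rewrite -!FsP; apply: consistent_unique.
- by have [z /FsP xz] := consistent_exists cons x; exists z.
- move=> /FsP vz j p pp pz; split=> //.
  by exists P, v, z, j.
- by exists tau => e; apply/FsP.
Qed.

End Classification.

(** * Realizing each Bal^S and the inconsistent logic *)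

Section Realization.
Local Open Scope ring_scope.

Lemma div_system_finite p : finite_set
  [set subst (two (Var (inl ord0)) (Var (inr ord0))) (gdiv_axiom p)
     : form grp_sig ('I_1 + 'I_1)]%classic.
Proof. exact: finite_set1. Qed.

Definition div_system p := System (div_system_finite p).

Lemma solves_div_system p x z : prime p ->
  solves (div_system p) x z <-> z ord0 = x ord0 / p%:R.
Proof.
move=> pp; have p0 : p%:R != 0 :> rat by rewrite pnatr_eq0 -lt0n prime_gt0.
split=> [/(_ _ erefl)|zx phi ->]; rewrite geval_subst geval_gdiv_axiom ?prime_gt0 //=.
  by move/eqP; rewrite subr_eq0 => /eqP <-; rewrite mulrC mulKf.
by rewrite zx mulrCA divff // mulr1 subrr.
Qed.

Lemma div_system_unique p : prime p -> unique_solutions (div_system p).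
Proof.
move=> pp x z z' /solves_div_system - /(_ pp) zx /solves_div_system - /(_ pp) zx'.
by apply/funext => i; rewrite (ord1 i) zx zx'.
Qed.

Lemma div_systems_morphisms (S : set nat) (SP : (S `<=` primes_set)%classic) :
  has_morphism (Bal_ae (div_system @` S)%classic) (BalS S) /\
  has_morphism (BalS S) (Bal_ae (div_system @` S)%classic).
Proof.
split.
  apply: Bal_ae_to_BalS => // -[_ /= [p Sp <-]]; first exact/div_system_unique/SP.
  exists (fun=> @App (expand grp_sig (div_sig S)) _ (inr (exist _ p Sp)) Var) => e.
  by apply/solves_div_system; first exact: SP.
apply: BalS_to_Bal_ae => // p Sp.
exists (exist _ (div_system p) (ex_intro2 _ _ p Sp erefl)).
exists (fun=> 1), (fun=> p%:R^-1), ord0; split=> /=.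
- exact/div_system_unique/SP.
- by apply/solves_div_system; [exact: SP|rewrite mul1r].
- by rewrite pmulrn denqVz // -lt0n prime_gt0 //; apply: SP.
Qed.

Lemma empty_system_finite : finite_set (@set0 (form grp_sig ('I_0 + 'I_1))).
Proof. exact: finite_set0. Qed.

(** With one output and no condition everything is a solution, so the uniqueness rule identifies all
    formulas; this realizes the top element. *)
Definition empty_system := System empty_system_finite.

Lemma empty_system_inconsistent : inconsistent (Bal_ae [set empty_system]%classic).
Proof.
pose P : {P | [set empty_system]%classic P} := exist _ empty_system erefl.
pose L := Bal_ae [set empty_system]%classic.
have H b c : L set0%classic (fimp b c).
  have := @Bal_ae_unique _ P set0%classic (fun=> Var 0%N) (fun=> b) (fun=> c) ord0.
  by apply=> phi [].
have LB := @Bal_ae_extends [set empty_system]%classic.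
exact: (fimp_mp LB (H (Var 0%N) (Var 0%N)) (H _ _)).
Qed.

Lemma BalS_consistent S : (S `<=` primes_set)%classic -> ~ inconsistent (BalS S).
Proof.
move=> SP /(BalS_sound SP (e := fun=> 1)) H.
by have := H (fun _ => False_ind _).
Qed.

End Realization.

(** * The lattice of algebraic expansions *)

(** Any translation is a morphism here; the constant 0 provides a term for every arity. *)
Lemma inconsistent_target (L1 L2 : expansion grp_sig) :
  inconsistent L2 -> has_morphism L1 L2.
Proof.
move=> inc; pose zero n : form (expand grp_sig (new_sig L2)) 'I_n :=
  @App (expand grp_sig (new_sig L2)) _ (inl GZero)
    (fun i => let: Ordinal _ h := i in False_rect _ (notF h)).
by exists (fun h => zero (ar h)) => G phi _; apply: inconsistentP.
Qed.

Lemma inconsistent_source (L1 L2 : expansion grp_sig) :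
  has_morphism L1 L2 -> inconsistent L1 -> inconsistent L2.
Proof. by move=> [T MT] /MT /=; rewrite image_set0. Qed.

Lemma inconsistent_expP : inconsistent inconsistent_exp.
Proof. exact: I. Qed.

Lemma inconsistent_equipollent (L1 L2 : expansion grp_sig) :
  inconsistent L1 -> inconsistent L2 -> equipollent L1 L2.
Proof.
move=> i1 i2; have [T MT] := inconsistent_target L1 i2.
have [S MS] := inconsistent_target L2 i1.
by exists T, S; split=> // phi; split; apply: inconsistentP.
Qed.

Lemma Bal_ae_equipollentP Sigma Sigma' :
  equipollent (Bal_ae Sigma) (Bal_ae Sigma') <->
  has_morphism (Bal_ae Sigma) (Bal_ae Sigma') /\
  has_morphism (Bal_ae Sigma') (Bal_ae Sigma).
Proof.
split; first exact: equipollent_morphisms.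
move=> [H H']; apply: rigid_equipollent => //;
  by [apply: Bal_ae_extends|apply: Bal_ae_rigid].
Qed.

Lemma Bal_ae_equipollent_unique Sigma :
  ~ inconsistent (Bal_ae Sigma) -> exists! S : set nat,
    (S `<=` primes_set)%classic /\ equipollent (Bal_ae Sigma) (BalS S).
Proof.
move=> /Bal_ae_classification [S SP [m1 m2]]; exists S; split.
  split=> //; apply: rigid_equipollent m1 m2.
  - exact: Bal_ae_extends.
  - exact: BalS_extends.
  - exact: Bal_ae_rigid.
  - exact: BalS_rigid.
move=> S' [SP' /equipollent_morphisms [m1' m2']]; apply/seteqP; split.
  by apply: BalS_has_morphism => //; apply: has_morphism_trans m2 m1'.
by apply: BalS_has_morphism => //; apply: has_morphism_trans m2' m1.
Qed.

(** The power set in the target lattice is that of [nat], so sets of primes are indexed through a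
    bijection. *)
Lemma primes_enumeration : exists pr : nat -> nat,
  [/\ forall k, prime (pr k), injective pr & forall p, prime p -> exists k, pr k = p].
Proof.
have inf : infinite_set primes_set.
  move=> /finite_seqP [s sE]; have [p lt pp] := prime_above (\max_(q <- s) q).
  have : p \in s by have : primes_set p by []; rewrite sE.
  by move=> ps; move: lt; rewrite (big_rem _ ps) /= gtn_max ltnn.
have : ([set: nat] #= primes_set)%card.
  by rewrite card_eq_le; apply/andP; split; [apply/infiniteP|apply: subset_card_le].
move=> /card_set_bijP [pr [fun_pr inj_pr surj_pr]]; exists pr; split.
- by move=> k; apply: fun_pr.
- by move=> k l; apply: inj_pr; rewrite inE.
- by move=> p /surj_pr [k _ <-]; exists k.
Qed.

Section Lattice.
Local Open Scope classical_set_scope.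

Definition ae_class (Sigma : set (system grp_sig)) : Bal_ae_class :=
  exist _ [set Sigma' | equipollent (Bal_ae Sigma) (Bal_ae Sigma')]
    (ex_intro _ Sigma erefl).

Lemma ae_class_surj C : exists Sigma, C = ae_class Sigma.
Proof. by case: C => C [Sigma E]; exists Sigma; apply: eq_exist. Qed.

(** In the consistent case the endomorphism is obtained by passing to the equivalent Bal^S and
    back. *)
Lemma ae_class_refl Sigma : sval (ae_class Sigma) Sigma.
Proof.
apply/Bal_ae_equipollentP; suff h : has_morphism (Bal_ae Sigma) (Bal_ae Sigma) by [].
have [inc|cons] := pselect (inconsistent (Bal_ae Sigma)).
  exact: inconsistent_target.
have [S _ [m1 m2]] := Bal_ae_classification cons.
exact: has_morphism_trans m1 m2.
Qed.

Lemma ae_class_le Sigma Sigma' : Bal_ae_le (ae_class Sigma) (ae_class Sigma') <->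
  has_morphism (Bal_ae Sigma) (Bal_ae Sigma').
Proof.
split=> [[T [T' [/Bal_ae_equipollentP [m1 _] /Bal_ae_equipollentP [_ m2] m]]]|m].
  by apply: has_morphism_trans m1 _; apply: has_morphism_trans m m2.
by exists Sigma, Sigma'; split=> //; apply: ae_class_refl.
Qed.

Lemma ae_class_eq Sigma Sigma' :
  has_morphism (Bal_ae Sigma) (Bal_ae Sigma') ->
  has_morphism (Bal_ae Sigma') (Bal_ae Sigma) ->
  ae_class Sigma = ae_class Sigma'.
Proof.
move=> m m'; apply: eq_exist; apply/seteqP; split=> T /Bal_ae_equipollentP [h h'];
  apply/Bal_ae_equipollentP; split.
- exact: has_morphism_trans m' h.
- exact: has_morphism_trans h' m.
- exact: has_morphism_trans m h.
- exact: has_morphism_trans h' m'.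
Qed.

Variable pr : nat -> nat.
Hypothesis pr_prime : forall k, prime (pr k).
Hypothesis pr_inj : injective pr.
Hypothesis pr_surj : forall p, prime p -> exists k, pr k = p.

Definition code_systems (u : set nat + unit) : set (system grp_sig) :=
  match u with
  | inl A => div_system @` (pr @` A)
  | inr _ => [set empty_system]
  end.

Let pr_primes A : pr @` A `<=` primes_set.
Proof. by move=> _ [k _ <-]; apply: pr_prime. Qed.

Lemma code_systems_morphism u w :
  has_morphism (Bal_ae (code_systems u)) (Bal_ae (code_systems w)) <->
  pow_omega_top_le u w.
Proof.
case: u w => [A|[]] [B|[]] /=.
- have [a1 a2] := div_systems_morphisms (pr_primes (A := A)).
  have [b1 b2] := div_systems_morphisms (pr_primes (A := B)).
  split=> [m|AB].
    have : pr @` A `<=` pr @` B.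
      apply: BalS_has_morphism => //.
      by apply: has_morphism_trans a2 _; apply: has_morphism_trans m b1.
    by move=> sub k Ak; have [|l Bl /pr_inj <-] := sub (pr k); first by exists k.
  apply: has_morphism_trans a1 _; apply: has_morphism_trans b2.
  apply: BalS_morphism; exact: image_subset.
- by split=> // _; apply: inconsistent_target empty_system_inconsistent.
- split=> // m; have [b1 _] := div_systems_morphisms (pr_primes (A := B)).
  apply: (BalS_consistent (pr_primes (A := B))).
  apply: inconsistent_source b1 _.
  exact: inconsistent_source m empty_system_inconsistent.
- by split=> // _; apply: inconsistent_target empty_system_inconsistent.
Qed.

Definition code u := ae_class (code_systems u).

Lemma code_le u w : Bal_ae_le (code u) (code w) <-> pow_omega_top_le u w.
Proof. by rewrite ae_class_le code_systems_morphism. Qed.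

Lemma code_surj C : exists u, code u = C.
Proof.
have [Sigma ->] := ae_class_surj C.
have [inc|cons] := pselect (inconsistent (Bal_ae Sigma)).
  exists (inr tt); apply: ae_class_eq; apply: inconsistent_target => //.
  exact: empty_system_inconsistent.
have [S SP [m1 m2]] := Bal_ae_classification cons.
have SE : pr @` [set k | S (pr k)] = S.
  apply/seteqP; split=> [_ [k Sk <-] //|p Sp].
  by have [k kp] := pr_surj (SP p Sp); exists k; rewrite //= kp.
exists (inl [set k | S (pr k)]); rewrite /code /= SE.
have [a1 a2] := div_systems_morphisms SP.
by apply: ae_class_eq; [apply: has_morphism_trans a1 m2|apply: has_morphism_trans m1 a2].
Qed.

End Lattice.

Section PowOmegaTop.
Local Open Scope classical_set_scope.

Lemma pow_omega_top_lattice : is_lattice pow_omega_top_le.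
Proof.
split.
- split=> [[A|[]]//|[A|[]] [B|[]] //= AB BA|[A|[]] [B|[]] [C|[]] //=].
    by congr inl; apply/seteqP.
  exact: subset_trans.
- move=> [A|[]] [B|[]].
  + exists (inl (A `|` B)); split=> /= [x|x|[C|[]] //= AC BC x [/AC|/BC] //];
      by [left|right].
  + by exists (inr tt); split=> // -[].
  + by exists (inr tt); split=> // -[].
  + by exists (inr tt); split=> // -[].
- move=> [A|[]] [B|[]].
  + exists (inl (A `&` B)); split=> /= [x []//|x []//|[C|[]] //= CA CB x Cx].
    by split; [apply: CA|apply: CB].
  + by exists (inl A); split=> // x.
  + by exists (inl B); split=> // x.
  + by exists (inr tt); split=> // -[].
Qed.

End PowOmegaTop.

(** A surjection that preserves and reflects the order is injective by antisymmetry of [leB], so any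
    section of it is an isomorphism. *)
Lemma order_transport (A B : Type) (leA : A -> A -> Prop) (leB : B -> B -> Prop)
    (c : B -> A) :
  (forall x, exists u, c u = x) -> (forall u w, leA (c u) (c w) <-> leB u w) ->
  is_lattice leB -> is_lattice leA /\ order_isomorphic leA leB.
Proof.
move=> surj cle [[rB aB tB] jB mB]; have [g gK] := choice surj; split; last first.
  exists g; split=> [|x y]; last by rewrite -cle !gK.
  exists c => [x|u]; first exact: gK.
  by apply: aB; apply/cle; rewrite gK; apply/cle; apply: rB.
split.
- split=> [x|x y|x y z]; have [u <-] := surj x.
  + by rewrite cle.
  + by have [w <-] := surj y; rewrite !cle => uw wu; congr c; apply: aB.
  + by have [w <-] := surj y; have [t <-] := surj z; rewrite !cle; apply: tB.
- move=> x y; have [u <-] := surj x; have [w <-] := surj y.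
  have [j [uj wj H]] := jB u w; exists (c j); split=> [||z]; [exact/cle|exact/cle|].
  by have [t <-] := surj z; rewrite !cle; apply: H.
- move=> x y; have [u <-] := surj x; have [w <-] := surj y.
  have [j [ju jw H]] := mB u w; exists (c j); split=> [||z]; [exact/cle|exact/cle|].
  by have [t <-] := surj z; rewrite !cle; apply: H.
Qed.

Local Open Scope classical_set_scope.

Theorem theorem4p14 :
  (forall Sigma : set (system grp_sig),
     (equipollent (Bal_ae Sigma) inconsistent_exp /\
      ~ exists S : set nat,
          S `<=` primes_set /\ equipollent (Bal_ae Sigma) (BalS S))
     \/
     (~ equipollent (Bal_ae Sigma) inconsistent_exp /\
      exists! S : set nat,
        S `<=` primes_set /\ equipollent (Bal_ae Sigma) (BalS S)))
  /\
  (is_lattice Bal_ae_le /\ order_isomorphic Bal_ae_le pow_omega_top_le)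
  /\
  (forall (S S' : set nat) (sub : S `<=` S'), S' `<=` primes_set ->
     is_expansion (expand_map grp_sig (div_map sub)) (BalS S) (BalS S') /\
     conservative (expand_map grp_sig (div_map sub)) (BalS S) (BalS S')).
Proof.
split=> [Sigma|]; last split.
- have [inc|cons] := pselect (inconsistent (Bal_ae Sigma)); [left|right]; split.
  + exact: inconsistent_equipollent inconsistent_expP.
  + move=> [S [SP /equipollent_morphisms [m _]]].
    exact: BalS_consistent SP (inconsistent_source m inc).
  + move=> /equipollent_morphisms [_ m]; apply: cons.
    exact: inconsistent_source m inconsistent_expP.
  + exact: Bal_ae_equipollent_unique.
- have [pr [pr_prime pr_inj pr_surj]] := primes_enumeration.
  apply: (order_transport (c := code pr)) pow_omega_top_lattice.
    exact: code_surj.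
  exact: code_le.
- move=> S S' sub SP'; split; first exact: BalS_expansion.
  exact: BalS_conservative.
Qed.
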